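(* There exists an absolute constant $C_0>0$ such that the following holds. Let $\theta\in C([0,T);\dot B^1_{\infty,1}(\mathbb R^2))$ be a classical solution on $[0,T)$ of the inviscid quasi-geostrophic system $(QG)_0$ with initial datum $\theta_0\in\dot B^1_{\infty,1}(\mathbb R^2)$. Then for all $t\in[0,T)$ and all $\gamma\ge C_0$ we have the upper estimate $$\|\nabla\theta(t)\|_{L^\infty}\le\frac{\|\nabla\theta_0\|_{L^\infty}\exp\left[\gamma\int_0^t\|\nabla\theta(\tau)\|_{\dot B^0_{\infty,1}}d\tau\right]}{1+(\gamma-C_0)\|\nabla\theta_0\|_{L^\infty}\int_0^t\exp\left[\gamma\int_0^\tau\|\nabla\theta(\sigma)\|_{\dot B^0_{\infty,1}}d\sigma\right]d\tau}$$ and the lower estimate $$\|\nabla\theta(t)\|_{L^\infty}\ge\frac{\|\nabla\theta_0\|_{L^\infty}\exp\left[-\gamma\int_0^t\|\nabla\theta(\tau)\|_{\dot B^0_{\infty,1}}d\tau\right]}{1-(\gamma-C_0)\|\nabla\theta_0\|_{L^\infty}\int_0^t\exp\left[-\gamma\int_0^\tau\|\nabla\theta(\sigma)\|_{\dot B^0_{\infty,1}}d\sigma\right]d\tau}.$$ In particular, the denominator of the right-hand side of the lower estimate is bounded from below by $$1-(\gamma-C_0)\|\nabla\theta_0\|_{L^\infty}\int_0^t\exp\left[-\gamma\int_0^\tau\|\nabla\theta(\sigma)\|_{\dot B^0_{\infty,1}}d\sigma\right]d\tau\ge\frac{1}{\left(1+C_0\|\nabla\theta_0\|_{L^\infty}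\,t\right)^{\frac{\gamma}{C_0}-1}}.$$
   Context: $(QG)_0$ is the two-dimensional inviscid quasi-geostrophic system for a scalar $\theta=\theta(x,t)$, $x\in\mathbb R^2$: $$\partial_t\theta+(v\cdot\nabla)\theta=0,\qquad v=\nabla^\perp(-\Delta)^{-\frac12}\theta,\qquad\theta(x,0)=\theta_0(x),$$ with $\nabla^\perp=(-\partial_2,\partial_1)$. Homogeneous Besov spaces: with Fourier transform $\hat f(\xi)=(2\pi)^{-n/2}\int_{\mathbb R^n}e^{-ix\cdot\xi}f(x)dx$, fix a Schwartz function $\varphi$ on $\mathbb R^n$ (here $n=2$) such that (i) $\operatorname{supp}\hat\varphi\subset\{\frac12\le|\xi|\le2\}$; (ii) $\hat\varphi(\xi)\ge C>0$ for $\frac23<|\xi|<\frac32$; (iii) $\sum_{j\in\mathbb Z}\hat\varphi_j(\xi)=1$ (for $\xi\neq0$), where $\hat\varphi_j(\xi)=\hat\varphi(2^{-j}\xi)$. For $s\in\mathbb R$ put $$\|f\|_{\dot B^s_{\infty,1}}=\sum_{j\in\mathbb Z}2^{sj}\|\varphi_j*f\|_{L^\infty},$$ and let $\dot B^s_{\infty,1}(\mathbb R^n)$ be the space of $f$ with finite norm modulo polynomials. For vector-valued $f$ the same definition is used. Convention on representatives: elements of $\dot B^0_{\infty,1}$ such as $\nabla\theta$ and $\nabla v$ are identified with the bounded functions recovered from their Littlewood–Paley series $(2\pi)^{-n/2}\sum_j\varphi_j*f$, so that $\|f\|_{L^\infty}\le\|f\|_{\dot B^0_{\infty,1}}$. 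*)

(* Defs.v *)
From HB Require Import structures.
From mathcomp Require Import all_boot all_order all_algebra.
From mathcomp Require Import complex.
From mathcomp Require Import all_classical all_reals all_analysis.

Set Implicit Arguments.
Unset Strict Implicit.
Unset Printing Implicit Defensive.

Import Order.TTheory GRing.Theory Num.Theory.
Import numFieldNormedType.Exports.

Local Open Scope classical_set_scope.
Local Open Scope ring_scope.
Local Open Scope complex_scope.

Notation plane R := (R * R)%type.

Notation leb2 := (lebesgue_measure \x lebesgue_measure)%E.

(* The library norm on a product is the sup norm; [enorm] is the Euclidean one. *)
Definition enorm (R : realType) (x : plane R) : R :=
  Num.sqrt (x.1 ^+ 2 + x.2 ^+ 2).

Definition dot (R : realType) (x y : plane R) : R := x.1 * y.1 + x.2 * y.2.

Definition basis2 (R : realType) (i : 'I_2) : plane R :=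
  ((i == 0)%:R, (i == 1)%:R).

Definition partial (R : realType) (i : 'I_2) (f : plane R -> R) : plane R -> R :=
  fun x => 'D_(basis2 R i) f x.

Definition grad (R : realType) (f : plane R -> R) : 'I_2 -> plane R -> R :=
  fun i => partial i f.

(** ** Schwartz functions and the Fourier transform on the plane *)

Definition cmod (R : realType) (z : R[i]) : R := ComplexField.Normc.normc z.

Definition schwartzR (R : realType) (f : plane R -> R) : Prop :=
  forall s : seq 'I_2,
    (forall x, differentiable (foldr (@partial R) f s) x) /\
    (forall a b : nat, exists C : R, forall x,
       `| x.1 ^+ a * x.2 ^+ b * foldr (@partial R) f s x | <= C).

Definition schwartz (R : realType) (f : plane R -> R[i]) : Prop :=
  schwartzR (fun x => complex.Re (f x)) /\ schwartzR (fun x => complex.Im (f x)).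

Definition cintegral (R : realType) (f : plane R -> R[i]) : R[i] :=
  (\int[leb2]_x complex.Re (f x)) +i* (\int[leb2]_x complex.Im (f x)).

Definition cis (R : realType) (t : R) : R[i] := cos t +i* sin t.

(* Unitary normalisation: (2 pi)^(-n/2) with n = 2. *)
Definition fourier (R : realType) (f : plane R -> R[i]) : plane R -> R[i] :=
  fun xi => ((2 * pi)^-1)%:C * cintegral (fun x => cis (- dot x xi) * f x).

Definition inv_fourier (R : realType) (g : plane R -> R[i]) : plane R -> R[i] :=
  fun x => ((2 * pi)^-1)%:C * cintegral (fun xi => cis (dot x xi) * g xi).

Definition convolution (R : realType) (phi : plane R -> R[i]) (f : plane R -> R) :
    plane R -> R[i] :=
  fun x => cintegral (fun y => phi (x - y) * (f y)%:C).

(** ** Homogeneous Besov spaces *)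

(* [phi 0] is the function phi itself and [phi j] its dyadic rescaling phi_j.
   The sum over int in the last clause has finite support because of the second and
   third clauses, so the library's finitely supported sum applies. *)
Definition littlewood_paley (R : realType) (phi : int -> plane R -> R[i]) : Prop :=
  [/\ forall j, schwartz (phi j),
      forall j xi,
        fourier (phi j) xi =
        fourier (phi 0) (2 ^ (- j) * xi.1, 2 ^ (- j) * xi.2),
      closure [set xi : plane R | fourier (phi 0) xi != 0] `<=`
        [set xi | 2^-1 <= enorm xi <= 2],
      exists2 C : R, 0 < C &
        forall xi, 2 / 3 < enorm xi < 3 / 2 -> C%:C <= fourier (phi 0) xi
    & forall xi, xi != 0 -> \sum_(j \in [set: int]) fourier (phi j) xi = 1].

(* Functions that define a tempered distribution. *)
Definition tempered (R : realType) (f : plane R -> R) : Prop :=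
  measurable_fun [set: plane R] f /\
  exists N : nat, leb2.-integrable [set: plane R]
    (EFin \o (fun x => f x / (1 + enorm x) ^+ N)).

(* A vector field is a family of scalar functions indexed by a finite type; a
   scalar function is a family indexed by unit. *)
Definition besov_norm (R : realType) (phi : int -> plane R -> R[i]) (s : R)
    (I : finType) (F : I -> plane R -> R) : \bar R :=
  (\esum_(j in [set: int])
     ((2 `^ (s * j%:~R))%R%:E *
      'N[leb2]_+oo [EFin \o (fun x =>
         Num.sqrt (\sum_(i : I) cmod (convolution (phi j) (F i) x) ^+ 2)%R)]))%E.

Definition scalar_field (R : realType) (f : plane R -> R) : unit -> plane R -> R :=
  fun _ => f.

(* Elements of the space are classes modulo polynomials; this predicate is about
   a function representing such a class. *)
Definition in_besov (R : realType) (phi : int -> plane R -> R[i]) (s : R)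
    (I : finType) (F : I -> plane R -> R) : Prop :=
  (forall i, tempered (F i)) /\ (besov_norm phi s F < +oo)%E.

(* f is the bounded function recovered from its Littlewood-Paley series
   (2 pi)^(-1) sum_j phi_j * f. This is how a class modulo polynomials in
   B^0_(oo,1) is identified with a function. *)
Definition lp_recovered (R : realType) (phi : int -> plane R -> R[i])
    (f : plane R -> R) : Prop :=
  [/\ measurable_fun [set: plane R] f,
      exists M : R, forall x, `|f x| <= M
    & forall x,
        (fun n : nat =>
           cmod (((2 * pi)^-1)%:C *
                 (\sum_(k < (2 * n).+1) convolution (phi (k%:Z - n%:Z)) f x)
                 - (f x)%:C)) @ \oo --> (0 : R)].

Definition Linf_norm (R : realType) (I : finType) (F : I -> plane R -> R) : \bar R :=
  ('N[leb2]_+oo [EFin \o (fun x => Num.sqrt (\sum_(i : I) F i x ^+ 2)%R)])%E.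

(** ** The inviscid quasi-geostrophic system *)

(* g = m(D) f modulo polynomials, where m may be singular at the origin: by
   duality, tested against the Schwartz functions whose Fourier transform
   vanishes near the origin. *)
Definition fourier_multiplier (R : realType) (m : plane R -> R[i])
    (f g : plane R -> R) : Prop :=
  forall psi : plane R -> R[i], schwartz psi ->
    (exists2 e : R, 0 < e & forall xi, enorm xi < e -> fourier psi xi = 0) ->
    forall x,
      convolution psi g x = convolution (inv_fourier (fun xi => m xi * fourier psi xi)) f x.

Definition symbol_perp_grad (R : realType) (k : 'I_2) (xi : plane R) : R[i] :=
  if k == 0 then 0 +i* (- xi.2) else 0 +i* xi.1.

Definition symbol_inv_sqrt_lap (R : realType) (xi : plane R) : R[i] :=
  ((enorm xi)^-1)%:C.

(* On B^1_(oo,1) the formula for v determines v modulo polynomials only; the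
   convention on the representative of nabla v reduces this to a constant. *)
Definition qg_velocity (R : realType) (phi : int -> plane R -> R[i])
    (theta : plane R -> R) (v : 'I_2 -> plane R -> R) : Prop :=
  forall k : 'I_2,
    [/\ tempered (v k),
        fourier_multiplier
          (fun xi => symbol_perp_grad k xi * symbol_inv_sqrt_lap xi) theta (v k),
        forall x, differentiable (v k) x
      & forall i, lp_recovered phi (partial i (v k))].

Definition time_interval (R : realType) (T : \bar R) : set R :=
  [set t | 0 <= t /\ (t%:E < T)%E].

Definition continuous_in_besov (R : realType) (phi : int -> plane R -> R[i])
    (s : R) (T : \bar R) (theta : R -> plane R -> R) : Prop :=
  (forall t, time_interval T t -> in_besov phi s (scalar_field (theta t))) /\
  (forall t, time_interval T t ->
     besov_norm phi s (scalar_field (fun x => theta r x - theta t x))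
       @[r --> within (time_interval T) (nbhs t)] --> 0%E).

Definition jointly_continuous (R : realType) (T : \bar R)
    (f : R -> plane R -> R) : Prop :=
  {within [set p : R * plane R | time_interval T p.1],
     continuous (fun p : R * plane R => f p.1 p.2)}.

Definition qg_classical_solution (R : realType) (phi : int -> plane R -> R[i])
    (T : \bar R) (theta0 : plane R -> R) (theta : R -> plane R -> R) : Prop :=
  [/\ forall x, theta 0 x = theta0 x,
      jointly_continuous T theta,
      forall t, time_interval T t ->
        (forall x, differentiable (theta t) x) /\
        (forall i, lp_recovered phi (partial i (theta t)))
    & exists v : R -> 'I_2 -> plane R -> R,
        [/\ forall k, jointly_continuous T (fun t => v t k),
            forall t, time_interval T t -> qg_velocity phi (theta t) (v t)
          & forall t x, 0 < t -> (t%:E < T)%E ->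
              derivable (fun r => theta r x) t 1 /\
              derive1 (fun r => theta r x) t
                + \sum_(k < 2) v t k x * partial k (theta t) x = 0]].

(* Main.v *)
(** Write y for the sup norm of grad theta, B for its norm in the Besov space of
    order 0 and A for the integral of B. The theorem reduces to the two-sided bound

      y(t) <= y(s) exp(C0 (A(t) - A(s)))  and  y(s) <= y(t) exp(C0 (A(t) - A(s)))

    for s <= t, combined with y <= B: multiplying by exp(+- gamma A) turns the
    integrands of the three estimates into exact derivatives.

    The velocity is the perpendicular Riesz transform of theta, so on each dyadic
    block grad v is the convolution of grad theta with a Schwartz kernel whose L1
    norm does not depend on the block; summing over blocks gives |grad v| <= C B.
    Since theta is transported by v and grad theta need not be differentiable, y is
    propagated as a Lipschitz constant: doubling the variables, the function
    theta(t,x) - theta(t,y) - M (exp(2 C0 A) |x-y|^2 / (2 eta) + eta / 2), penalized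
    at infinity, cannot have a positive maximum. The backward bound is the same
    statement for the time-reversed flow. *)
From HB Require Import structures.
Require Import Defs.
From mathcomp Require Import all_boot all_order all_algebra.
From mathcomp Require Import complex ring lra zify.
From mathcomp Require Import all_classical all_reals all_analysis.
From mathcomp Require Import measurable_realfun ess_sup_inf.

Import Order.TTheory GRing.Theory Num.Theory.
Import numFieldNormedType.Exports.

Set Implicit Arguments.
Unset Strict Implicit.
Unset Printing Implicit Defensive.

Local Open Scope classical_set_scope.
Local Open Scope ring_scope.
Local Open Scope complex_scope.

(** * Integration on the plane *)

(** The equation gives v only modulo polynomials, tested against functions whose transform vanishes
    near the origin. Every bound on grad v is therefore proved block by block, and the convention on
    representatives turns the block bounds into pointwise ones. The functions phi_j are given only
    through their transforms, so Fourier inversion is established first: it identifies the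
    derivatives of phi_j with multiplier kernels. The same kernels with a symbol of degree 1 yield
    Bernstein's inequality, which makes B finite and continuous in time. Three points fix the
    constants. C0 is twice the Riesz constant plus 1, the 1 keeping it positive. The inequality y <=
    B holds with constant exactly 1, thanks to the factor (2 pi)^-1 of the series; any other
    constant would appear in the denominators. The equation is only available at positive times, so
    the backward bound is first proved down to a > 0 and reaches 0 by a limit in its Lipschitz form,
    where continuity of theta suffices and none of y is needed. *)

Lemma open_plane_measurable (R : realType) (U : set (plane R)) :
  open U -> measurable U.
Proof.
move=> oU.
pose box (q : (rat * rat) * (rat * rat)) : set (plane R) :=
  `]ratr q.1.1, ratr q.1.2[ `*` `]ratr q.2.1, ratr q.2.2[.
have -> : U = \bigcup_(q in [set q | box q `<=` U]) box q.
  apply/seteqP; split=> [x Ux|x [q /= /[apply]]//].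
  have [/= e e0 he] := (@nbhs_ballP _ (plane R) x U).1 (open_nbhs_nbhs (conj oU Ux)).
  have H (z : R) : exists q : rat * rat, (ratr q.1 < z < ratr q.2) /\
      forall y, ratr q.1 < y < ratr q.2 -> ball z e y.
    have /rat_in_itvoo[q1 /itvP h1] : z - e < z by rewrite ltrBlDr ltrDl.
    have /rat_in_itvoo[q2 /itvP h2] : z < z + e by rewrite ltrDl.
    exists (q1, q2); split; first by rewrite /= !(h1, h2).
    move=> y /= /andP[a b]; rewrite /ball/= ltr_distlC.
    by rewrite (le_lt_trans _ a) ?(lt_le_trans b)// !(h1, h2).
  have [q1 [q1x h1]] := H x.1; have [q2 [q2x h2]] := H x.2.
  exists (q1, q2); last by split; rewrite /= in_itv.
  move=> y [/=]; rewrite !in_itv/= => y1 y2; apply: he; split => /=; [exact: h1|exact: h2].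
rewrite bigcup_mkcond; apply: countable_bigcupT_measurable => // q.
case: ifPn => // _; apply: measurableX; exact: measurable_itv.
Qed.

Lemma continuous_plane_measurable (R : realType) (f : plane R -> R) :
  continuous f -> measurable_fun setT f.
Proof.
move=> /continuousP cf; apply: (measurability _ (measurable_realfun.RGenOpens.measurableE R)).
move=> _ [_ [a [b ->] <-]]; rewrite setTI; apply: open_plane_measurable.
exact/cf/interval_open.
Qed.
Section affine_change_of_variables.
Variable R : realType.
Local Notation mu := (@lebesgue_measure R).

Definition affine1 (a b x : R) : R := a * x + b.

Lemma measurable_affine1 a b :
  measurable_fun [set: measurableTypeR R] (affine1 a b : _ -> measurableTypeR R).
Proof.
by apply: measurable_funD => //; apply: measurable_funM.
Qed.

(** The rescaled pushforward is a measure, so comparing it with Lebesgue measure on half-open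
    intervals is enough. For negative [a] the preimage is half-open at the other end, which does not
    change its length. *)
Lemma lebesgue_measure_affine1 (a b : R) (A : set (measurableTypeR R)) : a != 0 -> measurable A ->
  (`|a|%:E * mu (affine1 a b @^-1` A) = mu A)%E.
Proof.
move=> a0 mA.
pose r : {nonneg R} := NngNum (normr_ge0 a).
pose m := measure_function_pushforward__canonical__measure_function_Measure mu (measurable_affine1 a b).
transitivity (mscale r m A) => //.
apply/esym; apply: lebesgue_measure_unique => // _ [[u v] _ <-] /=.
rewrite /mscale/= /pushforward.
have [ap|an|/eqP] := ltgtP 0 a; last by rewrite eq_sym (negbTE a0).
- have -> : affine1 a b @^-1` `]u, v]%classic = `](u - b) / a, (v - b) / a]%classic.
    apply/seteqP; split=> x /=; rewrite /affine1 !in_itv/=;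
    by rewrite ltr_pdivrMr// ler_pdivlMr// ltrBlDr lerBrDr (mulrC x).
  rewrite !lebesgue_measure_itv/= !lte_fin ltr_pM2r ?invr_gt0// ltrD2r.
  case: ifPn => uv; last by rewrite mule0.
  rewrite -!EFinB -EFinM gtr0_norm//; congr (_%:E); field; exact: lt0r_neq0.
- have -> : affine1 a b @^-1` `]u, v]%classic = `[(v - b) / a, (u - b) / a[%classic.
    apply/seteqP; split=> x /=; rewrite /affine1 !in_itv/= andbC.
      by rewrite ler_ndivrMr// ltr_ndivlMr// ltrBlDr lerBrDr (mulrC x).
    by rewrite ler_ndivrMr// ltr_ndivlMr// ltrBlDr lerBrDr (mulrC x).
  rewrite !lebesgue_measure_itv/= !lte_fin ltr_nM2r ?invr_lt0// ltrD2r.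
  case: ifPn => uv; last by rewrite mule0.
  rewrite -!EFinB -EFinM ltr0_norm//; congr (_%:E); field; exact: ltr0_neq0.
Qed.

(** One family for the three changes of variables used later: translations ([a] = 1), the reflection
    y -> x - y ([a] = -1) and dilations ([b] = 0). *)
Definition affine2 (a : R) (b x : plane R) : plane R :=
  (affine1 a b.1 x.1, affine1 a b.2 x.2).

Local Notation P := (measurableTypeR R * measurableTypeR R)%type.

Lemma measurable_affine2 a b : measurable_fun [set: P] (affine2 a b : P -> P).
Proof.
by apply: measurable_fun_pair; apply: measurableT_comp => //; exact: measurable_affine1.
Qed.

Lemma leb2_affine (a : R) (b : plane R) (A : set P) : a != 0 -> measurable A ->
  ((a ^+ 2)%:E * leb2 (affine2 a b @^-1` A) = leb2 A)%E.
Proof.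
move=> a0 mA.
pose r : {nonneg R} := NngNum (sqr_ge0 a).
pose m := measure_function_pushforward__canonical__measure_function_Measure (lebesgue_measure \x lebesgue_measure)%E (measurable_affine2 a b).
transitivity (mscale r m A) => //.
apply/esym; apply: (@product_measure_unique _ _ _ _ R mu mu (mscale r m)); last exact: mA.
move=> X Y mX mY.
transitivity ((a ^+ 2)%:E * (mu \x mu)%E ((affine1 a b.1 @^-1` X) `*` (affine1 a b.2 @^-1` Y)))%E => //.
have H c Z : measurable Z -> measurable ((affine1 a c : measurableTypeR R -> measurableTypeR R) @^-1` Z).
  by move=> mZ; rewrite -[X in measurable X]setTI; apply: measurable_affine1.
rewrite product_measure1E; [|exact: H|exact: H].
have EX := lebesgue_measure_affine1 b.1 a0 mX; have EY := lebesgue_measure_affine1 b.2 a0 mY.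
transitivity ((`|a|%:E * mu (affine1 a b.1 @^-1` X)) * (`|a|%:E * mu (affine1 a b.2 @^-1` Y)))%E; last by rewrite EX EY.
rewrite -real_normK ?num_real// expr2 EFinM.
by rewrite muleACA.
Qed.

Lemma ge0_integral_affine (a : R) (b : plane R) (f : P -> \bar R) : a != 0 ->
  measurable_fun setT f -> (forall x, 0 <= f x)%E ->
  (\int[leb2]_x f x = (a ^+ 2)%:E * \int[leb2]_x f (affine2 a b x))%E.
Proof.
move=> a0 mf f0.
pose r : {nonneg R} := NngNum (sqr_ge0 a).
pose m := measure_function_pushforward__canonical__measure_function_Measure (lebesgue_measure \x lebesgue_measure)%E (measurable_affine2 a b).
transitivity (\int[mscale r m]_x f x)%E.
  by apply: eq_measure_integral => A mA _; exact/esym/leb2_affine.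
transitivity (r%:num%:E * \int[m]_x f x)%E.
  by apply: ge0_integral_mscale.
apply: (congr1 (fun z => (a ^+ 2)%:E * z)%E).
have := @ge0_integral_pushforward _ _ P P R (affine2 a b) (measurable_affine2 a b) (mu \x mu)%E setT f.
rewrite preimage_setT => H; apply: H.
- exact: measurableT.
- exact: mf.
- by move=> x _; exact: f0.
Qed.

Lemma integrable_affine (a : R) (b : plane R) (f : P -> R) : a != 0 ->
  leb2.-integrable setT (EFin \o f) ->
  leb2.-integrable setT (EFin \o (f \o affine2 a b)).
Proof.
move=> a0 /integrableP[mf foo]; apply/integrableP; split.
  by apply: (measurableT_comp mf); exact: measurable_affine2.
have := foo; rewrite (ge0_integral_affine b a0)//; last exact: measurableT_comp.
have a2 : 0 < a ^+ 2 by rewrite exprn_even_gt0.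
apply: contraTT; rewrite -!leNgt !leye_eq => /eqP ->.
by rewrite gt0_muley.
Qed.

Lemma Rintegral_affine (a : R) (b : plane R) (f : P -> R) : a != 0 ->
  leb2.-integrable setT (EFin \o f) ->
  (\int[leb2]_x f x = a ^+ 2 * \int[leb2]_x f (affine2 a b x))%R.
Proof.
move=> a0 intf; have intg := integrable_affine b a0 intf.
have mf := measurable_int _ intf.
rewrite /Rintegral -[X in X * _]/(fine (a ^+ 2)%:E) -fineM//; last exact: integrable_fin_num intg.
congr fine; rewrite [LHS]integralE.
set g := EFin \o (f \o affine2 a b) in intg *.
transitivity ((a ^+ 2)%:E * \int[leb2]_x g x)%E; last by [].
rewrite [in RHS]integralE.
have -> : (\int[leb2]_x (EFin \o f)^\+ x = (a ^+ 2)%:E * \int[leb2]_x g^\+ x)%E.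
  have f0 x : (0 <= (EFin \o f)^\+ x)%E by exact: funepos_ge0.
  have H := ge0_integral_affine b a0 (measurable_funepos mf) f0.
  by rewrite H; congr (_ * _)%E; apply: eq_integral => x _; rewrite !(funeposE, funenegE).
have -> : (\int[leb2]_x (EFin \o f)^\- x = (a ^+ 2)%:E * \int[leb2]_x g^\- x)%E.
  have f0 x : (0 <= (EFin \o f)^\- x)%E by exact: funeneg_ge0.
  have H := ge0_integral_affine b a0 (measurable_funeneg mf) f0.
  by rewrite H; congr (_ * _)%E; apply: eq_integral => x _; rewrite !(funeposE, funenegE).
have H (c : R) (u v : \bar R) : v \is a fin_num -> (c%:E * u - c%:E * v = c%:E * (u - v))%E.
  by move=> fv; rewrite muleBr// fin_num_adde_defl// fin_numN.
apply: H; apply: integrable_fin_num => //.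
exact: (integrable_funeneg measurableT intg).
Qed.

End affine_change_of_variables.

Section plane_integral.
Variable R : realType.
Implicit Types f g : plane R -> R.
Local Notation P := (measurableTypeR R * measurableTypeR R)%type.

(* The real line carries two sigma-algebra instances; these wrappers pin the one of
   the Lebesgue measure. *)
Definition meas f := measurable_fun [set: P] (f : P -> R).
Definition ig f := leb2.-integrable setT (EFin \o f).
Definition I2 f : R := \int[leb2]_x f x.

Lemma measP f : measurable_fun [set: plane R] f -> meas f.
Proof. by move=> h; exact: h. Qed.

Lemma measD f g : meas f -> meas g -> meas (fun x => f x + g x).
Proof. exact: measurable_funD. Qed.

Lemma measB f g : meas f -> meas g -> meas (fun x => f x - g x).
Proof. exact: measurable_funB. Qed.

Lemma measM f g : meas f -> meas g -> meas (fun x => f x * g x).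
Proof. exact: measurable_funM. Qed.

Lemma meas_cst c : meas (fun=> c).
Proof. exact: measurable_cst. Qed.

Lemma meas_abs f : meas f -> meas (fun x => `|f x|).
Proof. by move=> mf; apply: measurableT_comp. Qed.

Lemma meas_continuous f : continuous f -> meas f.
Proof. by move=> cf; apply: measP; exact: continuous_plane_measurable. Qed.

Lemma meas_lim (f_ : nat -> plane R -> R) f : (forall n, meas (f_ n)) ->
  (forall x, f_ ^~ x @ \oo --> f x) -> meas f.
Proof. by move=> mf cf; apply: (measurable_fun_cvg (D := setT) mf) => x _; exact: cf. Qed.

Lemma meas_affine a b f : meas f -> meas (f \o affine2 a b).
Proof. by move=> mf; apply: (measurableT_comp mf); exact: measurable_affine2. Qed.

Lemma ig_meas f : ig f -> meas f.
Proof. by move=> /measurable_int/measurable_EFinP. Qed.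

Lemma ig_dom f g : meas f -> ig g -> (forall x, `|f x| <= g x) -> ig f.
Proof.
move=> mf ig fg; apply: le_integrable ig => //; first exact/measurable_EFinP.
by move=> x _ /=; rewrite lee_fin (le_trans (fg x))// ler_norm.
Qed.

Lemma igD f g : ig f -> ig g -> ig (fun x => f x + g x).
Proof. by move=> hf hg; have := integrableD measurableT hf hg. Qed.

Lemma igZ c f : ig f -> ig (fun x => c * f x).
Proof. by move=> hf; have := integrableZl measurableT c hf. Qed.

Lemma igN f : ig f -> ig (fun x => - f x).
Proof. by move=> hf; have := integrableN hf. Qed.

Lemma igB f g : ig f -> ig g -> ig (fun x => f x - g x).
Proof. by move=> hf hg; apply: igD => //; exact: igN. Qed.

Lemma ig_abs f : ig f -> ig (fun x => `|f x|).
Proof.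
move=> hf; apply: (le_integrable measurableT _ _ hf).
  by apply/measurable_EFinP; apply: meas_abs; exact: ig_meas.
by move=> x _ /=; rewrite normr_id.
Qed.

Lemma I2D f g : ig f -> ig g -> I2 (fun x => f x + g x) = I2 f + I2 g.
Proof. by move=> hf hg; exact: RintegralD. Qed.

Lemma I2B f g : ig f -> ig g -> I2 (fun x => f x - g x) = I2 f - I2 g.
Proof. by move=> hf hg; exact: RintegralB. Qed.

Lemma I2Z c f : ig f -> I2 (fun x => c * f x) = c * I2 f.
Proof. by move=> hf; exact: RintegralZl. Qed.

Lemma I2N f : ig f -> I2 (fun x => - f x) = - I2 f.
Proof. by move=> hf; rewrite -mulN1r -I2Z//; congr I2; apply/funext => x; rewrite mulN1r. Qed.

Lemma le_I2 f g : ig f -> ig g -> (forall x, f x <= g x) -> I2 f <= I2 g.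
Proof. by move=> hf hg fg; apply: le_Rintegral. Qed.

Lemma I2_ge0 f : (forall x, 0 <= f x) -> 0 <= I2 f.
Proof. by move=> f0; apply: Rintegral_ge0. Qed.

Lemma le_abs_I2 f : ig f -> `|I2 f| <= I2 (fun x => `|f x|).
Proof. by move=> hf; apply: le_normr_Rintegral. Qed.

Lemma I2_bound f g : meas f -> ig g -> (forall x, `|f x| <= g x) -> `|I2 f| <= I2 g.
Proof.
move=> mf hg fg; have hf := ig_dom mf hg fg.
by apply: (le_trans (le_abs_I2 hf)); apply: le_I2 => //; exact: ig_abs.
Qed.

Lemma ig_affine a b f : a != 0 -> ig f -> ig (f \o affine2 a b).
Proof. exact: integrable_affine. Qed.

Lemma I2_affine a b f : a != 0 -> ig f -> I2 (f \o affine2 a b) = (a ^+ 2)^-1 * I2 f.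
Proof.
by move=> a0 hf; rewrite {2}/I2 (Rintegral_affine b a0 hf) mulKf// expf_neq0.
Qed.

Lemma I2_dct (f_ : nat -> plane R -> R) f g : (forall n, meas (f_ n)) ->
  ig g -> (forall n x, `|f_ n x| <= g x) ->
  (forall x, f_ ^~ x @ \oo --> f x) ->
  (fun n => I2 (f_ n)) @ \oo --> I2 f.
Proof.
move=> mf hg fg cf.
have mff : meas f by exact: meas_lim cf.
have [] := @dominated_convergence _ P R leb2 setT measurableT (fun n => EFin \o f_ n) (EFin \o f) (EFin \o g).
- by move=> n; apply/measurable_EFinP; exact: mf.
- by apply/measurable_EFinP; exact: mff.
- apply: nearW => x _; apply: cvg_EFin; [exact: nearW|exact: cf].
- exact: hg.
- by apply: nearW => x n _; rewrite /= lee_fin; exact: fg.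
move=> hf _ H; rewrite /I2 /Rintegral; apply: fine_cvg.
rewrite fineK; first exact: H.
exact: integrable_fin_num.
Qed.

End plane_integral.

(** * Fubini's theorem under a product majorant *)

Section dominated_fubini.
Context d1 d2 (T1 : measurableType d1) (T2 : measurableType d2) (R : realType).
Variables (m1 : {sigma_finite_measure set T1 -> \bar R}).
Variables (m2 : {sigma_finite_measure set T2 -> \bar R}).
Variables (F : T1 * T2 -> R) (a : T1 -> R) (b : T2 -> R).
Hypothesis mF : measurable_fun setT F.
Hypotheses (a0 : forall x, 0 <= a x) (b0 : forall y, 0 <= b y).
Hypothesis ia : m1.-integrable setT (EFin \o a).
Hypothesis ib : m2.-integrable setT (EFin \o b).
Hypothesis Fab : forall x y, `|F (x, y)| <= a x * b y.

Let mEF : measurable_fun setT (EFin \o F).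
Proof. exact/measurable_EFinP. Qed.

Lemma integrable_prod_dom : (m1 \x m2)%E.-integrable setT (EFin \o F).
Proof.
apply/(integrable12ltyP _ _ mEF) => /=.
pose B := \int[m2]_y b y.
have EB : (\int[m2]_y (b y)%:E = B%:E)%E.
  by rewrite /B /Rintegral fineK//; exact: integrable_fin_num ib.
have H x : (\int[m2]_y `|(F (x, y))%:E| <= (a x * B)%:E)%E.
  rewrite EFinM -EB -ge0_integralZl//; [|by move: ib => /measurable_int|by move=> y _; rewrite lee_fin|by rewrite lee_fin].
  apply: ge0_le_integral => //.
  - apply: measurableT_comp => //; apply/measurable_EFinP.
    by apply: (measurableT_comp mF); exact: measurable_pair1.
  - by apply: measurable_funeM; move: ib => /measurable_int.
  - by move=> y _; rewrite -EFinM lee_fin.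
apply: (@le_lt_trans _ _ (\int[m1]_x (a x * B)%:E)%E).
  apply: ge0_le_integral => //.
  - by move=> x _; exact: integral_ge0.
  - apply: (measurable_fun_fubini_tonelli_F (abse \o (EFin \o F))) => //.
    exact: measurableT_comp.
  - by move=> x /=.
  - by apply/measurable_EFinP; apply: measurable_funM => //; move: ia => /measurable_int/measurable_EFinP.
  - by move=> x _; exact: H.
have : m1.-integrable setT (fun x => (B%:E * (a x)%:E)%E) by exact: integrableZl.
move=> /integrableP[_ H1]; apply: (le_lt_trans _ H1); apply: ge0_le_integral => //.
- by move=> x _; rewrite lee_fin mulr_ge0// /B Rintegral_ge0.
- by apply/measurable_EFinP; apply: measurable_funM => //; move: ia => /measurable_int/measurable_EFinP.
- by apply: measurableT_comp => //; apply: measurable_funeM; move: ia => /measurable_int.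
- by move=> x _; rewrite mulrC EFinM lee_abs.
Qed.

Lemma Rintegral_prod_dom1 :
  \int[m1]_x \int[m2]_y F (x, y) = \int[(m1 \x m2)%E]_z F z.
Proof.
rewrite {1 3}/Rintegral -(integral12_prod_meas1 integrable_prod_dom); congr fine.
apply: eq_integral => x _ /=; rewrite /Rintegral fineK//.
apply: integrable_fin_num => //.
apply: (@le_integrable _ _ _ m2 _ measurableT _ (fun y => ((a x)%:E * (b y)%:E)%E)).
- by apply/measurable_EFinP; apply: (measurableT_comp mF); exact: measurable_pair1.
- by move=> y _ /=; rewrite lee_fin (le_trans (Fab x y))// ler_norm.
- exact: integrableZl.
Qed.

Lemma Rintegral_prod_dom2 :
  \int[m2]_y \int[m1]_x F (x, y) = \int[(m1 \x m2)%E]_z F z.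
Proof.
rewrite {1 3}/Rintegral -(integral21_prod_meas1 integrable_prod_dom); congr fine.
apply: eq_integral => y _ /=; rewrite /Rintegral fineK//.
apply: integrable_fin_num => //.
apply: (@le_integrable _ _ _ m1 _ measurableT _ (fun x => ((b y)%:E * (a x)%:E)%E)).
- by apply/measurable_EFinP; apply: (measurableT_comp mF); exact: measurable_pair2.
- by move=> x _ /=; rewrite lee_fin (le_trans (Fab x y))// mulrC ler_norm.
- exact: integrableZl.
Qed.

End dominated_fubini.

Section plane_fubini.
Variable R : realType.
Local Notation P := (measurableTypeR R * measurableTypeR R)%type.
Local Notation mu := (@lebesgue_measure R).

Lemma ig_prod (f g : R -> R) :
  mu.-integrable setT (EFin \o f) -> mu.-integrable setT (EFin \o g) ->
  ig (fun x => f x.1 * g x.2) /\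
  I2 (fun x => f x.1 * g x.2) = (\int[mu]_x f x) * (\int[mu]_x g x).
Proof.
move=> hf hg.
have mf : measurable_fun [set: measurableTypeR R] f by move: hf => /measurable_int/measurable_EFinP.
have mg : measurable_fun [set: measurableTypeR R] g by move: hg => /measurable_int/measurable_EFinP.
have N h : mu.-integrable setT (EFin \o h) -> mu.-integrable setT (EFin \o (fun x => `|h x|)).
  by move=> hh; have := integrable_abse hh.
pose F (x : P) := f x.1 * g x.2.
have mF : measurable_fun [set: P] F.
  by apply: measurable_funM; apply: measurableT_comp.
have D x y : `|F (x, y)| <= `|f x| * `|g y| by rewrite normrM.
have H := @integrable_prod_dom _ _ _ _ R mu mu F _ _ mF
  (fun=> normr_ge0 _) (fun=> normr_ge0 _) (N _ hf) (N _ hg) D.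
split; first exact: H.
rewrite /I2 -[LHS](@Rintegral_prod_dom1 _ _ _ _ R mu mu F _ _ mF
  (fun=> normr_ge0 _) (fun=> normr_ge0 _) (N _ hf) (N _ hg) D) /F/=.
rewrite -RintegralZr//; apply: eq_Rintegral => x _.
by rewrite RintegralZl.
Qed.

(** A named copy of the plane measure, to which a sigma-finite structure can be attached; Fubini is
    then applied with the plane itself as each factor. *)
Definition lebP : set P -> \bar R := (mu \x mu)%E.

HB.instance Definition _ := Measure.copy lebP (mu \x mu)%E.

Lemma sigma_finite_lebP : sigma_finite setT lebP.
Proof.
have /sigma_finiteP[F [TF ndF Foo]] := sigma_finiteT mu.
exists (fun n => F n `*` F n).
  apply/seteqP; split=> // -[x y] _.
  have [n _ Fx] : (\bigcup_n F n) x by rewrite -TF.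
  have [k _ Fy] : (\bigcup_n F n) y by rewrite -TF.
  exists (maxn n k) => //; split.
    by move: x Fx; apply/subsetPset/ndF/leq_maxl.
  by move: y Fy; apply/subsetPset/ndF/leq_maxr.
move=> k; have [mF Fk] := Foo k; split; first exact: measurableX.
by rewrite /lebP product_measure1E// lte_mul_pinfty// ge0_fin_numE.
Qed.

HB.instance Definition _ := Measure_isSigmaFinite.Build _ _ _ lebP sigma_finite_lebP.

Lemma I2_swap (F : plane R -> plane R -> R) (a b : plane R -> R) :
  measurable_fun [set: P * P] (fun z : P * P => F z.1 z.2) ->
  ig a -> ig b -> (forall x, 0 <= a x) -> (forall y, 0 <= b y) ->
  (forall x y, `|F x y| <= a x * b y) ->
  I2 (fun x => I2 (fun y => F x y)) = I2 (fun y => I2 (fun x => F x y)).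
Proof.
move=> mF ha hb a0 b0 D.
have H1 := @Rintegral_prod_dom1 _ _ P P R lebP lebP (fun z => F z.1 z.2) a b mF a0 b0 ha hb D.
have H2 := @Rintegral_prod_dom2 _ _ P P R lebP lebP (fun z => F z.1 z.2) a b mF a0 b0 ha hb D.
exact: (etrans H1 (esym H2)).
Qed.

End plane_fubini.

(** * Explicit integrals on the line: the Laplace and Cauchy densities *)

Section line_integrals.
Variable R : realType.
Local Notation mu := (@lebesgue_measure R).
Implicit Types (f : R -> R) (x t : R).

Lemma ge0_integral_fold f : continuous f -> (forall t, 0 <= f t) ->
  (\int[mu]_t (f t)%:E = \int[mu]_(t in `[0%R, +oo[) (f t + f (- t))%:E)%E.
Proof.
move=> cf f0; have mf : measurable_fun [set: R] f by exact: continuous_measurable_fun.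
have mEf : measurable_fun [set: R] (EFin \o f) by exact/measurable_EFinP.
have mNf : measurable_fun [set: R] (EFin \o (f \o -%R)).
  by apply/measurable_EFinP; apply: measurableT_comp.
under [RHS]eq_integral do rewrite EFinD.
rewrite ge0_integralD//=; last 4 first.
- by move=> t _; rewrite lee_fin.
- exact: measurable_funS mEf.
- by move=> t _; rewrite lee_fin.
- exact: measurable_funS mNf.
have -> : (\int[mu]_(t in `[0%R, +oo[) (f (- t))%:E = \int[mu]_(t in `]-oo, 0%R]) (f t)%:E)%E.
  rewrite (@ge0_integration_by_substitution0 R (EFin \o (f \o -%R)) mNf)//; last first.
    by move=> r; rewrite lee_fin; exact: f0.
  by apply: eq_integral => t _ /=; rewrite opprK.
rewrite -integral_itv_bndo_bndc; last exact: measurable_funS mEf.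
rewrite -ge0_integral_setU//=.
- congr (integral mu _ _); rewrite setUC; apply/seteqP; split => // t _ /=.
  by rewrite !in_itv/= andbT; case: ltP; [left|right].
- exact: measurable_funS mEf.
- by move=> t _; rewrite lee_fin.
- apply/disj_set2P; apply/seteqP; split => // t [] /=; rewrite !in_itv/= andbT.
  by move=> t0; rewrite ltNge t0.
Qed.

(** The integrand contains [1 + cos] instead of [cos] so as to be nonnegative: the fundamental
    theorem on a half-line then needs no prior integrability. The extra mass of the exponential is
    subtracted in [Rintegral_exp_cos]. *)
Lemma is_derive_cauchy_exp x t :
  is_derive t 1 (fun t => - expR (- t) +
     expR (- t) * (x * sin (x * t) - cos (x * t)) / (1 + x ^+ 2))
   (expR (- t) * (1 + cos (x * t))).
Proof.
have x2 : 1 + x ^+ 2 != 0 by rewrite lt0r_neq0// ltr_pwDl// sqr_ge0.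
apply: is_derive_eq.
rewrite /GRing.scale/=; field; exact: x2.
Qed.

Lemma integral_exp_cos_half x :
  (\int[mu]_(t in `[0%R, +oo[) (expR (- t) * (1 + cos (x * t)))%:E =
   (1 + (1 + x ^+ 2)^-1)%:E)%E.
Proof.
have x2 : 0 < 1 + x ^+ 2 by rewrite ltr_pwDl// sqr_ge0.
pose F t := - expR (- t) + expR (- t) * (x * sin (x * t) - cos (x * t)) / (1 + x ^+ 2).
have dF t : derivable F t 1 by have [] := is_derive_cauchy_exp x t.
rewrite (@ge0_continuous_FTC2y _ _ F 0 0).
- rewrite -EFinB /F oppr0 expR0 !mulr0 sin0 cos0 mulr0; congr (_%:E); field.
  exact: lt0r_neq0.
- by move=> t _; rewrite mulr_ge0 ?expR_ge0// -lerBlDl sub0r cos_geN1.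
- apply: continuous_subspaceT => t.
  apply: differentiable_continuous; apply/derivable1_diffP.
  by apply: ex_derive.
- pose K := 1 + (`|x| + 1) / (1 + x ^+ 2).
  have cK : K * expR (- t) @[t --> +oo] --> (0 : R).
    by rewrite -[X in _ --> X](mulr0 K); apply: cvgM; [exact: cvg_cst|exact: cvgr_expR].
  have FK t : `|F t| <= K * expR (- t).
    rewrite /F mulrDl mul1r (le_trans (ler_normD _ _))// normrN (ger0_norm (expR_ge0 _)) lerD2l.
    rewrite -mulrA normrM (ger0_norm (expR_ge0 _)) mulrC ler_wpM2r ?expR_ge0//.
    rewrite normrM normfV (gtr0_norm x2) ler_wpM2r ?invr_ge0 ?(ltW x2)//.
    rewrite (le_trans (ler_normB _ _))// lerD//; last by rewrite ler_norml cos_geN1 cos_le1.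
    by rewrite normrM ler_piMr// ler_norml sin_geN1 sin_le1.
  apply: (@squeeze_cvgr _ _ _ _ (fun t => - (K * expR (- t))) (fun t => K * expR (- t))) => //.
  - by apply: nearW => t; rewrite -ler_norml.
  - by rewrite -oppr0; exact: cvgN.
- by move=> t _; exact: dF.
- apply: cvg_at_right_filter.
  by apply: differentiable_continuous; apply/derivable1_diffP; exact: dF.
- by move=> t _; rewrite derive1E; have [_ ->] := is_derive_cauchy_exp x t.
Qed.

Let ccos x : continuous (fun t => cos (x * t)).
Proof.
by move=> t; apply: differentiable_continuous; apply/derivable1_diffP; exact: ex_derive.
Qed.

Let csin x : continuous (fun t => sin (x * t)).
Proof.
by move=> t; apply: differentiable_continuous; apply/derivable1_diffP; exact: ex_derive.
Qed.

Lemma continuous_exp_abs : continuous (fun t : R => expR (- `|t|)).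
Proof.
by move=> t; apply: continuous_comp; [apply: cvgN; exact: norm_continuous|exact: continuous_expR].
Qed.

Lemma integral_exp_cos x :
  (\int[mu]_t (expR (- `|t|) * (1 + cos (x * t)))%:E = (2 + 2 / (1 + x ^+ 2))%:E)%E.
Proof.
rewrite ge0_integral_fold.
- transitivity (\int[mu]_(t in `[0%R, +oo[) (2%:E * (expR (- t) * (1 + cos (x * t)))%:E))%E.
    apply: eq_integral => t; rewrite inE/= in_itv/= andbT => t0.
    by rewrite normrN ger0_norm// mulrN cosN -EFinM; congr (_%:E); ring.
  rewrite ge0_integralZl//.
  + by rewrite integral_exp_cos_half -EFinM; congr (_%:E); ring.
  + apply/measurable_EFinP; apply: measurable_funS (continuous_measurable_fun _) => //.
    by move=> t; apply: differentiable_continuous; apply/derivable1_diffP; exact: ex_derive.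
- move=> t; apply: cvgM; first exact: continuous_exp_abs.
  by apply: cvgD; [exact: cvg_cst|exact: ccos].
- by move=> t; rewrite mulr_ge0 ?expR_ge0// -lerBlDl sub0r cos_geN1.
Qed.

Lemma integral_exp_sin x :
  (\int[mu]_t (expR (- `|t|) * (1 + sin (x * t)))%:E = 2%:E)%E.
Proof.
rewrite ge0_integral_fold.
(* Folding cancels the odd sine. The remaining 2 exp(-t) is the cosine integrand at frequency 0. *)
- transitivity (\int[mu]_(t in `[0%R, +oo[) ((expR (- t) * (1 + cos (0 * t)))%:E))%E.
    apply: eq_integral => t; rewrite inE/= in_itv/= andbT => t0.
    by rewrite normrN ger0_norm// mulrN sinN mul0r cos0; congr (_%:E); ring.
  by rewrite integral_exp_cos_half; congr (_%:E); rewrite expr0n addr0 invr1.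
- move=> t; apply: cvgM; first exact: continuous_exp_abs.
  by apply: cvgD; [exact: cvg_cst|exact: csin].
- by move=> t; rewrite mulr_ge0 ?expR_ge0// -lerBlDl sub0r sin_geN1.
Qed.

Lemma integrable_exp_abs : mu.-integrable setT (EFin \o (fun t => expR (- `|t|))).
Proof.
apply/integrableP; split.
  by apply/measurable_EFinP; apply: continuous_measurable_fun; exact: continuous_exp_abs.
have := integral_exp_sin 0 => H.
apply: (@le_lt_trans _ _ 2%:E); last exact: ltry.
rewrite -H le_eqVlt; apply/orP; left; apply/eqP; apply: eq_integral => t _ /=.
by rewrite mul0r sin0 addr0 mulr1 ger0_norm ?expR_ge0.
Qed.

Lemma Rintegral_exp_abs : \int[mu]_t expR (- `|t|) = 2.
Proof.
rewrite /Rintegral -[RHS]/(fine 2%:E) -(integral_exp_sin 0); congr fine.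
by apply: eq_integral => t _; rewrite mul0r sin0 addr0 mulr1.
Qed.

Lemma integrable_exp_abs_bounded (c : R -> R) : continuous c -> (forall t, `|c t| <= 1) ->
  mu.-integrable setT (EFin \o (fun t => expR (- `|t|) * c t)).
Proof.
move=> cc c1; apply: (le_integrable measurableT _ _ integrable_exp_abs).
  apply/measurable_EFinP; apply: continuous_measurable_fun => t.
  by apply: cvgM; [exact: continuous_exp_abs|exact: cc].
by move=> t _ /=; rewrite lee_fin normrM ler_piMr.
Qed.

Lemma integrable_exp_cos x : mu.-integrable setT (EFin \o (fun t => expR (- `|t|) * cos (x * t))).
Proof.
by apply: integrable_exp_abs_bounded => // t; rewrite ler_norml cos_geN1 cos_le1.
Qed.

Lemma integrable_exp_sin x : mu.-integrable setT (EFin \o (fun t => expR (- `|t|) * sin (x * t))).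
Proof.
by apply: integrable_exp_abs_bounded => // t; rewrite ler_norml sin_geN1 sin_le1.
Qed.

Lemma Rintegral_exp_cos x : \int[mu]_t (expR (- `|t|) * cos (x * t)) = 2 / (1 + x ^+ 2).
Proof.
apply: (@addrI _ 2); rewrite -{1}Rintegral_exp_abs -RintegralD//; last 2 first.
- exact: integrable_exp_abs.
- exact: integrable_exp_cos.
rewrite /Rintegral -[RHS]/(fine (2 + 2 / (1 + x ^+ 2))%:E) -integral_exp_cos; congr fine.
by apply: eq_integral => t _; rewrite mulrDr mulr1.
Qed.

Lemma Rintegral_exp_sin x : \int[mu]_t (expR (- `|t|) * sin (x * t)) = 0.
Proof.
apply: (@addrI _ 2); rewrite addr0 -{1}Rintegral_exp_abs -RintegralD//; last 2 first.
- exact: integrable_exp_abs.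
- exact: integrable_exp_sin.
rewrite /Rintegral -[RHS]/(fine 2%:E) -(integral_exp_sin x); congr fine.
by apply: eq_integral => t _; rewrite mulrDr mulr1.
Qed.

Lemma continuous_cauchy : continuous (fun t : R => (1 + t ^+ 2)^-1).
Proof.
have c2 : continuous (fun t : R => 1 + t ^+ 2).
  by move=> t; apply: differentiable_continuous; apply/derivable1_diffP; exact: ex_derive.
by move=> t; apply: cvgV; [rewrite lt0r_neq0// ltr_pwDl// sqr_ge0|exact: c2].
Qed.

Lemma integral_cauchy : (\int[mu]_t ((1 + t ^+ 2)^-1)%:E = pi%:E)%E.
Proof.
rewrite ge0_symfun_integralT.
- have -> : [set x : R | 0 <= x] = `[0, +oo[%classic by rewrite set_itvcy.
  rewrite (@ge0_continuous_FTC2y _ _ (@atan R) 0 (pi / 2)).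
  + by rewrite atan0 -EFinB -EFinM; congr (_%:E); field.
  + by move=> t _; rewrite invr_ge0 addr_ge0// sqr_ge0.
  + exact: continuous_subspaceT continuous_cauchy.
  + exact: cvgy_atan.
  + by move=> t _; exact: derivable_atan.
  + by apply: cvg_at_right_filter; exact: continuous_atan.
  + by move=> t _; exact: derive1_atan.
- by move=> t; rewrite invr_ge0 addr_ge0// sqr_ge0.
- exact: continuous_cauchy.
- by move=> t /=; rewrite sqrrN.
Qed.

Lemma integrable_cauchy : mu.-integrable setT (EFin \o (fun t : R => (1 + t ^+ 2)^-1)).
Proof.
apply/integrableP; split.
  by apply/measurable_EFinP; apply: continuous_measurable_fun; exact: continuous_cauchy.
apply: (@le_lt_trans _ _ pi%:E); last exact: ltry.
rewrite -integral_cauchy le_eqVlt; apply/orP; left; apply/eqP; apply: eq_integral => t _ /=.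
by rewrite ger0_norm// invr_ge0 addr_ge0// sqr_ge0.
Qed.

Lemma Rintegral_cauchy : \int[mu]_t (1 + t ^+ 2)^-1 = pi.
Proof. by rewrite /Rintegral integral_cauchy. Qed.

End line_integrals.

(** * Directional derivatives and rapidly decaying functions *)

Section directional_derivatives.
Variable R : realType.
Implicit Types (f g : plane R -> R) (x v : plane R).

(** Dominated convergence speaks of sequences; in this form it applies directly to difference
    quotients. *)
Lemma is_derive_seqP f x v d :
  is_derive x v f d <->
  forall u : nat -> R, (forall n, u n != 0) -> u @ \oo --> 0 ->
    (fun n => (u n)^-1 * (f (x + u n *: v) - f x)) @ \oo --> d.
Proof.
have E u : (fun n => (u n)^-1 * (f (x + u n *: v) - f x)) =
   (fun h : R => h^-1 *: ((f \o shift x) (h *: v) - f x)) \o u :> (nat -> R).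
  by apply/funext => n /=; rewrite (addrC x).
split=> [[dv <-] u u0 ul|H].
  by rewrite E; apply: (cvgr_dnbhsP _ _ _).1 => //; exact: dv.
have c : (fun h : R => h^-1 *: ((f \o shift x) (h *: v) - f x)) @ 0^' --> d.
  by apply/cvgr_dnbhsP => u [u0 ul]; have := H u u0 ul; rewrite E.
apply: DeriveDef; first by apply/cvg_ex; exists d.
by apply: cvg_lim.
Qed.

Lemma is_derive_line f x v t d : is_derive (x + t *: v) v f d ->
  is_derive t (1 : R) (fun t => f (x + t *: v)) d.
Proof.
move=> [dv dE].
have E : (fun h : R => h^-1 *: (((fun t => f (x + t *: v)) \o shift t) (h *: (1 : R)) - f (x + t *: v)))
  = (fun h : R => h^-1 *: ((f \o shift (x + t *: v)) (h *: v) - f (x + t *: v))).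
  apply/funext => h /=; congr (_ *: (f _ - _)).
  by rewrite [h *: (1 : R)]mulr1 scalerDl addrCA.
by apply: DeriveDef; [rewrite /derivable E|rewrite /derive E].
Qed.

Lemma line_mvt f df x v (K s : R) :
  (forall y, is_derive y v f (df y)) ->
  (forall t, `|t| <= `|s| -> `|df (x + t *: v)| <= K) ->
  `|f (x + s *: v) - f x| <= K * `|s|.
Proof.
move=> fd dK.
have d1 t : is_derive t (1 : R) (fun t => f (x + t *: v)) (df (x + t *: v)).
  exact: is_derive_line.
have cf a b : {within `[a, b], continuous (fun t => f (x + t *: v))}.
  by apply: derivable_within_continuous => t _; have [] := d1 t.
have [s0|s0] := leP 0 s.
  have [c] := MVT_segment s0 (fun t _ => d1 t) (cf _ _).
  rewrite in_itv/= subr0 scale0r addr0 => /andP[c0 cs] ->.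
  by rewrite normrM ler_wpM2r// dK// !ger0_norm.
have [c] := MVT_segment (ltW s0) (fun t _ => d1 t) (cf _ _).
rewrite in_itv/= scale0r addr0 sub0r => /andP[c0 cs] E.
rewrite distrC E normrM normrN ler_wpM2r// dK//.
by rewrite !ler0_norm ?lerN2// ltW.
Qed.

End directional_derivatives.

Section weight.
Variable R : realType.
Implicit Types (x y : plane R).
Local Notation mu := (@lebesgue_measure R).

(** The yardstick for decay and growth, instead of powers of 1 + |x|: its integrability reduces to
    one dimension because it is a product, and it is moreover proportional to the transform of the
    Abel factor used for inversion. *)
Definition weight x : R := (1 + x.1 ^+ 2)^-1 * (1 + x.2 ^+ 2)^-1.

Let pos1 (t : R) : 0 < 1 + t ^+ 2. Proof. by rewrite ltr_pwDl// sqr_ge0. Qed.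

Lemma weight_gt0 x : 0 < weight x.
Proof. by rewrite mulr_gt0// invr_gt0. Qed.

Lemma weight_ge0 x : 0 <= weight x. Proof. exact/ltW/weight_gt0. Qed.

Lemma weight_le1 x : weight x <= 1.
Proof. by rewrite mulr_ile1 ?invr_ge0 ?(ltW (pos1 _))// invf_le1// lerDl sqr_ge0. Qed.

Lemma ig_weight : ig weight.
Proof. exact: (ig_prod (integrable_cauchy R) (integrable_cauchy R)).1. Qed.

Lemma I2_weight : I2 weight = pi ^+ 2 :> R.
Proof. by rewrite (ig_prod (integrable_cauchy R) (integrable_cauchy R)).2 Rintegral_cauchy. Qed.

Lemma meas_fst : meas (fun x => x.1). Proof. by rewrite /meas; apply: measurable_fst. Qed.
Lemma meas_snd : meas (fun x => x.2). Proof. by rewrite /meas; apply: measurable_snd. Qed.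

Lemma meas_weight : meas weight. Proof. exact: ig_meas ig_weight. Qed.

Let abs_le1sqr (t : R) : `|t| <= 1 + t ^+ 2.
Proof. by rewrite -[t ^+ 2]real_normK ?num_real//; have := sqr_ge0 (`|t| - 1); nra. Qed.

Lemma coord1_weight x : `|x.1| <= (weight x)^-1.
Proof.
rewrite /weight invfM !invrK (le_trans (abs_le1sqr _))// ler_peMr ?(ltW (pos1 _))//.
by rewrite lerDl sqr_ge0.
Qed.

Lemma coord2_weight x : `|x.2| <= (weight x)^-1.
Proof.
rewrite /weight invfM !invrK (le_trans (abs_le1sqr _))// ler_peMl ?(ltW (pos1 _))//.
by rewrite lerDl sqr_ge0.
Qed.

(** Peetre's inequality. In one variable it holds because 2 (1 + (a + b)^2) (1 + b^2) exceeds 1 +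
    a^2 by 1 + (a + 2b)^2 + 2 (b (a + b))^2. *)
Lemma weight_add x y : weight (x + y) <= 4 * weight x / weight y.
Proof.
have H (a b : R) : (1 + (a + b) ^+ 2)^-1 <= 2 * (1 + a ^+ 2)^-1 * (1 + b ^+ 2).
  rewrite -[leLHS]mul1r ler_pdivrMr// mulrAC -mulrA mulrAC ler_pdivlMr//.
  have := sqr_ge0 (a + 2 * b); have := sqr_ge0 (b * (a + b)); nra.
rewrite /weight invfM !invrK.
rewrite (_ : 4 * _ * _ = (2 * (1 + x.1 ^+ 2)^-1 * (1 + y.1 ^+ 2)) * (2 * (1 + x.2 ^+ 2)^-1 * (1 + y.2 ^+ 2))); last by ring.
by apply: ler_pM; rewrite ?invr_ge0 ?(ltW (pos1 _))//; exact: H.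
Qed.

End weight.

Section rapid_decay.
Variable R : realType.
Implicit Types (f g : plane R -> R) (x y v : plane R) (i : 'I_2).

Definition crd i x : R := if i == 0 then x.1 else x.2.

Lemma coord_weight i x : `|crd i x| <= (weight x)^-1.
Proof. by rewrite /crd; case: ifP => _; [exact: coord1_weight|exact: coord2_weight]. Qed.

Lemma meas_coord i : meas (crd i).
Proof. by rewrite /crd; case: (i == 0); [exact: meas_fst|exact: meas_snd]. Qed.

(** Schwartz decay without smoothness, hence stable under products with bounded or slowly growing
    measurable functions; derivatives are tracked separately. *)
Definition rapid f := meas f /\ forall n, exists K, forall x, `|f x| <= K * weight x ^+ n.

Lemma rapid_ge0 f n K : (forall x, `|f x| <= K * weight x ^+ n) -> 0 <= K.
Proof.
move=> /(_ 0) H; rewrite -(pmulr_lge0 _ (exprn_gt0 n (weight_gt0 (0 : plane R)))).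
exact: le_trans H.
Qed.

Lemma rapidD f g : rapid f -> rapid g -> rapid (fun x => f x + g x).
Proof.
move=> [mf hf] [mg hg]; split; first exact: measD.
move=> n; have [K1 h1] := hf n; have [K2 h2] := hg n; exists (K1 + K2) => x.
by rewrite mulrDl (le_trans (ler_normD _ _))// lerD.
Qed.

Lemma rapid_bounded f g M : rapid f -> meas g -> (forall x, `|g x| <= M) ->
  rapid (fun x => g x * f x).
Proof.
move=> [mf hf] mg hg; split; first exact: measM.
move=> n; have [K h] := hf n; exists (M * K) => x.
by rewrite normrM -mulrA ler_pM.
Qed.

Lemma rapidZ c f : rapid f -> rapid (fun x => c * f x).
Proof. by move=> hf; apply: (@rapid_bounded f (fun=> c) `|c|) => //; exact: meas_cst. Qed.

Lemma rapidN f : rapid f -> rapid (fun x => - f x).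
Proof.
move=> hf; rewrite (_ : (fun x => _) = (fun x => (-1) * f x)); first exact: rapidZ.
by apply/funext => x; rewrite mulN1r.
Qed.

Lemma rapid_moderate f g M : rapid f -> meas g -> (forall x, `|g x| <= M / weight x) ->
  rapid (fun x => g x * f x).
Proof.
move=> [mf hf] mg hg; split; first exact: measM.
move=> n; have [K h] := hf n.+1; exists (M * K) => x.
rewrite normrM (_ : M * K * _ = (M / weight x) * (K * weight x ^+ n.+1)).
  by rewrite ler_pM.
rewrite exprS; field; exact/lt0r_neq0/weight_gt0.
Qed.

Lemma rapid_coord i f : rapid f -> rapid (fun x => crd i x * f x).
Proof.
move=> hf; apply: (@rapid_moderate _ _ 1) => //; first exact: meas_coord.
by move=> x; rewrite mul1r coord_weight.
Qed.

Lemma rapid_ig f : rapid f -> ig f.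
Proof.
move=> [mf /(_ 1%N)[K hK]]; apply: (ig_dom mf (igZ K (@ig_weight R))) => x.
by have := hK x; rewrite expr1.
Qed.

Lemma dot_shift i x (s : R) xi :
  dot (x + s *: basis2 R i) xi = dot x xi + s * crd i xi.
Proof.
rewrite /dot /crd /basis2 /=; case: ifP => [/eqP ->|i0] /=.
  by rewrite /GRing.scale/=; ring.
have -> : i == 1 by case: i i0 => -[|[|]].
by rewrite /GRing.scale/=; ring.
Qed.

Lemma dotC x y : dot x y = dot y x.
Proof. by rewrite /dot mulrC [x.2 * _]mulrC. Qed.

Lemma shift_affine i x (s : R) : x + s *: basis2 R i = affine2 1 (s *: basis2 R i) x.
Proof. by rewrite /affine2 /affine1 !mul1r; case: x. Qed.

(** The 8 is the 4 of [weight_add] times 1 + s^2, which is at most 2. *)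
Lemma weight_shift i x (s : R) : `|s| <= 1 -> weight (x + s *: basis2 R i) <= 8 * weight x.
Proof.
move=> s1; apply: (le_trans (weight_add _ _)).
rewrite mulrAC ler_wpM2r ?weight_ge0// (_ : 8 = 4 * 2); last by ring.
rewrite ler_pM2l//; rewrite /weight invfM !invrK /basis2 /=.
have s2 : s ^+ 2 <= 1 by rewrite -real_normK ?num_real// expr_le1.
case: i => -[|[|//]] ? /=; rewrite /GRing.scale/= ?mulr1 ?mulr0 ?expr0n/= ?addr0 ?mulr1 ?mul1r;
  by rewrite -[leRHS]/(1 + 1) lerD2l.
Qed.

Lemma inv_succ_cvg0 : (fun n : nat => (n.+1%:R)^-1 : R) @ \oo --> (0 : R).
Proof. exact: cvg_harmonic. Qed.

Lemma meas_shift i (s : R) f : meas f -> meas (fun x => f (x + s *: basis2 R i)).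
Proof.
move=> mf; rewrite (_ : (fun x => _) = f \o affine2 1 (s *: basis2 R i)); first exact: meas_affine.
by apply/funext => x; rewrite shift_affine.
Qed.

Lemma ig_shift i (s : R) f : ig f -> ig (fun x => f (x + s *: basis2 R i)).
Proof.
move=> mf; rewrite (_ : (fun x => _) = f \o affine2 1 (s *: basis2 R i)).
  exact: ig_affine (oner_neq0 _) mf.
by apply/funext => x; rewrite shift_affine.
Qed.

Lemma I2_shift i (s : R) f : ig f -> I2 (fun x => f (x + s *: basis2 R i)) = I2 f.
Proof.
move=> mf; rewrite (_ : (fun x => _) = f \o affine2 1 (s *: basis2 R i)).
  by rewrite (I2_affine _ (oner_neq0 _) mf) expr1n invr1 mul1r.
by apply/funext => x; rewrite shift_affine.
Qed.

(* Translation invariance kills every difference quotient; dominated convergence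
   passes to the limit, so no fundamental theorem of calculus is needed. *)
Lemma I2_partial0 i f df K : meas f ->
  (forall x, is_derive x (basis2 R i) f (df x)) ->
  (forall x, `|f x| <= K * weight x) -> (forall x, `|df x| <= K * weight x) ->
  I2 df = 0.
Proof.
move=> mf fd fK dK.
have igf : ig f by exact: (ig_dom mf (igZ K (@ig_weight R))).
pose q (n : nat) x : R := ((n.+1%:R)^-1)^-1 * (f (x + (n.+1%:R)^-1 *: basis2 R i) - f x).
have n1 (n : nat) : `|(n.+1%:R)^-1| <= 1 :> R.
  by rewrite ger0_norm ?invr_ge0// invf_le1 ?ler1n ?ltr0n.
have K0 : 0 <= K.
  by apply: (@rapid_ge0 f 1 K) => x; rewrite expr1.
have : (fun n => I2 (q n)) @ \oo --> I2 df.
  apply: (@I2_dct _ q df (fun x => 8 * K * weight x)).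
  - move=> n; apply: measM; first exact: meas_cst.
    by apply: measB => //; exact: meas_shift.
  - exact: igZ (@ig_weight R).
  - move=> n x; rewrite /q normrM mulrC normfV ler_pdivrMr; last first.
      by rewrite normr_gt0 invr_neq0// pnatr_eq0.
    apply: (line_mvt fd) => t tn; rewrite (le_trans (dK _))//.
    rewrite (_ : 8 * K * weight x = K * (8 * weight x)); last by ring.
    by rewrite ler_wpM2l// weight_shift// (le_trans tn).
  - move=> x; apply: ((is_derive_seqP _ _ _ _).1 (fd x)).
      by move=> n; rewrite invr_neq0// pnatr_eq0.
    exact: inv_succ_cvg0.
have -> : (fun n => I2 (q n)) = fun=> 0.
  apply/funext => n; rewrite /q I2Z; last by apply: igB => //; exact: ig_shift.
  by rewrite I2B//; [rewrite I2_shift// subrr mulr0|exact: ig_shift].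
move=> H; have := cvg_lim (@Rhausdorff R) H; have := cvg_lim (@Rhausdorff R) (@cvg_cst R 0 _ \oo _).
by move=> -> <-.
Qed.

Lemma is_derive_I2 i (F dF : plane R -> plane R -> R) g :
  (forall x, ig (F x)) ->
  (forall x y, is_derive x (basis2 R i) (F ^~ y) (dF x y)) ->
  ig g -> (forall x y, `|dF x y| <= g y) ->
  forall x, is_derive x (basis2 R i) (fun x => I2 (F x)) (I2 (dF x)).
Proof.
move=> hF hd hg dg x; apply/is_derive_seqP => u u0 ul.
pose q (n : nat) y : R := (u n)^-1 * (F (x + u n *: basis2 R i) y - F x y).
have -> : (fun n => (u n)^-1 * (I2 (F (x + u n *: basis2 R i)) - I2 (F x))) = (fun n => I2 (q n)).
  by apply/funext => n; rewrite /q I2Z ?I2B//; exact: igB.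
apply: (@I2_dct _ q (dF x) g) => //.
- by move=> n; apply: ig_meas; apply: igZ; exact: igB.
- move=> n y; rewrite /q normrM mulrC normfV ler_pdivrMr ?normr_gt0//.
  exact: (line_mvt (fun z => hd z y)).
- by move=> y; exact: ((is_derive_seqP _ _ _ _).1 (hd x y)).
Qed.

Lemma lip_partials f (df : 'I_2 -> plane R -> R) K :
  (forall i x, is_derive x (basis2 R i) f (df i x)) ->
  (forall i x, `|df i x| <= K) ->
  forall x y, `|f x - f y| <= K * (`|x.1 - y.1| + `|x.2 - y.2|).
Proof.
move=> fd dK x y.
pose z := y + (x.1 - y.1) *: basis2 R 0.
have E : x = z + (x.2 - y.2) *: basis2 R 1.
  rewrite /z /basis2 /= /GRing.scale/=; case: x y {z} => x1 x2 [y1 y2] /=.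
  by congr (_, _) => /=; rewrite /GRing.scale/=; ring.
rewrite -(subrKA (f z)) (le_trans (ler_normD _ _))// addrC mulrDr lerD//.
  exact: (line_mvt (fd 0)).
by rewrite {1}E; exact: (line_mvt (fd 1)).
Qed.

Lemma lip_continuous f K :
  (forall x y, `|f x - f y| <= K * (`|x.1 - y.1| + `|x.2 - y.2|)) -> continuous f.
Proof.
move=> fK x.
have c : (fun y : plane R => K * (`|x.1 - y.1| + `|x.2 - y.2|)) @ x --> K * (`|x.1 - x.1| + `|x.2 - x.2|).
  apply: cvgM; first exact: cvg_cst.
  apply: cvgD; apply: cvg_norm; apply: cvgB; try exact: cvg_cst.
    exact: cvg_fst.
  exact: cvg_snd.
rewrite !subrr normr0 addr0 mulr0 in c.
apply/cvgrPdist_le => e e0; move/cvgrPdist_le : c => /(_ _ e0).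
apply: filterS => y; rewrite sub0r normrN => h.
by rewrite (le_trans (fK x y))// (le_trans _ h)// ler_norm.
Qed.

End rapid_decay.

(** * Fourier inversion *)

Section trigonometric_transforms.
Variable R : realType.
Implicit Types (f g : plane R -> R) (x y v : plane R) (i : 'I_2).

Lemma ord2_cases i : i = 0 \/ i = 1.
Proof. by case: i => -[|[|//]] j; [left|right]; apply: val_inj. Qed.

Lemma is_derive_of_line f x v d :
  is_derive (0 : R) (1 : R) (fun t : R => f (x + t *: v)) d -> is_derive x v f d.
Proof.
move=> [dv dE].
have E : (fun h : R => h^-1 *: (((fun t : R => f (x + t *: v)) \o shift 0) (h *: (1 : R)) - f (x + 0 *: v)))
  = (fun h : R => h^-1 *: ((f \o shift x) (h *: v) - f x)).
  apply/funext => h /=; rewrite scale0r addr0 addr0 (addrC x).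
  by rewrite [h *: (1 : R)]mulr1.
by apply: DeriveDef; [move: dv; rewrite /derivable E|move: dE; rewrite /derive E].
Qed.

Lemma is_derive_cos_dot i x xi :
  is_derive x (basis2 R i) (fun y => cos (dot y xi)) (- (sin (dot x xi) * crd i xi)).
Proof.
apply: is_derive_of_line; rewrite (_ : (fun t => _) = (fun t : R => cos (dot x xi + t * crd i xi))).
  by apply: is_derive_eq; rewrite /GRing.scale/= mul0r addr0; ring.
by apply/funext => t; rewrite dot_shift.
Qed.

Lemma is_derive_sin_dot i x xi :
  is_derive x (basis2 R i) (fun y => sin (dot y xi)) (cos (dot x xi) * crd i xi).
Proof.
apply: is_derive_of_line; rewrite (_ : (fun t => _) = (fun t : R => sin (dot x xi + t * crd i xi))).
  by apply: is_derive_eq; rewrite /GRing.scale/= mul0r addr0; ring.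
by apply/funext => t; rewrite dot_shift.
Qed.

Lemma is_derive_mulr v x f c d : is_derive x v f d -> is_derive x v (fun y => f y * c) (d * c).
Proof.
move=> fd; apply: (is_derive_eq (is_deriveM fd (is_derive_cst c x v))).
by rewrite scaler0 add0r /GRing.scale/= mulrC.
Qed.

Lemma meas_dot x : meas (dot x).
Proof. by apply: measD; apply: measM; try exact: meas_cst; [exact: meas_fst|exact: meas_snd]. Qed.

Lemma meas_cos f : meas f -> meas (fun x => cos (f x)).
Proof.
move=> mf; apply: measurableT_comp => //.
by apply: continuous_measurable_fun; exact: continuous_cos.
Qed.

Lemma meas_sin f : meas f -> meas (fun x => sin (f x)).
Proof.
move=> mf; apply: measurableT_comp => //.
by apply: continuous_measurable_fun; exact: continuous_sin.
Qed.

Lemma norm_cos_le1 (t : R) : `|cos t| <= 1. Proof. by rewrite ler_norml cos_geN1 cos_le1. Qed.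
Lemma norm_sin_le1 (t : R) : `|sin t| <= 1. Proof. by rewrite ler_norml sin_geN1 sin_le1. Qed.

Lemma rapid_cos f x : rapid f -> rapid (fun xi => cos (dot x xi) * f xi).
Proof.
move=> hf; apply: (rapid_bounded hf (M := 1)); last by move=> y; exact: norm_cos_le1.
exact: meas_cos (meas_dot x).
Qed.

Lemma rapid_sin f x : rapid f -> rapid (fun xi => sin (dot x xi) * f xi).
Proof.
move=> hf; apply: (rapid_bounded hf (M := 1)); last by move=> y; exact: norm_sin_le1.
exact: meas_sin (meas_dot x).
Qed.

(** Complex transforms are treated through their real and imaginary parts; [tcos] and [tsin] are the
    two halves of the unnormalised Fourier transform of a real function. *)
Definition tcos f x : R := I2 (fun xi => cos (dot x xi) * f xi).
Definition tsin f x : R := I2 (fun xi => sin (dot x xi) * f xi).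

Lemma tcos_bound f x : rapid f -> `|tcos f x| <= I2 (fun xi => `|f xi|).
Proof.
move=> hf; apply: I2_bound; [exact: (rapid_cos x hf).1|exact: ig_abs (rapid_ig hf)|].
by move=> xi; rewrite normrM ler_piMl// norm_cos_le1.
Qed.

Lemma tsin_bound f x : rapid f -> `|tsin f x| <= I2 (fun xi => `|f xi|).
Proof.
move=> hf; apply: I2_bound; [exact: (rapid_sin x hf).1|exact: ig_abs (rapid_ig hf)|].
by move=> xi; rewrite normrM ler_piMl// norm_sin_le1.
Qed.

Lemma tcosZ c f x : rapid f -> tcos (fun xi => c * f xi) x = c * tcos f x.
Proof.
move=> hf; rewrite /tcos -I2Z; last exact: rapid_ig (rapid_cos x hf).
by congr I2; apply/funext => y; ring.
Qed.

Lemma tsinZ c f x : rapid f -> tsin (fun xi => c * f xi) x = c * tsin f x.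
Proof.
move=> hf; rewrite /tsin -I2Z; last exact: rapid_ig (rapid_sin x hf).
by congr I2; apply/funext => y; ring.
Qed.

Lemma tcosD f g x : rapid f -> rapid g ->
  tcos (fun xi => f xi + g xi) x = tcos f x + tcos g x.
Proof.
move=> hf hg; rewrite /tcos -I2D; [|exact: rapid_ig (rapid_cos x hf)|exact: rapid_ig (rapid_cos x hg)].
by congr I2; apply/funext => y; ring.
Qed.

Lemma tsinD f g x : rapid f -> rapid g ->
  tsin (fun xi => f xi + g xi) x = tsin f x + tsin g x.
Proof.
move=> hf hg; rewrite /tsin -I2D; [|exact: rapid_ig (rapid_sin x hf)|exact: rapid_ig (rapid_sin x hg)].
by congr I2; apply/funext => y; ring.
Qed.

Lemma is_derive_tcos i f x : rapid f ->
  is_derive x (basis2 R i) (tcos f) (- tsin (fun xi => crd i xi * f xi) x).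
Proof.
move=> hf.
have -> : - tsin (fun xi => crd i xi * f xi) x =
    I2 (fun xi => - (sin (dot x xi) * crd i xi) * f xi).
  rewrite /tsin -I2N; last exact: rapid_ig (rapid_sin x (rapid_coord i hf)).
  by congr I2; apply/funext => xi; ring.
apply: (@is_derive_I2 _ i (fun x xi => cos (dot x xi) * f xi)
  (fun x xi => - (sin (dot x xi) * crd i xi) * f xi) (fun xi => `|crd i xi * f xi|)).
- by move=> y; exact: rapid_ig (rapid_cos y hf).
- by move=> y xi; apply: is_derive_mulr; exact: is_derive_cos_dot.
- exact: ig_abs (rapid_ig (rapid_coord i hf)).
- by move=> y xi; rewrite mulNr normrN -mulrA normrM ler_piMl// norm_sin_le1.
Qed.

Lemma is_derive_tsin i f x : rapid f ->
  is_derive x (basis2 R i) (tsin f) (tcos (fun xi => crd i xi * f xi) x).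
Proof.
move=> hf.
have -> : tcos (fun xi => crd i xi * f xi) x =
    I2 (fun xi => (cos (dot x xi) * crd i xi) * f xi).
  by rewrite /tcos; congr I2; apply/funext => xi; ring.
apply: (@is_derive_I2 _ i (fun x xi => sin (dot x xi) * f xi)
  (fun x xi => (cos (dot x xi) * crd i xi) * f xi) (fun xi => `|crd i xi * f xi|)).
- by move=> y; exact: rapid_ig (rapid_sin y hf).
- by move=> y xi; apply: is_derive_mulr; exact: is_derive_sin_dot.
- exact: ig_abs (rapid_ig (rapid_coord i hf)).
- by move=> y xi; rewrite -mulrA normrM ler_piMl// norm_cos_le1.
Qed.

Lemma partials_continuous f (df : 'I_2 -> plane R -> R) (K : 'I_2 -> R) :
  (forall i x, is_derive x (basis2 R i) f (df i x)) ->
  (forall i x, `|df i x| <= K i) -> continuous f.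
Proof.
move=> fd fK; apply: (@lip_continuous _ _ (`|K 0| + `|K 1|)).
apply: (lip_partials fd) => i x; apply: (le_trans (fK i x)); apply: (le_trans (ler_norm _)).
by case: (ord2_cases i) => ->; rewrite ?lerDl ?lerDr.
Qed.

Lemma continuous_tcos f : rapid f -> continuous (tcos f).
Proof.
move=> hf; apply: (partials_continuous (fun i x => is_derive_tcos i x hf)) => i x.
by rewrite normrN; apply: tsin_bound; exact: rapid_coord.
Qed.

Lemma continuous_tsin f : rapid f -> continuous (tsin f).
Proof.
move=> hf; apply: (partials_continuous (fun i x => is_derive_tsin i x hf)) => i x.
by apply: tcos_bound; exact: rapid_coord.
Qed.

Section integration_by_parts.
Variables (i : 'I_2) (f df : plane R -> R).
Hypotheses (hf : rapid f) (hdf : rapid df).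
Hypothesis fd : forall x, is_derive x (basis2 R i) f (df x).

Let dom (c : R) (a b : plane R -> R) : rapid a -> rapid b ->
  exists K, (forall x, `|a x| <= K * weight x) /\ (forall x, `|b x| <= K * weight x).
Proof.
move=> [_ /(_ 1%N) [K1 h1]] [_ /(_ 1%N) [K2 h2]]; exists (Num.max K1 K2); split=> x.
  by have := h1 x; rewrite expr1 => /le_trans; apply; rewrite ler_wpM2r ?weight_ge0 ?le_max ?lexx.
by have := h2 x; rewrite expr1 => /le_trans; apply; rewrite ler_wpM2r ?weight_ge0 ?le_max ?lexx ?orbT.
Qed.

(** The derivative of cos(x . xi) f(xi) in xi integrates to zero by [I2_partial0], and its two terms
    are the two sides. *)
Lemma tcos_partial x : tcos df x = crd i x * tsin f x.
Proof.
pose G xi := cos (dot x xi) * df xi - crd i x * (sin (dot x xi) * f xi).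
have hG : rapid G.
  apply: rapidD; first exact: rapid_cos.
  by apply: rapidN; apply: rapidZ; exact: rapid_sin.
have [K [K1 K2]] := dom 0 (rapid_cos x hf) hG.
have H : I2 G = 0.
  apply: (I2_partial0 (rapid_cos x hf).1 _ K1 K2) => xi.
  apply: (is_derive_eq (is_deriveM (_ : is_derive xi (basis2 R i) (fun y => cos (dot x y)) (- (sin (dot x xi) * crd i x))) (fd xi))).
    rewrite (_ : (fun y => _) = (fun y => cos (dot y x))); last by apply/funext => y; rewrite dotC.
    by rewrite (dotC x); exact: is_derive_cos_dot.
  by rewrite /G /GRing.scale/=; ring.
apply/eqP; rewrite -subr_eq0 -H /G I2B ?I2Z//.
- exact: rapid_ig (rapid_sin x hf).
- exact: rapid_ig (rapid_cos x hdf).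
- by apply: igZ; exact: rapid_ig (rapid_sin x hf).
Qed.

Lemma tsin_partial x : tsin df x = - (crd i x * tcos f x).
Proof.
pose G xi := sin (dot x xi) * df xi + crd i x * (cos (dot x xi) * f xi).
have hG : rapid G.
  apply: rapidD; first exact: rapid_sin.
  by apply: rapidZ; exact: rapid_cos.
have [K [K1 K2]] := dom 0 (rapid_sin x hf) hG.
have H : I2 G = 0.
  apply: (I2_partial0 (rapid_sin x hf).1 _ K1 K2) => xi.
  apply: (is_derive_eq (is_deriveM (_ : is_derive xi (basis2 R i) (fun y => sin (dot x y)) (cos (dot x xi) * crd i x)) (fd xi))).
    rewrite (_ : (fun y => _) = (fun y => sin (dot y x))); last by apply/funext => y; rewrite dotC.
    by rewrite (dotC x); exact: is_derive_sin_dot.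
  by rewrite /G /GRing.scale/=; ring.
apply/eqP; rewrite -subr_eq0 opprK -H /G I2D ?I2Z//.
- exact: rapid_ig (rapid_cos x hf).
- exact: rapid_ig (rapid_sin x hdf).
- by apply: igZ; exact: rapid_ig (rapid_cos x hf).
Qed.

End integration_by_parts.

(** Repeated derivatives in one direction only. They give decay of the transform in the matching
    coordinate, and by [weight_inv_le] the pure powers of the coordinates control every power of the
    weight, so mixed derivatives never enter. *)
Fixpoint rapid_smooth (n : nat) i f : Prop := rapid f /\
  if n is m.+1 then exists2 df, (forall x, is_derive x (basis2 R i) f (df x)) &
    rapid_smooth m i df else True.

Lemma rapid_smooth_rapid n i f : rapid_smooth n i f -> rapid f.
Proof. by case: n => [|n] []. Qed.

(** Each integration by parts trades one coordinate factor for one derivative of [f] and exchanges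
    sine and cosine; this is why both transforms are bounded in the same induction. *)
Lemma transform_decay1 n i f : rapid_smooth n i f -> exists K, forall x,
  `|crd i x ^+ n * tcos f x| <= K /\ `|crd i x ^+ n * tsin f x| <= K.
Proof.
elim: n f => [|n IH] f hf.
  exists (I2 (fun xi => `|f xi|)) => x; rewrite expr0 !mul1r.
  by split; [exact: tcos_bound hf.1|exact: tsin_bound hf.1].
case: hf => hf [df fd hdf]; have [K hK] := IH _ hdf; exists K => x.
have [h1 h2] := hK x; have hdf' := rapid_smooth_rapid hdf.
split; rewrite exprSr -mulrA.
  by rewrite -normrN -mulrN -(tsin_partial hf hdf' fd).
by rewrite -(tcos_partial hf hdf' fd).
Qed.

(** With m the maximum of 1, |x1| and |x2|, the inverse weight is at most 4 m^4, and m^(4n) is one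
    of the three terms on the right. *)
Lemma weight_inv_le n x :
  (weight x)^-1 ^+ n <= 4 ^+ n * (1 + `|crd 0 x ^+ (4 * n)| + `|crd 1 x ^+ (4 * n)|).
Proof.
pose m := Num.max 1 (Num.max `|x.1| `|x.2|).
have m1 : 1 <= m by rewrite le_max lexx.
have xm1 : `|x.1| <= m by rewrite !le_max lexx orbT.
have xm2 : `|x.2| <= m by rewrite !le_max lexx !orbT.
have H (t : R) : `|t| <= m -> 1 + t ^+ 2 <= 2 * m ^+ 2.
  move=> tm; rewrite -(real_normK (num_real t)).
  have := normr_ge0 t; nra.
have Hw : (weight x)^-1 <= 4 * m ^+ 4.
  rewrite /weight invfM !invrK (_ : 4 * m ^+ 4 = (2 * m ^+ 2) * (2 * m ^+ 2)); last by ring.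
  by apply: ler_pM; rewrite ?addr_ge0 ?sqr_ge0// H.
apply: (@le_trans _ _ ((4 * m ^+ 4) ^+ n)).
  by rewrite lerXn2r ?nnegrE ?invr_ge0 ?weight_ge0// (le_trans _ Hw)// invr_ge0 weight_ge0.
rewrite exprMn -exprM ler_wpM2l ?exprn_ge0//.
rewrite !normrX /crd/=.
have p t : 0 <= `|t : R| ^+ (4 * n) by rewrite exprn_ge0.
have [->|[->|->]] : m = 1 \/ m = `|x.1| \/ m = `|x.2|.
- by rewrite /m; case: (leP `|x.1| `|x.2|) => _; case: leP => _; auto.
- by rewrite expr1n -addrA lerDl addr_ge0.
- by rewrite [1 + _]addrC -addrA lerDl addr_ge0.
- by rewrite lerDr addr_ge0.
Qed.

Lemma rapid_of_moments f : meas f ->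
  (forall n i, exists K, forall x, `|crd i x ^+ n * f x| <= K) -> rapid f.
Proof.
move=> mf H; split=> // n.
have [K0 h0] := H 0%N 0; have [K1 h1] := H (4 * n)%N 0; have [K2 h2] := H (4 * n)%N 1.
exists (4 ^+ n * (K0 + K1 + K2)) => x.
have w0 : 0 < weight x ^+ n by rewrite exprn_gt0// weight_gt0.
have := h2 x; have := h1 x; have := h0 x.
rewrite expr0 mul1r !normrM => t0 t1 t2; rewrite -ler_pdivrMr// -exprVn mulrC.
apply: (@le_trans _ _ (4 ^+ n * (1 + `|crd 0 x ^+ (4 * n)| + `|crd 1 x ^+ (4 * n)|) * `|f x|)).
  by rewrite ler_wpM2r// weight_inv_le.
by rewrite -mulrA ler_pM2l ?exprn_gt0// !mulrDl mul1r !lerD.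
Qed.

Lemma rapid_transform f : (forall n i, rapid_smooth n i f) -> rapid (tcos f) /\ rapid (tsin f).
Proof.
move=> sf; have hf := rapid_smooth_rapid (sf 0%N 0).
split; apply: rapid_of_moments.
- by apply: meas_continuous; exact: continuous_tcos.
- by move=> n i; have [K h] := transform_decay1 (sf n i); exists K => x; have [] := h x.
- by apply: meas_continuous; exact: continuous_tsin.
- by move=> n i; have [K h] := transform_decay1 (sf n i); exists K => x; have [] := h x.
Qed.

End trigonometric_transforms.

Section fourier_inversion.
Variable R : realType.
Implicit Types (f g : plane R -> R) (x y u : plane R).
Local Notation P := (measurableTypeR R * measurableTypeR R)%type.

Definition meas2 (F : plane R -> plane R -> R) :=
  measurable_fun [set: P * P] (fun z : P * P => F z.1 z.2).

Lemma meas2_l f : meas f -> meas2 (fun x _ => f x).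
Proof. by move=> mf; apply: (measurableT_comp mf); exact: measurable_fst. Qed.

Lemma meas2_r f : meas f -> meas2 (fun _ y => f y).
Proof. by move=> mf; apply: (measurableT_comp mf); exact: measurable_snd. Qed.

Lemma meas2D F G : meas2 F -> meas2 G -> meas2 (fun x y => F x y + G x y).
Proof. exact: measurable_funD. Qed.

Lemma meas2B F G : meas2 F -> meas2 G -> meas2 (fun x y => F x y - G x y).
Proof. exact: measurable_funB. Qed.

Lemma meas2M F G : meas2 F -> meas2 G -> meas2 (fun x y => F x y * G x y).
Proof. exact: measurable_funM. Qed.

Lemma meas2_comp (h : R -> R) F : continuous h -> meas2 F -> meas2 (fun x y => h (F x y)).
Proof.
by move=> ch mF; apply: (measurableT_comp _ mF); apply: continuous_measurable_fun.
Qed.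

Lemma meas2_comp_pair f F G : meas f -> meas2 F -> meas2 G ->
  meas2 (fun x y => f (F x y, G x y)).
Proof.
move=> mf mF mG; apply: (measurableT_comp mf (g := fun z : P * P => (F z.1 z.2, G z.1 z.2) : P)).
exact: measurable_fun_pair.
Qed.

Lemma meas2_dot_sub x : meas2 (fun xi y => dot (x - y) xi).
Proof.
by apply: meas2D; apply: meas2M;
  by [apply: meas2_r; apply: measB; [exact: meas_cst|exact: meas_fst]|
      apply: meas2_r; apply: measB; [exact: meas_cst|exact: meas_snd]|
      apply: meas2_l; exact: meas_fst|apply: meas2_l; exact: meas_snd].
Qed.

(** An exponential summability factor instead of a Gaussian: its transform comes from an elementary
    primitive. *)
Definition abel x : R := expR (- `|x.1|) * expR (- `|x.2|).

Lemma ig_abel : ig abel.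
Proof. exact: (ig_prod (integrable_exp_abs R) (integrable_exp_abs R)).1. Qed.

Lemma abel_gt0 x : 0 < abel x.
Proof. by rewrite mulr_gt0 ?expR_gt0. Qed.

Lemma abel_le1 x : abel x <= 1.
Proof.
by rewrite /abel -expRD -expR0 ler_expR -opprD oppr_le0 addr_ge0.
Qed.

Lemma abel_cos u : I2 (fun xi => cos (dot u xi) * abel xi) = 4 * weight u.
Proof.
have [c1 c2] := ig_prod (integrable_exp_cos u.1) (integrable_exp_cos u.2).
have [s1 s2] := ig_prod (integrable_exp_sin u.1) (integrable_exp_sin u.2).
rewrite (_ : (fun xi => _) = (fun xi : plane R =>
   expR (- `|xi.1|) * cos (u.1 * xi.1) * (expR (- `|xi.2|) * cos (u.2 * xi.2)) -
   expR (- `|xi.1|) * sin (u.1 * xi.1) * (expR (- `|xi.2|) * sin (u.2 * xi.2)))).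
  rewrite I2B// c2 s2 !Rintegral_exp_cos !Rintegral_exp_sin mulr0 subr0 /weight.
  by ring.
by apply/funext => xi; rewrite /dot cosD /abel; ring.
Qed.

Lemma abel_sin u : I2 (fun xi => sin (dot u xi) * abel xi) = 0.
Proof.
have [c1 c2] := ig_prod (integrable_exp_cos u.1) (integrable_exp_sin u.2).
have [s1 s2] := ig_prod (integrable_exp_sin u.1) (integrable_exp_cos u.2).
rewrite (_ : (fun xi => _) = (fun xi : plane R =>
   expR (- `|xi.1|) * sin (u.1 * xi.1) * (expR (- `|xi.2|) * cos (u.2 * xi.2)) +
   expR (- `|xi.1|) * cos (u.1 * xi.1) * (expR (- `|xi.2|) * sin (u.2 * xi.2)))).
  by rewrite I2D// c2 s2 !Rintegral_exp_sin mul0r mulr0 addr0.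
by apply/funext => xi; rewrite /dot sinD /abel; ring.
Qed.

Lemma affine2_0 (e : R) x : affine2 e 0 x = e *: x.
Proof. by rewrite /affine2 /affine1 !addr0; case: x. Qed.

Lemma abel_scale_ig (e : R) : e != 0 -> ig (fun xi => abel (e *: xi)).
Proof.
move=> e0; rewrite (_ : (fun xi => _) = abel \o affine2 e 0); first exact: ig_affine ig_abel.
by apply/funext => xi /=; rewrite affine2_0.
Qed.

Lemma abel_scale_cos (e : R) u : e != 0 ->
  I2 (fun xi => cos (dot u xi) * abel (e *: xi)) = (e ^+ 2)^-1 * (4 * weight (e^-1 *: u)).
Proof.
move=> e0; rewrite -abel_cos -(I2_affine 0 e0).
  congr I2; apply/funext => xi /=; rewrite affine2_0; congr (cos _ * _).
  by rewrite /dot /= /GRing.scale/=; field.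
apply: (ig_dom _ ig_abel).
  apply: measM; first by apply: meas_cos; exact: meas_dot.
  exact: ig_meas ig_abel.
by move=> xi; rewrite normrM (gtr0_norm (abel_gt0 _)) ler_piMl ?(ltW (abel_gt0 _))// norm_cos_le1.
Qed.

Lemma abel_scale_sin (e : R) u : e != 0 ->
  I2 (fun xi => sin (dot u xi) * abel (e *: xi)) = 0.
Proof.
move=> e0; rewrite -(mulr0 (e ^+ 2)^-1) -(abel_sin (e^-1 *: u)) -(I2_affine 0 e0).
  congr I2; apply/funext => xi /=; rewrite affine2_0; congr (sin _ * _).
  by rewrite /dot /= /GRing.scale/=; field.
apply: (ig_dom _ ig_abel).
  apply: measM; first by apply: meas_sin; exact: meas_dot.
  exact: ig_meas ig_abel.
by move=> xi; rewrite normrM (gtr0_norm (abel_gt0 _)) ler_piMl ?(ltW (abel_gt0 _))// norm_sin_le1.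
Qed.

Lemma dotBl x y z : dot (x - y) z = dot x z - dot y z.
Proof. by rewrite /dot /=; ring. Qed.

(* The Abel factor makes Fubini applicable; its own transform is the Cauchy density,
   proportional to [weight]. *)
Lemma abel_inversion (f g : plane R -> R) x (e : R) : rapid f -> rapid g -> e != 0 ->
  I2 (fun xi => abel (e *: xi) * (cos (dot x xi) * (tcos f xi + tsin g xi)
      - sin (dot x xi) * (tcos g xi - tsin f xi)))
  = 4 * I2 (fun z => f (x - e *: z) * weight z).
Proof.
move=> hf hg e0.
pose F xi y : R := abel (e *: xi) * (cos (dot (x - y) xi) * f y - sin (dot (x - y) xi) * g y).
have aS xi : rapid (fun y => cos (dot xi y) * f y) := rapid_cos xi hf.
have igc (h : plane R -> R) xi : rapid h -> ig (fun y => cos (dot xi y) * h y).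
  by move=> hh; exact: rapid_ig (rapid_cos xi hh).
have igs (h : plane R -> R) xi : rapid h -> ig (fun y => sin (dot xi y) * h y).
  by move=> hh; exact: rapid_ig (rapid_sin xi hh).
transitivity (I2 (fun xi => I2 (F xi))).
  congr I2; apply/funext => xi.
  have i1 := igc f xi hf; have i2 := igs g xi hg; have i3 := igc g xi hg; have i4 := igs f xi hf.
  set k := abel _; set c := cos _; set s := sin _.
  have -> : F xi = fun y => (k * c) * (cos (dot xi y) * f y) + (k * c) * (sin (dot xi y) * g y)
      - ((k * s) * (cos (dot xi y) * g y) - (k * s) * (sin (dot xi y) * f y)).
    by apply/funext => y; rewrite /F dotBl sinB cosB (dotC xi y) /k /c /s; ring.
  rewrite (I2B (igD (igZ _ i1) (igZ _ i2)) (igB (igZ _ i3) (igZ _ i4))).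
  rewrite (I2D (igZ _ i1) (igZ _ i2)) (I2B (igZ _ i3) (igZ _ i4)) !I2Z//.
  by rewrite /tcos /tsin; ring.
rewrite (@I2_swap _ F (fun xi => abel (e *: xi)) (fun y => `|f y| + `|g y|)); last first.
- move=> xi y; rewrite /F normrM (gtr0_norm (abel_gt0 _)) ler_pM2l ?abel_gt0//.
  rewrite (le_trans (ler_normB _ _))// !normrM lerD// ler_piMl//.
    exact: norm_cos_le1.
  exact: norm_sin_le1.
- by move=> y; rewrite addr_ge0.
- by move=> y; rewrite ltW// abel_gt0.
- by apply: igD; apply: ig_abs; exact: rapid_ig.
- exact: abel_scale_ig.
- apply: (@meas2M (fun xi _ => abel (e *: xi)) (fun xi y => cos (dot (x - y) xi) * f y - sin (dot (x - y) xi) * g y)).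
    by apply: meas2_l; exact: ig_meas (abel_scale_ig e0).
  apply: (@meas2B (fun xi y => cos (dot (x - y) xi) * f y) (fun xi y => sin (dot (x - y) xi) * g y)).
    apply: (@meas2M (fun xi y => cos (dot (x - y) xi)) (fun _ y => f y)); last exact: meas2_r hf.1.
    by apply: meas2_comp (meas2_dot_sub x); exact: continuous_cos.
  apply: (@meas2M (fun xi y => sin (dot (x - y) xi)) (fun _ y => g y)); last exact: meas2_r hg.1.
  by apply: meas2_comp (meas2_dot_sub x); exact: continuous_sin.
have E y : I2 (F ^~ y) = (e ^+ 2)^-1 * (4 * weight (e^-1 *: (x - y))) * f y.
  have ic : ig (fun xi => cos (dot (x - y) xi) * abel (e *: xi)).
    apply: (ig_dom _ (abel_scale_ig e0)).
      apply: measM; first by apply: meas_cos; exact: meas_dot.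
      exact: ig_meas (abel_scale_ig e0).
    by move=> xi; rewrite normrM (gtr0_norm (abel_gt0 _)) ler_piMl ?(ltW (abel_gt0 _))// norm_cos_le1.
  have is_ : ig (fun xi => sin (dot (x - y) xi) * abel (e *: xi)).
    apply: (ig_dom _ (abel_scale_ig e0)).
      apply: measM; first by apply: meas_sin; exact: meas_dot.
      exact: ig_meas (abel_scale_ig e0).
    by move=> xi; rewrite normrM (gtr0_norm (abel_gt0 _)) ler_piMl ?(ltW (abel_gt0 _))// norm_sin_le1.
  rewrite (_ : F ^~ y = (fun xi => f y * (cos (dot (x - y) xi) * abel (e *: xi)) -
      g y * (sin (dot (x - y) xi) * abel (e *: xi)))); last first.
    by apply/funext => xi; rewrite /F; ring.
  rewrite I2B ?I2Z//; [|exact: igZ|exact: igZ].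
  by rewrite abel_scale_cos// abel_scale_sin// mulr0 subr0 mulrC.
rewrite (_ : (fun y => I2 _) = (fun y => (e ^+ 2)^-1 * (4 * (f y * weight (e^-1 *: (x - y)))))); last first.
  by apply/funext => y; rewrite E; ring.
have ne0 : - e^-1 != 0 by rewrite oppr_eq0 invr_eq0.
pose G z := f (x - e *: z) * weight z.
(* The substitution z = (x - y) / e; its Jacobian cancels the factor e^-2 of the dilated Cauchy
   kernel. *)
have EG : (fun y => f y * weight (e^-1 *: (x - y))) = G \o affine2 (- e^-1) (e^-1 *: x).
  apply/funext => y; rewrite /G /=.
  have -> : affine2 (- e^-1) (e^-1 *: x) y = e^-1 *: (x - y).
    by rewrite /affine2 /affine1 /=; congr (_, _); rewrite /GRing.scale/=; ring.
  by rewrite scalerA divff// scale1r opprB addrCA subrr addr0.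
have mG : meas G.
  apply: measM; last exact: meas_weight.
  rewrite (_ : (fun z => _) = f \o affine2 (- e) x); first by apply: meas_affine; exact: hf.1.
  by apply/funext => z /=; congr f; rewrite /affine2 /affine1/=; case: x {F aS E EG G} => a b; congr (_, _) => /=; rewrite /GRing.scale/=; ring.
have [K hK] := hf.2 0%N.
have igG : ig G.
  apply: (ig_dom mG (igZ K (@ig_weight R))) => z; rewrite normrM (ger0_norm (weight_ge0 _)).
  by rewrite ler_wpM2r ?weight_ge0// (le_trans (hK _))// expr0 mulr1.
rewrite I2Z; last by apply: igZ; rewrite EG; exact: ig_affine.
rewrite I2Z; last by rewrite EG; exact: ig_affine.
rewrite EG I2_affine//.
by field.
Qed.

(** The two functions of xi are the real and imaginary parts of the unnormalised transform of f + i
    g, and the left side is the real part of the inverse transform applied to them. The imaginary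
    part is obtained later by applying the lemma to another pair. *)
Lemma inversion (f g : plane R -> R) x : rapid f -> continuous f -> rapid g ->
  rapid (fun xi => tcos f xi + tsin g xi) -> rapid (fun xi => tcos g xi - tsin f xi) ->
  tcos (fun xi => tcos f xi + tsin g xi) x - tsin (fun xi => tcos g xi - tsin f xi) x
  = (2 * pi) ^+ 2 * f x.
Proof.
move=> hf cf hg ha hb.
set a := fun xi => tcos f xi + tsin g xi; set b := fun xi => tcos g xi - tsin f xi.
have ia : ig (fun xi => cos (dot x xi) * a xi) by exact: rapid_ig (rapid_cos x ha).
have ib : ig (fun xi => sin (dot x xi) * b xi) by exact: rapid_ig (rapid_sin x hb).
pose e (n : nat) : R := (n.+1%:R)^-1.
have e0 n : e n != 0 by rewrite invr_neq0// pnatr_eq0.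
have ce (t : R) : (fun n => e n * t) @ \oo --> (0 : R).
  by rewrite -[X in _ --> X](mul0r t); apply: cvgM; [exact: inv_succ_cvg0|exact: cvg_cst].
(* [L] has two limits: in frequency the Abel factor tends to 1; in space, by [abel_inversion], the
   Cauchy kernel of mass pi^2 concentrates at x, where [f] is continuous. *)
pose L n := I2 (fun xi => abel (e n *: xi) * (cos (dot x xi) * a xi - sin (dot x xi) * b xi)).
have L1 : L @ \oo --> tcos a x - tsin b x.
  rewrite /tcos /tsin -I2B//; apply: (@I2_dct _ _ _ (fun xi => `|cos (dot x xi) * a xi - sin (dot x xi) * b xi|)).
  - move=> n; apply: measM; first exact: ig_meas (abel_scale_ig (e0 n)).
    by apply: ig_meas; exact: igB.
  - by apply: ig_abs; exact: igB.
  - by move=> n xi; rewrite normrM ler_piMl// gtr0_norm ?abel_gt0// abel_le1.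
  - move=> xi; rewrite -[X in _ --> X]mul1r; apply: cvgM; last exact: cvg_cst.
    rewrite /abel -[X in _ --> X]mul1r -expR0 -oppr0; apply: cvgM;
      apply: continuous_cvg; try exact: continuous_expR; apply: cvgN; rewrite -(normr0 R);
      by apply: cvg_norm; exact: ce.
have L2 : L @ \oo --> 4 * (f x * pi ^+ 2).
  have -> : L = fun n => 4 * I2 (fun z => f (x - e n *: z) * weight z).
    by apply/funext => n; rewrite /L abel_inversion.
  apply: cvgM; first exact: cvg_cst.
  have [K hK] := hf.2 0%N.
  rewrite -I2_weight -I2Z; last exact: ig_weight.
  apply: (@I2_dct _ _ _ (fun z => K * weight z)).
  - move=> n; apply: measM; last exact: meas_weight.
    rewrite (_ : (fun z => _) = f \o affine2 (- e n) x); first by apply: meas_affine; exact: hf.1.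
    by apply/funext => z /=; congr f; rewrite /affine2 /affine1/=; case: (x) => u v; congr (_, _) => /=; rewrite /GRing.scale/=; ring.
  - by apply: igZ; exact: ig_weight.
  - move=> n z; rewrite normrM (ger0_norm (weight_ge0 _)).
    by rewrite ler_wpM2r ?weight_ge0// (le_trans (hK _))// expr0 mulr1.
  - move=> z; apply: cvgM; last exact: cvg_cst.
    have cx : (fun n => x - e n *: z) @ \oo --> x.
      rewrite -[X in _ --> X]subr0; apply: cvgB; first exact: cvg_cst.
      by rewrite -(scale0r z); apply: cvgZr_tmp; exact: inv_succ_cvg0.
    exact: (cvg_comp _ f cx (cf x)).
have := cvg_unique (@Rhausdorff R) L1 L2 => ->.
by ring.
Qed.

End fourier_inversion.

(** * Symbols smooth off the origin and their restriction to an annulus *)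

Section smooth_away_from_origin.
Variable R : realType.
Implicit Types (f g : plane R -> R) (x y : plane R) (i : 'I_2).

(* [cdiff n i f]: n times differentiable in direction i off the origin, where the
   Riesz symbols are singular. *)
Fixpoint cdiff (n : nat) i f : Prop := (forall x, x != 0 -> {for x, continuous f}) /\
  if n is m.+1 then exists2 df, (forall x, x != 0 -> is_derive x (basis2 R i) f (df x)) &
    cdiff m i df else True.

Lemma cdiff_continuous n i f : cdiff n i f -> forall x, x != 0 -> {for x, continuous f}.
Proof. by case: n => [|n] []. Qed.

Lemma cdiffS n i f : cdiff n.+1 i f -> cdiff n i f.
Proof.
elim: n f => [|n IH] f [cf [df fd hdf]]; first by [].
by split => //; exists df => //; exact: IH.
Qed.

Lemma cdiff_cst n i c : cdiff n i (fun=> c).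
Proof.
elim: n c => [|n IH] c; (split; first by move=> x _; exact: cst_continuous) => //.
by exists (fun=> 0) => // x _; exact: is_derive_cst.
Qed.

Lemma cdiffD n i f g : cdiff n i f -> cdiff n i g -> cdiff n i (fun x => f x + g x).
Proof.
elim: n f g => [|n IH] f g [cf hf] [cg hg]; (split; first by
  move=> x x0; apply: cvgD; [exact: cf|exact: cg]) => //.
case: hf => df fd hdf; case: hg => dg gd hdg.
exists (fun x => df x + dg x); last exact: IH.
by move=> x x0; apply: is_deriveD; [exact: fd|exact: gd].
Qed.

Lemma cdiffM n i f g : cdiff n i f -> cdiff n i g -> cdiff n i (fun x => f x * g x).
Proof.
elim: n f g => [|n IH] f g hf hg; (split; first by
  move=> x x0; apply: cvgM; [exact: (cdiff_continuous hf)|exact: (cdiff_continuous hg)]) => //.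
have [_ [df fd hdf]] := hf; have [_ [dg gd hdg]] := hg.
exists (fun x => f x * dg x + g x * df x).
  by move=> x x0; exact: is_deriveM (fd x x0) (gd x x0).
by apply: cdiffD; apply: IH => //; exact: cdiffS.
Qed.

Lemma crd_shift i k x (t : R) : crd k (x + t *: basis2 R i) = crd k x + t * (k == i)%:R.
Proof.
by case: (ord2_cases i) => ->; case: (ord2_cases k) => ->; rewrite /crd /basis2 /=;
  rewrite /GRing.scale/= ?mulr0 ?mulr1.
Qed.

Lemma continuous_crd i : continuous (crd i : plane R -> R).
Proof.
by move=> x; rewrite /crd; case: (i == 0); [exact: cvg_fst|exact: cvg_snd].
Qed.

Lemma is_derive_crd i k x : is_derive x (basis2 R i) (crd k) ((k == i)%:R).
Proof.
apply: is_derive_of_line; rewrite (_ : (fun t => _) = (fun t : R => crd k x + t * (k == i)%:R)).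
  by apply: is_derive_eq; rewrite /GRing.scale/=; ring.
by apply/funext => t; rewrite crd_shift.
Qed.

Lemma cdiff_crd n i k : cdiff n i (crd k).
Proof.
case: n => [|n]; (split; first by move=> x _; exact: continuous_crd) => //.
exists (fun=> (k == i)%:R); last exact: cdiff_cst.
by move=> x _; exact: is_derive_crd.
Qed.

Definition invnorm x : R := (enorm x)^-1.

Lemma enorm_gt0 x : x != 0 -> 0 < enorm x.
Proof.
move=> x0; rewrite sqrtr_gt0 lt_neqAle addr_ge0 ?sqr_ge0// andbT eq_sym.
apply: contra x0; rewrite paddr_eq0 ?sqr_ge0// !sqrf_eq0 => /andP[/eqP a /eqP b].
by apply/eqP; case: x a b => /= ? ? -> ->.
Qed.

Lemma enorm0 : enorm (0 : plane R) = 0.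
Proof. by rewrite /enorm /= expr0n addr0 sqrtr0. Qed.

Lemma enorm_continuous : continuous (@enorm R).
Proof.
move=> x; apply: (@continuous_comp _ _ _ (fun x : plane R => x.1 ^+ 2 + x.2 ^+ 2) Num.sqrt).
  by apply: cvgD; rewrite !expr2; apply: cvgM; [exact: cvg_fst|exact: cvg_fst|exact: cvg_snd|exact: cvg_snd].
exact: sqrt_continuous.
Qed.

Lemma is_derive_invnorm i x : x != 0 ->
  is_derive x (basis2 R i) invnorm (- (crd i x * (invnorm x * (invnorm x * invnorm x)))).
Proof.
move=> x0; have e0 := enorm_gt0 x0; apply: is_derive_of_line.
have E0 : x.1 ^+ 2 + x.2 ^+ 2 = enorm x ^+ 2.
  by rewrite sqr_sqrtr// addr_ge0 ?sqr_ge0.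
rewrite (_ : (fun t => _) = (fun t : R => (Num.sqrt (enorm x ^+ 2 + t * (2 * crd i x) + t ^+ 2))^-1)); last first.
  apply/funext => t; rewrite /invnorm /enorm -E0; congr (Num.sqrt _)^-1.
  by case: (ord2_cases i) => ->; rewrite /crd /basis2 /=; rewrite /GRing.scale/=; ring.
pose q (t : R) := enorm x ^+ 2 + t * (2 * crd i x) + t ^+ 2.
have q0 : q 0 = enorm x ^+ 2 by rewrite /q expr0n mul0r !addr0.
have dq : is_derive (0 : R) 1 q (2 * crd i x).
  by apply: is_derive_eq; rewrite /GRing.scale/=; ring.
have sq : Num.sqrt (q 0) = enorm x by rewrite q0 sqrtr_sqr gtr0_norm.
have ds : is_derive (q 0) 1 (@Num.sqrt R) ((2 * Num.sqrt (q 0))^-1).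
  by apply: is_derive1_sqrt; rewrite q0 exprn_gt0.
have dc := is_derive1_comp ds dq.
have dv : is_derive (0 : R) 1 (fun t => ((@Num.sqrt R \o q) t)^-1) (- (Num.sqrt (q 0)) ^- 2 *: ((2 * Num.sqrt (q 0))^-1 * (2 * crd i x))).
  by apply: is_deriveV; rewrite /= sq lt0r_neq0.
apply: (is_derive_eq dv); rewrite sq /invnorm /GRing.scale/=; field.
exact: lt0r_neq0.
Qed.

(** The derivative of 1/|x| is a polynomial in the coordinates and 1/|x| itself, so the induction
    closes on products. *)
Lemma cdiff_invnorm n i : cdiff n i invnorm.
Proof.
elim: n => [|n IH]; (split; first by
  move=> x x0; apply: cvgV; [exact/lt0r_neq0/enorm_gt0|exact: enorm_continuous]) => //.
exists (fun x => (-1) * (crd i x * (invnorm x * (invnorm x * invnorm x)))).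
  by move=> x x0; rewrite mulN1r; exact: is_derive_invnorm.
by apply: cdiffM; [exact: cdiff_cst|]; apply: cdiffM; [exact: cdiff_crd|]; do 2 (apply: cdiffM => //).
Qed.

Lemma cdiff_transform n i f : rapid f -> cdiff n i (tcos f) /\ cdiff n i (tsin f).
Proof.
elim: n f => [|n IH] f hf.
  by split; split => // x _; [exact: continuous_tcos|exact: continuous_tsin].
have [h1 h2] := IH _ (rapid_coord i hf).
split; split.
- by move=> x _; exact: continuous_tcos.
- exists (fun x => (-1) * tsin (fun xi => crd i xi * f xi) x).
    by move=> x _; rewrite mulN1r; exact: is_derive_tcos.
  by apply: cdiffM => //; exact: cdiff_cst.
- by move=> x _; exact: continuous_tsin.
- exists (tcos (fun xi => crd i xi * f xi)) => //.
  by move=> x _; exact: is_derive_tsin.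
Qed.

Lemma near_neq0 x : x != 0 -> \forall y \near x, y != 0.
Proof.
move=> x0; have H : \forall y \near x, 0 < enorm y.
  by apply: (cvgr_gt (enorm x) (@enorm_continuous x)); exact: enorm_gt0.
by apply: (@filterS _ _ (nbhs_filter x) _ _ _ H) => y; apply: contraTneq => ->; rewrite enorm0 ltxx.
Qed.

Lemma near_eq_continuous f g x : (\forall y \near x, f y = g y) ->
  {for x, continuous f} -> {for x, continuous g}.
Proof.
move=> fg cf; have fx : f x = g x := nbhs_singleton fg.
have : g @ x --> f x by exact: cvg_trans (near_eq_cvg fg) cf.
by rewrite fx.
Qed.

Lemma cdiff_congr n i f g : (forall x, x != 0 -> f x = g x) -> cdiff n i f -> cdiff n i g.
Proof.
move=> fg; have nb x : x != 0 -> \forall y \near x, f y = g y.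
  by move=> x0; apply: (@filterS _ _ (nbhs_filter x) _ _ _ (near_neq0 x0)) => y; exact: fg.
case: n => [|n] [cf hf]; (split; first by
  move=> x x0; apply: (near_eq_continuous (nb x x0)); exact: cf) => //.
case: hf => df fd hdf; exists df => // x x0.
apply: near_eq_is_derive (fd x x0); first by apply: (@filterS _ _ (nbhs_filter x) _ _ _ (nb x x0)) => y ->.
Qed.

Section annulus.
Variables r s : R.
Hypothesis r0 : 0 < r.

Definition off_annulus x := ~~ (r <= enorm x <= s).

Lemma near_off_annulus x : off_annulus x -> \forall y \near x, off_annulus y.
Proof.
rewrite /off_annulus negb_and -!ltNge => /orP[h|h].
  have H : \forall y \near x, enorm y < r by apply: (cvgr_lt (enorm x) (@enorm_continuous x)).
  by apply: (@filterS _ _ (nbhs_filter x) _ _ _ H) => y h'; rewrite negb_and -!ltNge h'.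
have H : \forall y \near x, s < enorm y by apply: (cvgr_gt (enorm x) (@enorm_continuous x)).
by apply: (@filterS _ _ (nbhs_filter x) _ _ _ H) => y h'; rewrite negb_and -!ltNge h' orbT.
Qed.

Lemma off_annulus0 : off_annulus 0.
Proof. by rewrite /off_annulus enorm0 leNgt r0. Qed.

(** The origin has a neighbourhood off the annulus, where [f] is zero, so a singularity there is
    invisible; bounded support then gives decay of every order. *)
Lemma annulus_rapid f : (forall x, x != 0 -> {for x, continuous f}) ->
  (forall x, off_annulus x -> f x = 0) -> continuous f /\ rapid f.
Proof.
move=> cf f0.
have c : continuous f.
  move=> x; have [->|x0] := eqVneq x 0; last exact: cf.
  apply: (@near_eq_continuous (fun=> 0)); last exact: cst_continuous.
  by apply: (@filterS _ _ (nbhs_filter _) _ _ _ (near_off_annulus off_annulus0)) => y /f0.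
split=> //; split; first exact: meas_continuous.
move=> n.
pose A : set (plane R) := `[- `|s|, `|s|] `*` `[- `|s|, `|s|].
have cA : compact A by apply: compact_setX; exact: segment_compact.
have A0 : A !=set0 by exists 0; split => /=; rewrite in_itv/= oppr_le0 normr_ge0.
have [c0 _ hc] := @compact_EVT_max _ R (fun x => `|f x|) A A0 cA
  (continuous_subspaceT (fun x => cvg_norm (c x))).
(* On the annulus both coordinates are at most |s|, so the inverse weight is at most (1 + s^2)^2. *)
exists (`|f c0| * ((1 + s ^+ 2) ^+ 2) ^+ n) => x.
have w0 := weight_gt0 x.
have [xA|xA] := boolP (off_annulus x).
  by rewrite f0// normr0 !mulr_ge0// exprn_ge0// ?sqr_ge0// weight_ge0.
have xs : x.1 ^+ 2 <= s ^+ 2 /\ x.2 ^+ 2 <= s ^+ 2.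
  move: xA; rewrite /off_annulus negbK => /andP[_ xs].
  have : enorm x ^+ 2 <= s ^+ 2 by rewrite lerXn2r// nnegrE ?(le_trans _ xs)// sqrtr_ge0.
  rewrite sqr_sqrtr ?addr_ge0 ?sqr_ge0// => h.
  by split; apply: le_trans h; rewrite ?lerDl ?lerDr sqr_ge0.
have H (t : R) : t ^+ 2 <= s ^+ 2 -> `|t| <= `|s|.
  by rewrite -(real_normK (num_real t)) -(real_normK (num_real s)) ler_pXn2r// nnegrE.
rewrite -mulrA -exprMn; apply: (@le_trans _ _ (`|f c0| * 1)).
  rewrite mulr1; apply: hc; rewrite inE; split => /=; rewrite in_itv/= -ler_norml; apply: H; tauto.
rewrite ler_wpM2l// exprn_ege1//.
rewrite -ler_pdivrMr// mul1r /weight invfM !invrK expr2.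
by apply: ler_pM; rewrite ?addr_ge0 ?sqr_ge0// lerD2l; tauto.
Qed.

End annulus.

End smooth_away_from_origin.

Section annulus_smooth.
Variable R : realType.
Implicit Types (f g : plane R -> R) (x y : plane R) (i : 'I_2).
Variables r s : R.
Hypothesis r0 : 0 < r.

Lemma is_derive_unique f x v d1 d2 : is_derive x v f d1 -> is_derive x v f d2 -> d1 = d2.
Proof. by move=> [_ <-] [_ <-]. Qed.

Lemma is_derive_off_annulus i f x : (forall x, off_annulus r s x -> f x = 0) ->
  off_annulus r s x -> is_derive x (basis2 R i) f 0.
Proof.
move=> f0 ox; apply: (@near_eq_is_derive _ _ _ (fun=> 0 : R)).
by apply: (@filterS _ _ (nbhs_filter _) _ _ _ (near_off_annulus ox)) => y /f0 ->.
Qed.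

Lemma cdiff_rapid_smooth n i f : cdiff n i f ->
  (forall x, off_annulus r s x -> f x = 0) -> rapid_smooth n i f.
Proof.
elim: n f => [|n IH] f cf f0.
  by split => //; exact: (annulus_rapid r0 (cdiff_continuous cf) f0).2.
split; first exact: (annulus_rapid r0 (cdiff_continuous cf) f0).2.
have [_ [df fd hdf]] := cf.
(* [cdiff] leaves the value of [df] at the origin arbitrary; the true derivative there is 0, since
   [f] vanishes nearby. *)
exists (fun x => if x == 0 then 0 else df x).
  move=> x; case: eqVneq => [->|x0]; last exact: fd.
  by apply: is_derive_off_annulus => //; exact: off_annulus0.
apply: IH.
  by apply: cdiff_congr hdf => x /negbTE ->.
move=> x ox; case: eqVneq => // x0.
exact: is_derive_unique (fd x x0) (is_derive_off_annulus i f0 ox).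
Qed.

End annulus_smooth.

Section schwartz_functions.
Variable R : realType.
Implicit Types (f : plane R -> R) (phi : plane R -> R[i]) (x xi : plane R) (i : 'I_2).

Lemma schwartzR_continuous f : schwartzR f -> continuous f.
Proof. by move=> /(_ [::]) [/= df _] x; exact: differentiable_continuous. Qed.

Lemma schwartzR_rapid f : schwartzR f -> rapid f.
Proof.
move=> sf; apply: rapid_of_moments.
  by apply: meas_continuous; exact: schwartzR_continuous.
have [_ H] := sf [::] => n i; case: (ord2_cases i) => ->.
  have [C hC] := H n 0%N; exists C => x; have := hC x.
  by rewrite expr0 mulr1.
have [C hC] := H 0%N n; exists C => x; have := hC x.
by rewrite expr0 mul1r.
Qed.

Lemma schwartzR_partial i f : schwartzR f -> schwartzR (partial i f).
Proof.
move=> sf s; rewrite -[foldr _ _ _]/(foldr (@partial R) (foldr (@partial R) f [:: i]) s).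
by rewrite -foldr_cat; exact: sf.
Qed.

Lemma is_derive_partial i f x : differentiable f x ->
  is_derive x (basis2 R i) f (partial i f x).
Proof. by move=> df; apply: DeriveDef => //; exact: diff_derivable. Qed.

Lemma schwartzR_is_derive i f x : schwartzR f -> is_derive x (basis2 R i) f (partial i f x).
Proof. by move=> /(_ [::]) [/= df _]; exact: is_derive_partial. Qed.

(** With [fim], the two parts of the unitary Fourier transform of p + i q. *)
Definition fre (p q : plane R -> R) xi : R := (2 * pi)^-1 * (tcos p xi + tsin q xi).
Definition fim (p q : plane R -> R) xi : R := (2 * pi)^-1 * (tcos q xi - tsin p xi).

Lemma mulcE (c u v : R) : c%:C * (u +i* v) = (c * u) +i* (c * v).
Proof. by apply/eqP; rewrite eq_complex /= !mul0r subr0 addr0 !eqxx. Qed.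

Lemma fourierE phi xi : rapid (fun x => complex.Re (phi x)) -> rapid (fun x => complex.Im (phi x)) ->
  fourier phi xi = fre (fun x => complex.Re (phi x)) (fun x => complex.Im (phi x)) xi
    +i* fim (fun x => complex.Re (phi x)) (fun x => complex.Im (phi x)) xi.
Proof.
move=> hp hq; rewrite /fourier /cintegral.
rewrite -[X in X +i* _]/(I2 _) -[X in _ +i* X]/(I2 _) /fre /fim.
have i1 := rapid_ig (rapid_cos xi hp); have i2 := rapid_ig (rapid_sin xi hq).
have i3 := rapid_ig (rapid_cos xi hq); have i4 := rapid_ig (rapid_sin xi hp).
rewrite /tcos /tsin -I2D// -I2B//.
rewrite mulcE; congr (_ * _ +i* (_ * _)); congr I2; apply/funext => x.
  by case: (phi x) => u v; rewrite /cis /= cosN sinN (dotC x); ring.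
by case: (phi x) => u v; rewrite /cis /= cosN sinN (dotC x); ring.
Qed.

Lemma inv_fourierE (A B : plane R -> R) x : rapid A -> rapid B ->
  inv_fourier (fun xi => A xi +i* B xi) x =
  ((2 * pi)^-1 * (tcos A x - tsin B x)) +i* ((2 * pi)^-1 * (tcos B x + tsin A x)).
Proof.
move=> hA hB; rewrite /inv_fourier /cintegral.
rewrite -[X in X +i* _]/(I2 _) -[X in _ +i* X]/(I2 _).
have i1 := rapid_ig (rapid_cos x hA); have i2 := rapid_ig (rapid_sin x hB).
have i3 := rapid_ig (rapid_cos x hB); have i4 := rapid_ig (rapid_sin x hA).
rewrite /tcos /tsin -I2D// -I2B//.
by rewrite mulcE.
Qed.

End schwartz_functions.

(** * Littlewood-Paley blocks *)

Section littlewood_paley_pieces.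
Variables (R : realType) (phi : int -> plane R -> R[i]).
Hypothesis hphi : littlewood_paley phi.
Implicit Types (x xi : plane R) (i : 'I_2) (j k : int).

(** Since [phi j] is complex valued, four real functions are carried for each block: [lpr] and [lpi]
    in space, [lpa] and [lpb] in frequency. *)
Definition lpr j x : R := complex.Re (phi j x).
Definition lpi j x : R := complex.Im (phi j x).
Definition lpa j : plane R -> R := fre (lpr j) (lpi j).
Definition lpb j : plane R -> R := fim (lpr j) (lpi j).
Local Notation lam j := ((2 : R) ^ j).

Lemma lam_gt0 j : 0 < lam j. Proof. exact: exprz_gt0. Qed.

Lemma schwartz_lpr j : schwartzR (lpr j). Proof. by case: hphi => /(_ j) []. Qed.
Lemma schwartz_lpi j : schwartzR (lpi j). Proof. by case: hphi => /(_ j) []. Qed.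
Lemma rapid_lpr j : rapid (lpr j). Proof. exact: schwartzR_rapid (schwartz_lpr j). Qed.
Lemma rapid_lpi j : rapid (lpi j). Proof. exact: schwartzR_rapid (schwartz_lpi j). Qed.

Lemma fourier_phiE j xi : fourier (phi j) xi = lpa j xi +i* lpb j xi.
Proof. by apply: fourierE; [exact: rapid_lpr|exact: rapid_lpi]. Qed.

Lemma enormZ (c : R) xi : enorm (c * xi.1, c * xi.2) = `|c| * enorm xi.
Proof. by rewrite /enorm /= !exprMn -mulrDr sqrtrM ?sqr_ge0// sqrtr_sqr. Qed.

Lemma lp_scale j xi : lpa j xi = lpa 0 (2 ^ (- j) * xi.1, 2 ^ (- j) * xi.2) /\
  lpb j xi = lpb 0 (2 ^ (- j) * xi.1, 2 ^ (- j) * xi.2).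
Proof. by case: hphi => _ /(_ j xi) + _ _ _; rewrite !fourier_phiE => -[]. Qed.

Lemma lp_support j xi : off_annulus (lam (j - 1)) (lam (j + 1)) xi -> lpa j xi = 0 /\ lpb j xi = 0.
Proof.
move=> ox; have [-> ->] := lp_scale j xi.
set y : plane R := (_, _).
have [/eqP|fy] := eqVneq (fourier (phi 0) y) 0.
  by rewrite fourier_phiE eq_complex /= => /andP[/eqP ? /eqP ?].
have cy : closure [set xi : plane R | fourier (phi 0) xi != 0] y by apply: subset_closure.
have [_ _ /(_ y cy) /= /andP[h1 h2] _ _] := hphi.
move: ox; rewrite /off_annulus => /negP[].
move: h1 h2; rewrite enormZ (gtr0_norm (lam_gt0 _)) -invr_expz mulrC.
rewrite ler_pdivlMr ?lam_gt0// ler_pdivrMr ?lam_gt0// => h1 h2.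
have l1 : lam (j - 1) = 2^-1 * lam j by rewrite expfzDr ?pnatr_eq0// exprN1 mulrC.
have l2 : lam (j + 1) = 2 * lam j by rewrite expfzDr ?pnatr_eq0// expr1z mulrC.
by rewrite l1 l2 h1 h2.
Qed.

Lemma cdiff_lp n i j : cdiff n i (lpa j) /\ cdiff n i (lpb j).
Proof.
have [p1 p2] := cdiff_transform n i (rapid_lpr j).
have [q1 q2] := cdiff_transform n i (rapid_lpi j).
split; apply: cdiffM; try exact: cdiff_cst; apply: cdiffD => //.
by apply: (cdiff_congr (f := fun x => (-1) * tsin (lpr j) x)) => [x _|]; [rewrite mulN1r|apply: cdiffM => //; exact: cdiff_cst].
Qed.

Lemma rapid_smooth_lp n i j (mu : plane R -> R) : cdiff n i mu ->
  rapid_smooth n i (fun xi => mu xi * lpa j xi) /\ rapid_smooth n i (fun xi => mu xi * lpb j xi).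
Proof.
move=> cmu; have [ca cb] := cdiff_lp n i j.
split; apply: (cdiff_rapid_smooth (lam_gt0 (j - 1)) (s := lam (j + 1))); try exact: cdiffM;
  by move=> x /lp_support [h1 h2]; rewrite ?h1 ?h2 mulr0.
Qed.

(** The annuli of blocks j and k meet only if |j - k| <= 2, so on the support of block j the
    partition of unity reduces to five terms. The two outermost annuli share just a circle with that
    of block j; keeping them avoids a continuity argument. *)
Lemma lp_partition j xi :
  \sum_(m < 5) (lpa j xi * lpa (j - 2 + m%:Z) xi - lpb j xi * lpb (j - 2 + m%:Z) xi) = lpa j xi /\
  \sum_(m < 5) (lpa j xi * lpb (j - 2 + m%:Z) xi + lpb j xi * lpa (j - 2 + m%:Z) xi) = lpb j xi.
Proof.
have [ox|] := boolP (off_annulus (lam (j - 1)) (lam (j + 1)) xi).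
  have [-> ->] := lp_support ox.
  by split; rewrite big1// => m _; rewrite !mul0r ?subr0 ?addr0.
rewrite /off_annulus negbK => /andP[l1 l2].
have xi0 : xi != 0 by apply: contraTneq l1 => ->; rewrite enorm0 -ltNge lam_gt0.
have l12 : (1 : R) < 2 by rewrite ltr1n.
have S : \sum_(m < 5) fourier (phi (j - 2 + m%:Z)) xi = 1.
  have [_ _ _ _ /(_ xi xi0) <-] := hphi.
  pose r := [seq j - 2 + (m%:Z : int) | m <- iota 0 5].
  have ur : uniq r by rewrite map_inj_uniq ?iota_uniq// => m n /addrI [].
  rewrite -(@fsbig_widen _ _ _ _ [set` r])//=.
    by rewrite -fsbig_seq// big_map -[in RHS](subn0 5%N) -/(index_iota 0 5) big_mkord.
  move=> k [_ /= kr]; have ok : off_annulus (lam (k - 1)) (lam (k + 1)) xi.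
    apply/negP => /andP[k1 k2]; apply: kr.
    have k3 : k - 1 <= j + 1.
      by rewrite -(ler_eXz2l l12); exact: le_trans k1 l2.
    have k4 : j - 1 <= k + 1.
      by rewrite -(ler_eXz2l l12); exact: le_trans l1 k2.
    apply/mapP; exists (absz (k - j + 2)); first by rewrite mem_iota; lia.
    by lia.
  have [h1 h2] := lp_support ok.
  by rewrite fourier_phiE h1 h2.
have [Sa Sb] : \sum_(m < 5) lpa (j - 2 + m%:Z) xi = 1 /\ \sum_(m < 5) lpb (j - 2 + m%:Z) xi = 0.
  have -> : \sum_(m < 5) lpa (j - 2 + m%:Z) xi = complex.Re (\sum_(m < 5) fourier (phi (j - 2 + m%:Z)) xi).
    by rewrite raddf_sum; apply: eq_bigr => m _; rewrite fourier_phiE.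
  have -> : \sum_(m < 5) lpb (j - 2 + m%:Z) xi = complex.Im (\sum_(m < 5) fourier (phi (j - 2 + m%:Z)) xi).
    by rewrite raddf_sum; apply: eq_bigr => m _; rewrite fourier_phiE.
  by rewrite S.
split.
  by rewrite sumrB -[X in X - _]mulr_sumr -[X in _ - X]mulr_sumr Sa Sb mulr1 mulr0 subr0.
by rewrite big_split /= -[X in X + _]mulr_sumr -[X in _ + X]mulr_sumr Sa Sb mulr1 mulr0 add0r.
Qed.

End littlewood_paley_pieces.

(** * Convolution with rapidly decaying kernels *)

Section real_convolution.
Variable R : realType.
Implicit Types (f g h p q A B : plane R -> R) (x y z xi : plane R).

Definition rconv h f x : R := I2 (fun y => h (x - y) * f y).

Lemma convolutionE (phi : plane R -> R[i]) f x :
  convolution phi f x = rconv (fun x => complex.Re (phi x)) f x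
    +i* rconv (fun x => complex.Im (phi x)) f x.
Proof.
rewrite /convolution /cintegral; congr (_ +i* _); congr Rintegral; apply/funext => y;
by case: (phi (x - y)) => u v /=; rewrite mulr0 ?subr0 ?add0r.
Qed.

(** The growth class of theta and v, for which only the gradients are known to be bounded; it
    contains all functions of linear growth. *)
Definition moderate f := meas f /\ exists K, forall x, `|f x| <= K / weight x.

Lemma moderate_bounded f K : meas f -> (forall x, `|f x| <= K) -> moderate f.
Proof.
move=> mf fK; split=> //; exists K => x; apply: (le_trans (fK x)).
have K0 : 0 <= K by exact: le_trans (fK 0).
by rewrite ler_peMr// invf_ge1 ?weight_gt0 ?weight_le1.
Qed.

Lemma weightN x : weight (- x) = weight x.
Proof. by rewrite /weight /= !sqrrN. Qed.

Lemma sub_affine x y : x - y = affine2 (-1) x y.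
Proof. by rewrite /affine2 /affine1 !mulN1r; case: x y => a b [c d]; congr (_, _) => /=; rewrite addrC. Qed.

Lemma meas_reflect h x : meas h -> meas (fun y => h (x - y)).
Proof.
move=> mh; rewrite (_ : (fun y => _) = h \o affine2 (-1) x); first exact: meas_affine.
by apply/funext => y; rewrite sub_affine.
Qed.

Lemma weight_sub x y : weight (x - y) <= 4 * weight y / weight x.
Proof. by rewrite addrC -(weightN y); exact: weight_add. Qed.

Lemma rapid_reflect h x : rapid h -> rapid (fun y => h (x - y)).
Proof.
move=> [mh hh]; split; first exact: meas_reflect.
move=> n; have [K hK] := hh n; exists (K * (4 / weight x) ^+ n) => y.
apply: (le_trans (hK _)); rewrite -mulrA -exprMn ler_wpM2l ?(rapid_ge0 hK)//.
rewrite lerXn2r ?nnegrE ?weight_ge0//.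
  by rewrite mulr_ge0 ?weight_ge0// divr_ge0 ?weight_ge0.
by rewrite mulrAC; exact: weight_sub.
Qed.

Lemma rconv_ig h f x : rapid h -> moderate f -> ig (fun y => h (x - y) * f y).
Proof.
move=> hh [mf [K hK]]; rewrite (_ : (fun y => _) = (fun y => f y * h (x - y))).
  by apply: rapid_ig; apply: (rapid_moderate (rapid_reflect x hh) mf hK).
by apply/funext => y; rewrite mulrC.
Qed.

Lemma rapid_is_moderate p : rapid p -> moderate p.
Proof.
move=> [mp hp]; have [K hK] := hp 0%N; apply: (moderate_bounded (K := K) mp) => x.
by have := hK x; rewrite expr0 mulr1.
Qed.

Lemma I2_reflect h x : ig h -> I2 (fun y => h (x - y)) = I2 h.
Proof.
move=> hh; rewrite (_ : (fun y => _) = h \o affine2 (-1) x).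
  by rewrite I2_affine ?oppr_eq0 ?oner_eq0// sqrrN expr1n invr1 mul1r.
by apply/funext => y; rewrite sub_affine.
Qed.

(** Young's inequality between L1 and the sup norm. *)
Lemma rconv_bound h f x N : rapid h -> meas f -> (forall y, `|f y| <= N) ->
  `|rconv h f x| <= N * I2 (fun y => `|h y|).
Proof.
move=> hh mf fN; have ih := ig_abs (rapid_ig hh).
rewrite -(I2_reflect x ih) -I2Z; last exact: ig_abs (rapid_ig (rapid_reflect x hh)).
apply: I2_bound.
- by apply: ig_meas; apply: rconv_ig => //; exact: moderate_bounded fN.
- by apply: igZ; exact: ig_abs (rapid_ig (rapid_reflect x hh)).
- by move=> y; rewrite normrM mulrC ler_wpM2r.
Qed.

Lemma rconvBr h f g x : rapid h -> moderate f -> moderate g ->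
  rconv h (fun y => f y - g y) x = rconv h f x - rconv h g x.
Proof.
move=> hh mf mg; rewrite /rconv -I2B; [|exact: rconv_ig|exact: rconv_ig].
by congr I2; apply/funext => y; rewrite mulrBr.
Qed.

Lemma rconvDl h1 h2 f x : rapid h1 -> rapid h2 -> moderate f ->
  rconv (fun y => h1 y + h2 y) f x = rconv h1 f x + rconv h2 f x.
Proof.
move=> hh1 hh2 mf; rewrite /rconv -I2D; [|exact: rconv_ig|exact: rconv_ig].
by congr I2; apply/funext => y; rewrite mulrDl.
Qed.

Lemma rconvZl c h f x : rapid h -> moderate f ->
  rconv (fun y => c * h y) f x = c * rconv h f x.
Proof.
move=> hh mf; rewrite /rconv -I2Z; last exact: rconv_ig.
by congr I2; apply/funext => y; rewrite mulrA.
Qed.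

Lemma meas2_sub p : meas p -> meas2 (fun y z => p (y - z)).
Proof.
move=> mp; rewrite (_ : (fun y z => _) = (fun y z => p (y.1 - z.1, y.2 - z.2))).
  apply: (@meas2_comp_pair _ p (fun y z => y.1 - z.1) (fun y z => y.2 - z.2)) => //.
    by apply: (@meas2B _ (fun y _ => y.1) (fun _ z => z.1)); [exact: meas2_l (@meas_fst R)|exact: meas2_r (@meas_fst R)].
  by apply: (@meas2B _ (fun y _ => y.2) (fun _ z => z.2)); [exact: meas2_l (@meas_snd R)|exact: meas2_r (@meas_snd R)].
by apply/funext => y; apply/funext => z.
Qed.

Lemma rconv_assoc h p f x : rapid h -> rapid p -> moderate f ->
  rconv h (rconv p f) x = rconv (rconv h p) f x.
Proof.
move=> hh hp mf; pose F y z := h (x - y) * p (y - z) * f z.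
have [mf1 [Kf hKf]] := mf.
(* Exponent 2 on p(y - z) gives weight(z)^2 / weight(y)^2 by Peetre's inequality; one factor in z
   absorbs the growth of [f]. Exponent 3 on h(x - y) repays the loss in y. One power of the weight
   is left in each variable to integrate. *)
have [K1 hK1] := (rapid_reflect x hh).2 3%N; have [K2 hK2] := hp.2 2%N.
have K10 := rapid_ge0 hK1; have K20 := rapid_ge0 hK2.
transitivity (I2 (fun y => I2 (fun z => F y z))).
  congr I2; apply/funext => y; rewrite /rconv -I2Z; last exact: rconv_ig.
  by congr I2; apply/funext => z; rewrite /F mulrA.
have Kf0 : 0 <= Kf.
  have w0 : 0 < (weight (0 : plane R))^-1 by rewrite invr_gt0 weight_gt0.
  by rewrite -(pmulr_lge0 _ w0); exact: le_trans (hKf 0).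
rewrite (@I2_swap _ F (fun y => K1 * K2 * 16 * weight y) (fun z => Kf * weight z)).
- congr I2; apply/funext => z.
  have ihp : ig (fun y => h (x - y) * p (y - z)).
    have -> : (fun y => h (x - y) * p (y - z)) = (fun y => h (x - z - y) * p y) \o affine2 1 (- z).
      apply/funext => y /=; rewrite (_ : affine2 1 (- z) y = y - z); last first.
        by rewrite /affine2 /affine1 !mul1r; case: y z => a b [c d].
      by congr (h _ * _); rewrite opprB -!addrA addKr.
    by apply: ig_affine (oner_neq0 _) _; apply: rconv_ig => //; exact: rapid_is_moderate.
  rewrite /F (_ : (fun y => _) = (fun y => f z * (h (x - y) * p (y - z)))); last by apply/funext => y; ring.
  rewrite I2Z// mulrC; congr (_ * _).
  rewrite /rconv (_ : (fun y => h (x - y) * p (y - z)) = (fun y => h (x - z - y) * p y) \o affine2 1 (- z)).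
    rewrite I2_affine ?oner_neq0// ?expr1n ?invr1 ?mul1r//.
    by apply: rconv_ig => //; exact: rapid_is_moderate.
  apply/funext => y /=; rewrite (_ : affine2 1 (- z) y = y - z); last first.
    by rewrite /affine2 /affine1 !mul1r; case: y z {ihp} => a b [c d].
  by congr (h _ * _); rewrite opprB -!addrA addKr.
- apply: (@meas2M _ (fun y z => h (x - y) * p (y - z)) (fun _ z => f z)); last exact: meas2_r.
  apply: (@meas2M _ (fun y _ => h (x - y)) (fun y z => p (y - z))).
    by apply: meas2_l; exact: meas_reflect hh.1.
  exact: meas2_sub hp.1.
- exact: igZ (@ig_weight R).
- exact: igZ (@ig_weight R).
- by move=> y; apply: mulr_ge0 (weight_ge0 y); rewrite mulr_ge0 ?mulr_ge0 ?ler0n.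
- by move=> z; exact: mulr_ge0 Kf0 (weight_ge0 z).
move=> y z; rewrite /F !normrM.
have wy := weight_gt0 y; have wz := weight_gt0 z.
have Hp : `|p (y - z)| <= K2 * (4 * weight z / weight y) ^+ 2.
  apply: (le_trans (hK2 _)); rewrite ler_wpM2l// lerXn2r ?nnegrE ?weight_ge0 ?weight_sub//.
  exact: divr_ge0 (mulr_ge0 (ler0n R 4) (ltW wz)) (ltW wy).
rewrite (_ : _ * (Kf * _) = (K1 * weight y ^+ 3) * (K2 * (4 * weight z / weight y) ^+ 2) * (Kf / weight z)).
  by rewrite !ler_pM ?mulr_ge0.
by field; rewrite !gt_eqF.
Qed.

(** Fubini and the addition formula: convolving the transform of [A] with [p] multiplies [A] by the
    transform of [p]. *)
Lemma rconv_tcos A p x : rapid A -> rapid p ->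
  rconv (tcos A) p x = tcos (fun xi => A xi * tcos p xi) x + tsin (fun xi => A xi * tsin p xi) x.
Proof.
move=> hA hp; pose F y xi := cos (dot (x - y) xi) * A xi * p y.
transitivity (I2 (fun y => I2 (fun xi => F y xi))).
  congr I2; apply/funext => y; rewrite /tcos mulrC -I2Z; last exact: rapid_ig (rapid_cos _ hA).
  by congr I2; apply/funext => xi; rewrite /F mulrC.
rewrite (@I2_swap _ F (fun y => `|p y|) (fun xi => `|A xi|)).
- have ic xi := rapid_ig (rapid_cos xi hp); have is_ xi := rapid_ig (rapid_sin xi hp).
  have bc : rapid (fun xi => A xi * tcos p xi).
    rewrite (_ : (fun xi => _) = (fun xi => tcos p xi * A xi)); last by apply/funext => xi; rewrite mulrC.
    apply: (rapid_bounded hA); last by move=> xi; exact: (tcos_bound xi hp).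
    by apply: meas_continuous; exact: continuous_tcos.
  have bs : rapid (fun xi => A xi * tsin p xi).
    rewrite (_ : (fun xi => _) = (fun xi => tsin p xi * A xi)); last by apply/funext => xi; rewrite mulrC.
    apply: (rapid_bounded hA); last by move=> xi; exact: (tsin_bound xi hp).
    by apply: meas_continuous; exact: continuous_tsin.
  rewrite {1}/tcos {2}/tsin -I2D; [|exact: rapid_ig (rapid_cos _ bc)|exact: rapid_ig (rapid_sin _ bs)].
  congr I2; apply/funext => xi; rewrite /F.
  rewrite (_ : (fun y => _) = (fun y => (cos (dot x xi) * A xi) * (cos (dot xi y) * p y) + (sin (dot x xi) * A xi) * (sin (dot xi y) * p y))).
    by rewrite I2D ?I2Z//; [rewrite /tcos /tsin; ring|exact: igZ|exact: igZ].
  by apply/funext => y; rewrite dotBl cosB (dotC y); ring.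
- apply: (@meas2M _ (fun y xi => cos (dot (x - y) xi) * A xi) (fun y _ => p y)); last exact: meas2_l hp.1.
  apply: (@meas2M _ (fun y xi => cos (dot (x - y) xi)) (fun _ xi => A xi)); last exact: meas2_r hA.1.
  apply: (meas2_comp (@continuous_cos R)).
  rewrite (_ : (fun y xi => _) = (fun y xi => dot xi (x - y))); last by apply/funext => y; apply/funext => xi; rewrite dotC.
  apply: (@meas2D _ (fun y xi => xi.1 * (x - y).1) (fun y xi => xi.2 * (x - y).2)).
    apply: (@meas2M _ (fun _ xi => xi.1) (fun y _ => (x - y).1)); first exact: meas2_r (@meas_fst R).
    by apply: meas2_l; apply: measB; [exact: meas_cst|exact: meas_fst].
  apply: (@meas2M _ (fun _ xi => xi.2) (fun y _ => (x - y).2)); first exact: meas2_r (@meas_snd R).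
  by apply: meas2_l; apply: measB; [exact: meas_cst|exact: meas_snd].
- exact/ig_abs/rapid_ig.
- exact/ig_abs/rapid_ig.
- by [].
- by [].
- move=> y xi; rewrite /F !normrM mulrC ler_wpM2l// ler_piMl//; exact: norm_cos_le1.
Qed.

Lemma rconv_tsin A p x : rapid A -> rapid p ->
  rconv (tsin A) p x = tsin (fun xi => A xi * tcos p xi) x - tcos (fun xi => A xi * tsin p xi) x.
Proof.
move=> hA hp; pose F y xi := sin (dot (x - y) xi) * A xi * p y.
transitivity (I2 (fun y => I2 (fun xi => F y xi))).
  congr I2; apply/funext => y; rewrite /tsin mulrC -I2Z; last exact: rapid_ig (rapid_sin _ hA).
  by congr I2; apply/funext => xi; rewrite /F mulrC.
rewrite (@I2_swap _ F (fun y => `|p y|) (fun xi => `|A xi|)).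
- have ic xi := rapid_ig (rapid_cos xi hp); have is_ xi := rapid_ig (rapid_sin xi hp).
  have bc : rapid (fun xi => A xi * tcos p xi).
    rewrite (_ : (fun xi => _) = (fun xi => tcos p xi * A xi)); last by apply/funext => xi; rewrite mulrC.
    apply: (rapid_bounded hA); last by move=> xi; exact: (tcos_bound xi hp).
    by apply: meas_continuous; exact: continuous_tcos.
  have bs : rapid (fun xi => A xi * tsin p xi).
    rewrite (_ : (fun xi => _) = (fun xi => tsin p xi * A xi)); last by apply/funext => xi; rewrite mulrC.
    apply: (rapid_bounded hA); last by move=> xi; exact: (tsin_bound xi hp).
    by apply: meas_continuous; exact: continuous_tsin.
  rewrite {1}/tsin {2}/tcos -I2B; [|exact: rapid_ig (rapid_sin _ bc)|exact: rapid_ig (rapid_cos _ bs)].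
  congr I2; apply/funext => xi; rewrite /F.
  rewrite (_ : (fun y => _) = (fun y => (sin (dot x xi) * A xi) * (cos (dot xi y) * p y) - (cos (dot x xi) * A xi) * (sin (dot xi y) * p y))).
    by rewrite I2B ?I2Z//; [rewrite /tcos /tsin; ring|exact: igZ|exact: igZ].
  by apply/funext => y; rewrite dotBl sinB (dotC y); ring.
- apply: (@meas2M _ (fun y xi => sin (dot (x - y) xi) * A xi) (fun y _ => p y)); last exact: meas2_l hp.1.
  apply: (@meas2M _ (fun y xi => sin (dot (x - y) xi)) (fun _ xi => A xi)); last exact: meas2_r hA.1.
  apply: (meas2_comp (@continuous_sin R)).
  rewrite (_ : (fun y xi => _) = (fun y xi => dot xi (x - y))); last by apply/funext => y; apply/funext => xi; rewrite dotC.
  apply: (@meas2D _ (fun y xi => xi.1 * (x - y).1) (fun y xi => xi.2 * (x - y).2)).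
    apply: (@meas2M _ (fun _ xi => xi.1) (fun y _ => (x - y).1)); first exact: meas2_r (@meas_fst R).
    by apply: meas2_l; apply: measB; [exact: meas_cst|exact: meas_fst].
  apply: (@meas2M _ (fun _ xi => xi.2) (fun y _ => (x - y).2)); first exact: meas2_r (@meas_snd R).
  by apply: meas2_l; apply: measB; [exact: meas_cst|exact: meas_snd].
- exact/ig_abs/rapid_ig.
- exact/ig_abs/rapid_ig.
- by [].
- by [].
- move=> y xi; rewrite /F !normrM mulrC ler_wpM2l// ler_piMl//; exact: norm_sin_le1.
Qed.

End real_convolution.

Section kernels.
Variable R : realType.
Implicit Types (f g h p q A B : plane R -> R) (x y z xi : plane R) (i : 'I_2).

(** With [K2], the real and imaginary parts of the inverse unitary transform of A + i B. *)
Definition K1 A B x : R := (2 * pi)^-1 * (tcos A x - tsin B x).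
Definition K2 A B x : R := (2 * pi)^-1 * (tcos B x + tsin A x).

Definition nice A := [/\ rapid A, rapid (tcos A) & rapid (tsin A)].

Lemma nice_smooth A : (forall n i, rapid_smooth n i A) -> nice A.
Proof. by move=> sA; have [h1 h2] := rapid_transform sA; split => //; exact: rapid_smooth_rapid (sA 0%N 0). Qed.

Lemma rapid_K1 A B : nice A -> nice B -> rapid (K1 A B).
Proof. by move=> [_ h1 _] [_ _ h2]; apply: rapidZ; apply: rapidD => //; exact: rapidN. Qed.

Lemma rapid_K2 A B : nice A -> nice B -> rapid (K2 A B).
Proof. by move=> [_ _ h1] [_ h2 _]; apply: rapidZ; apply: rapidD. Qed.

Lemma rconvNl h f x : rapid h -> moderate f -> rconv (fun y => - h y) f x = - rconv h f x.
Proof.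
move=> hh mf; rewrite /rconv -I2N; last exact: rconv_ig.
by congr I2; apply/funext => y; rewrite mulNr.
Qed.

Lemma rconv_K1 A B f x : nice A -> nice B -> moderate f ->
  rconv (K1 A B) f x = (2 * pi)^-1 * (rconv (tcos A) f x - rconv (tsin B) f x).
Proof.
move=> [_ h1 _] [_ _ h2] mf; rewrite /K1 rconvZl//; last first.
  by apply: rapidD => //; exact: rapidN.
by rewrite rconvDl//; [rewrite rconvNl|exact: rapidN].
Qed.

Lemma rconv_K2 A B f x : nice A -> nice B -> moderate f ->
  rconv (K2 A B) f x = (2 * pi)^-1 * (rconv (tcos B) f x + rconv (tsin A) f x).
Proof.
move=> [_ _ h1] [_ h2 _] mf; rewrite /K2 rconvZl//; last exact: rapidD.
by rewrite rconvDl.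
Qed.

Lemma rapid_mul_bounded A g M : rapid A -> continuous g -> (forall x, `|g x| <= M) ->
  rapid (fun x => A x * g x).
Proof.
move=> hA cg gM; rewrite (_ : (fun x => _) = (fun x => g x * A x)).
  exact: rapid_bounded hA (meas_continuous cg) gM.
by apply/funext => x; rewrite mulrC.
Qed.

Lemma rapid_mul_tcos A p : rapid A -> rapid p -> rapid (fun x => A x * tcos p x).
Proof. by move=> hA hp; exact: rapid_mul_bounded hA (continuous_tcos hp) (fun x => tcos_bound x hp). Qed.

Lemma rapid_mul_tsin A p : rapid A -> rapid p -> rapid (fun x => A x * tsin p x).
Proof. by move=> hA hp; exact: rapid_mul_bounded hA (continuous_tsin hp) (fun x => tsin_bound x hp). Qed.

Lemma tcosB f g x : rapid f -> rapid g ->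
  tcos (fun xi => f xi - g xi) x = tcos f x - tcos g x.
Proof.
move=> hf hg; rewrite /tcos -I2B; [|exact: rapid_ig (rapid_cos x hf)|exact: rapid_ig (rapid_cos x hg)].
by congr I2; apply/funext => y; ring.
Qed.

Lemma tsinB f g x : rapid f -> rapid g ->
  tsin (fun xi => f xi - g xi) x = tsin f x - tsin g x.
Proof.
move=> hf hg; rewrite /tsin -I2B; [|exact: rapid_ig (rapid_sin x hf)|exact: rapid_ig (rapid_sin x hg)].
by congr I2; apply/funext => y; ring.
Qed.

(** The convolution theorem in real coordinates: the kernel of symbol A + i B convolved with p + i q
    has the product symbol, and the unitary normalisation leaves a factor 2 pi. *)
Lemma kernel_conv A B p q x : nice A -> nice B -> rapid p -> rapid q ->
  rconv (K1 A B) p x - rconv (K2 A B) q x =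
    2 * pi * K1 (fun xi => A xi * fre p q xi - B xi * fim p q xi)
                (fun xi => A xi * fim p q xi + B xi * fre p q xi) x /\
  rconv (K1 A B) q x + rconv (K2 A B) p x =
    2 * pi * K2 (fun xi => A xi * fre p q xi - B xi * fim p q xi)
                (fun xi => A xi * fim p q xi + B xi * fre p q xi) x.
Proof.
move=> nA nB hp hq; have mp := rapid_is_moderate hp; have mq := rapid_is_moderate hq.
have pi0 : (pi : R) != 0 by rewrite gt_eqF ?pi_gt0.
have [hA _ _] := nA; have [hB _ _] := nB.
rewrite !rconv_K1// !rconv_K2// !rconv_tcos// !rconv_tsin// /K1 /K2 /fre /fim.
set c := (2 * pi)^-1.
have a1 := rapid_mul_tcos hA hp; have a2 := rapid_mul_tsin hA hp.
have a3 := rapid_mul_tcos hA hq; have a4 := rapid_mul_tsin hA hq.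
have b1 := rapid_mul_tcos hB hp; have b2 := rapid_mul_tsin hB hp.
have b3 := rapid_mul_tcos hB hq; have b4 := rapid_mul_tsin hB hq.
have E1 : (fun xi => A xi * (c * (tcos p xi + tsin q xi)) - B xi * (c * (tcos q xi - tsin p xi)))
  = (fun xi => c * ((A xi * tcos p xi + A xi * tsin q xi) - (B xi * tcos q xi - B xi * tsin p xi))).
  by apply/funext => xi; ring.
have E2 : (fun xi => A xi * (c * (tcos q xi - tsin p xi)) + B xi * (c * (tcos p xi + tsin q xi)))
  = (fun xi => c * ((A xi * tcos q xi - A xi * tsin p xi) + (B xi * tcos p xi + B xi * tsin q xi))).
  by apply/funext => xi; ring.
rewrite E1 E2.
have r1 := rapidD a1 a4; have r2 := rapidD b3 (rapidN b2); have r3 := rapidD a3 (rapidN a2).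
have r4 := rapidD b1 b4.
have s1 := rapidD r1 (rapidN r2); have s2 := rapidD r3 r4.
rewrite (tcosZ _ _ s1) (tcosZ _ _ s2) (tsinZ _ _ s1) (tsinZ _ _ s2).
rewrite (tcosB _ r1 r2) (tsinB _ r1 r2) (tcosD _ r3 r4) (tsinD _ r3 r4).
rewrite (tcosD _ a1 a4) (tsinD _ a1 a4) (tcosB _ b3 b2) (tsinB _ b3 b2).
rewrite (tcosB _ a3 a2) (tsinB _ a3 a2) (tcosD _ b1 b4) (tsinD _ b1 b4).
have hc : 2 * pi * c = 1 by rewrite /c mulfV// mulf_neq0// pnatr_eq0.
(* Linearity has been used up: each remaining transform is an opaque real and the identity is
   polynomial. *)
repeat match goal with |- context [@tcos _ ?f x] => generalize (tcos f x); intro end.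
repeat match goal with |- context [@tsin _ ?f x] => generalize (tsin f x); intro end.
by split; rewrite [RHS]mulrA hc mul1r; ring.
Qed.

(** Differentiation multiplies the symbol by i times a coordinate, and the factor i exchanges the
    two kernels up to sign. *)
Lemma is_derive_K1 i A B x : rapid A -> rapid B ->
  is_derive x (basis2 R i) (K1 A B) (- K2 (fun xi => crd i xi * A xi) (fun xi => crd i xi * B xi) x).
Proof.
move=> hA hB; have d1 := is_derive_tcos i x hA; have d2 := is_derive_tsin i x hB.
have := is_derive_mulr (2 * pi)^-1 (is_deriveB d1 d2).
rewrite (_ : (fun y => _) = K1 A B); last by apply/funext => y; rewrite /K1 mulrC.
by move=> h; apply: (is_derive_eq h); rewrite /K2; ring.
Qed.

Lemma is_derive_K2 i A B x : rapid A -> rapid B ->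
  is_derive x (basis2 R i) (K2 A B) (K1 (fun xi => crd i xi * A xi) (fun xi => crd i xi * B xi) x).
Proof.
move=> hA hB; have d1 := is_derive_tcos i x hB; have d2 := is_derive_tsin i x hA.
have := is_derive_mulr (2 * pi)^-1 (is_deriveD d1 d2).
rewrite (_ : (fun y => _) = K2 A B); last by apply/funext => y; rewrite /K2 mulrC.
by move=> h; apply: (is_derive_eq h); rewrite /K1; ring.
Qed.

Lemma I2_scale (l : R) f : 0 < l -> ig f -> I2 (fun x => f (l *: x)) = (l ^+ 2)^-1 * I2 f.
Proof.
move=> l0 hf; rewrite -(I2_affine 0 (lt0r_neq0 l0) hf); congr I2.
by apply/funext => x /=; rewrite affine2_0.
Qed.

Lemma tcos_scale (l : R) f x : 0 < l -> rapid f ->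
  tcos (fun xi => f (l^-1 *: xi)) x = l ^+ 2 * tcos f (l *: x).
Proof.
move=> l0 hf; have l1 : 0 < l^-1 by rewrite invr_gt0.
have := I2_scale l1 (rapid_ig (rapid_cos (l *: x) hf)).
rewrite exprVn invrK => <-; congr I2; apply/funext => xi; congr (cos _ * _).
by rewrite /dot /= /GRing.scale/=; field; rewrite gt_eqF.
Qed.

Lemma tsin_scale (l : R) f x : 0 < l -> rapid f ->
  tsin (fun xi => f (l^-1 *: xi)) x = l ^+ 2 * tsin f (l *: x).
Proof.
move=> l0 hf; have l1 : 0 < l^-1 by rewrite invr_gt0.
have := I2_scale l1 (rapid_ig (rapid_sin (l *: x) hf)).
rewrite exprVn invrK => <-; congr I2; apply/funext => xi; congr (sin _ * _).
by rewrite /dot /= /GRing.scale/=; field; rewrite gt_eqF.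
Qed.

Definition L1 f : R := I2 (fun x => `|f x|).

Lemma L1_ge0 f : 0 <= L1 f. Proof. by apply: I2_ge0. Qed.

Lemma L1_scale (c l : R) f g : 0 < l -> rapid f -> (forall x, g x = c * l ^+ 2 * f (l *: x)) ->
  0 <= c -> L1 g = c * L1 f.
Proof.
move=> l0 hf E c0.
have hs := I2_scale l0 (ig_abs (rapid_ig hf)).
rewrite /L1 (_ : (fun x => `|g x|) = (fun x => c * l ^+ 2 * `|f (l *: x)|)).
  rewrite I2Z; first by rewrite hs; field; rewrite gt_eqF.
  rewrite (_ : (fun x => _) = (fun x => `|f x|) \o affine2 l 0).
    by apply: ig_affine (lt0r_neq0 l0) _; exact/ig_abs/rapid_ig.
  by apply/funext => x /=; rewrite affine2_0.
by apply/funext => x; rewrite E normrM ger0_norm// mulr_ge0// sqr_ge0.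
Qed.

End kernels.

Section convolution_regularity.
Variable R : realType.
Implicit Types (f g h : plane R -> R) (x y z : plane R) (i : 'I_2).

Lemma rapid_lip h (dh : 'I_2 -> plane R -> R) n : (forall i, rapid (dh i)) ->
  (forall i x, is_derive x (basis2 R i) h (dh i x)) ->
  exists2 C, 0 <= C & forall x (d : plane R), `|d.1| <= 1 -> `|d.2| <= 1 ->
    `|h (x + d) - h x| <= C * (`|d.1| + `|d.2|) * weight x ^+ n.
Proof.
move=> rdh hd.
have [Ka ha] := (rdh 0).2 n; have [Kb hb] := (rdh 1).2 n.
have Ka0 := rapid_ge0 ha; have Kb0 := rapid_ge0 hb.
(* The path follows one axis, then the other. Each leg has length at most 1 and costs 8^n through
   [weight_shift], so the second leg, seen from x, costs 64^n. *)
exists (Ka * 8 ^+ n + Kb * 64 ^+ n); first by rewrite addr_ge0// mulr_ge0// exprn_ge0.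
move=> x d d1 d2; pose z := x + d.1 *: basis2 R 0.
have E : x + d = z + d.2 *: basis2 R 1.
  rewrite /z /basis2 /= /GRing.scale/=; case: x d {d1 d2 z} => x1 x2 [y1 y2] /=.
  by congr (_, _) => /=; rewrite /GRing.scale/=; ring.
have w8 y k (t : R) : `|t| <= 1 -> weight (y + t *: basis2 R k) ^+ n <= 8 ^+ n * weight y ^+ n.
  move=> t1; rewrite -exprMn lerXn2r ?nnegrE ?weight_ge0 ?weight_shift//.
  exact: mulr_ge0 (ler0n R 8) (weight_ge0 _).
have A1 : `|h z - h x| <= Ka * (8 ^+ n * weight x ^+ n) * `|d.1|.
  apply: (line_mvt (hd 0)) => t td; apply: (le_trans (ha _)).
  by rewrite ler_wpM2l// w8// (le_trans td).
have A2 : `|h (x + d) - h z| <= Kb * (8 ^+ n * (8 ^+ n * weight x ^+ n)) * `|d.2|.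
  rewrite E; apply: (line_mvt (hd 1)) => t td; apply: (le_trans (hb _)).
  rewrite ler_wpM2l// (le_trans (w8 _ _ _ _)) ?(le_trans td)//.
  by rewrite ler_wpM2l ?exprn_ge0// w8.
rewrite -(subrKA (h z)) (le_trans (ler_normD _ _))// (le_trans (lerD A2 A1))//.
have -> : 8 ^+ n * (8 ^+ n * weight x ^+ n) = 64 ^+ n * weight x ^+ n :> R.
  by rewrite mulrA -exprMn -natrM.
have w0 : 0 <= weight x ^+ n by rewrite exprn_ge0 ?weight_ge0.
have p1 : 0 <= Ka * 8 ^+ n * weight x ^+ n by rewrite !mulr_ge0// exprn_ge0.
have p2 : 0 <= Kb * 64 ^+ n * weight x ^+ n by rewrite !mulr_ge0// exprn_ge0.
have q1 := mulr_ge0 p1 (normr_ge0 d.2); have q2 := mulr_ge0 p2 (normr_ge0 d.1).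
rewrite -subr_ge0; rewrite (_ : _ - _ = Ka * 8 ^+ n * weight x ^+ n * `|d.2| + Kb * 64 ^+ n * weight x ^+ n * `|d.1|); last by ring.
exact: addr_ge0.
Qed.

Lemma continuous_rconv h dh f : rapid h -> (forall i, rapid (dh i)) ->
  (forall i x, is_derive x (basis2 R i) h (dh i x)) -> moderate f ->
  continuous (rconv h f).
Proof.
move=> hh rdh hd mf x.
(* Exponent 2: one power of the weight absorbs the growth of [f], the other makes the majorant
   integrable. *)
have [C C0 hC] := rapid_lip 2 rdh hd; have [mf1 [Kf hKf]] := mf.
pose D := C * (4 / weight x) ^+ 2 * Kf * I2 (@weight R).
have H (d : plane R) : `|d.1| <= 1 -> `|d.2| <= 1 ->
    `|rconv h f (x + d) - rconv h f x| <= (`|d.1| + `|d.2|) * D.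
  move=> d1 d2; rewrite /rconv -I2B; [|exact: rconv_ig|exact: rconv_ig].
  rewrite /D mulrA -I2Z; last exact: ig_weight.
  apply: I2_bound.
  - by apply: measB; apply: ig_meas; exact: rconv_ig.
  - exact: igZ (@ig_weight R).
  move=> y; rewrite -mulrBl normrM.
  have -> : x + d - y = (x - y) + d by rewrite addrAC.
  apply: (@le_trans _ _ (C * (`|d.1| + `|d.2|) * weight (x - y) ^+ 2 * (Kf / weight y))).
    by apply: ler_pM => //; exact: hC.
  have wy := weight_gt0 y; have wx := weight_gt0 x.
  have Kf0 : 0 <= Kf.
    have w0 : 0 < (weight y)^-1 by rewrite invr_gt0.
    by rewrite -(pmulr_lge0 _ w0); exact: le_trans (hKf y).
  rewrite (_ : (`|d.1| + `|d.2|) * _ * _ = C * (`|d.1| + `|d.2|) * (4 * weight y / weight x) ^+ 2 * (Kf / weight y)); last first.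
    by field; rewrite !gt_eqF.
  apply: ler_wpM2r; first by rewrite divr_ge0 ?(ltW wy).
  apply: ler_wpM2l; first by rewrite mulr_ge0 ?addr_ge0.
  rewrite lerXn2r ?nnegrE ?weight_ge0 ?weight_sub//.
  exact: divr_ge0 (mulr_ge0 (ler0n R 4) (ltW wy)) (ltW wx).
have c : (fun y : plane R => (`|(y - x).1| + `|(y - x).2|) * D) @ x --> (`|(x - x).1| + `|(x - x).2|) * D.
  apply: cvgM; last exact: cvg_cst.
  apply: cvgD; apply: cvg_norm; apply: cvgB; try exact: cvg_cst.
    exact: cvg_fst.
  exact: cvg_snd.
rewrite subrr /= normr0 addr0 mul0r in c.
have n1 : \forall y \near x, `|(y - x).1| <= 1.
  have c1 : (fun y : plane R => `|(y - x).1|) @ x --> `|(x - x).1|.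
    by apply: cvg_norm; apply: cvgB; [exact: cvg_fst|exact: cvg_cst].
  rewrite subrr normr0 in c1.
  by apply: (cvgr_le (0 : R) c1).
have n2 : \forall y \near x, `|(y - x).2| <= 1.
  have c1 : (fun y : plane R => `|(y - x).2|) @ x --> `|(x - x).2|.
    by apply: cvg_norm; apply: cvgB; [exact: cvg_snd|exact: cvg_cst].
  rewrite subrr normr0 in c1.
  by apply: (cvgr_le (0 : R) c1).
apply/cvgrPdist_le => e e0; move/cvgrPdist_le : c => /(_ _ e0) c.
near=> y.
have -> : y = x + (y - x) by rewrite addrC subrK.
rewrite distrC; apply: le_trans (H _ _ _) _; [by near: y|by near: y|].
apply: le_trans (ler_norm _) _; rewrite -normrN -sub0r; near: y; exact: c.
Unshelve. all: by end_near. Qed.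

End convolution_regularity.

Section convolution_by_parts.
Variable R : realType.
Implicit Types (f g h p : plane R -> R) (x y z : plane R) (i : 'I_2).

Lemma rapid_rconv h p : rapid h -> rapid p -> meas (rconv h p) -> rapid (rconv h p).
Proof.
move=> hh hp mc; split=> // n.
(* Moving the decay of [h] from x - y to x costs weight(y)^-n; [p] pays for it and keeps one power
   to integrate. *)
have [Kh hKh] := hh.2 n; have [Kp hKp] := hp.2 n.+1.
have Kh0 := rapid_ge0 hKh; have Kp0 := rapid_ge0 hKp.
exists (Kh * Kp * 4 ^+ n * I2 (@weight R)) => x.
rewrite mulrAC -I2Z; last exact: ig_weight.
apply: I2_bound; [|exact: igZ (@ig_weight R)|].
  by apply: ig_meas; apply: rconv_ig => //; exact: rapid_is_moderate.
move=> y; have wy := weight_gt0 y; have wx := weight_gt0 x; rewrite normrM.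
have E (v w : R) : 0 < v -> Kh * Kp * 4 ^+ n * w ^+ n * v = Kh * (4 * w / v) ^+ n * (Kp * v ^+ n.+1).
  move=> v0; have : v ^+ n != 0 by rewrite expf_neq0// gt_eqF.
  rewrite !exprMn exprVn exprS; move: (v ^+ n) (w ^+ n) (4 ^+ n) => a b c a0.
  by field.
rewrite (E _ _ wy).
apply: ler_pM => //; apply: (le_trans (hKh _)); apply: ler_wpM2l => //.
rewrite lerXn2r ?nnegrE ?weight_ge0//.
  exact: divr_ge0 (mulr_ge0 (ler0n R 4) (ltW wx)) (ltW wy).
by rewrite -(weightN y); exact: weight_add.
Qed.

Lemma is_derive_reflect i h (d : R) x y : is_derive (x - y) (basis2 R i) h d ->
  is_derive y (basis2 R i) (fun y => h (x - y)) (- d).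
Proof.
move=> hd; apply: is_derive_of_line.
pose g (t : R) := h ((x - y) + t *: basis2 R i).
rewrite (_ : (fun t : R => _) = g \o -%R); last first.
  by apply/funext => t /=; rewrite /g scaleNr opprD addrA.
have gd : is_derive (- 0 : R) 1 g d.
  by rewrite oppr0; apply: is_derive_line; rewrite scale0r addr0.
have nd : is_derive (0 : R) 1 (-%R : R -> R) (- 1) by apply: is_deriveNid.
by apply: (is_derive_eq (is_derive1_comp gd nd)); rewrite mulrN1.
Qed.

(** The y-derivative of h(x - y) f(y) integrates to zero; the reflection contributes a second sign,
    so the derivative moves across without one. *)
Lemma rconv_partial i h dh f df x : rapid h -> rapid dh ->
  (forall y, is_derive y (basis2 R i) h (dh y)) ->
  moderate f -> moderate df ->
  (forall y, is_derive y (basis2 R i) f (df y)) ->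
  rconv h df x = rconv dh f x.
Proof.
move=> hh hdh hd mf mdf fd.
have P g k : rapid g -> moderate k -> rapid (fun y => g (x - y) * k y).
  move=> hg [mk [K hK]]; rewrite (_ : (fun y => _) = (fun y => k y * g (x - y))).
    exact: rapid_moderate (rapid_reflect x hg) mk hK.
  by apply/funext => y; rewrite mulrC.
have r1 := P _ _ hh mf; have r2 := P _ _ hh mdf; have r3 := P _ _ hdh mf.
have r4 := rapidD r2 (rapidN r3).
have [Ka ha] := r1.2 1%N; have [Kb hb] := r4.2 1%N.
have H : I2 (fun y => h (x - y) * df y - dh (x - y) * f y) = 0.
  apply: (@I2_partial0 _ i (fun y => h (x - y) * f y) _ (Num.max Ka Kb)).
  - exact: r1.1.
  - move=> y; apply: (is_derive_eq (is_deriveM (is_derive_reflect (hd (x - y))) (fd y))).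
    by rewrite /GRing.scale/=; ring.
  - move=> y; have := ha y; rewrite expr1 => /le_trans; apply.
    by rewrite ler_wpM2r ?weight_ge0 ?le_max ?lexx.
  - move=> y; have := hb y; rewrite expr1 => /le_trans; apply.
    by rewrite ler_wpM2r ?weight_ge0 ?le_max ?lexx ?orbT.
apply/eqP; rewrite -subr_eq0 -H /rconv I2B//; exact: rapid_ig.
Qed.

End convolution_by_parts.

Section reproduction.
Variables (R : realType) (phi : int -> plane R -> R[i]).
Hypothesis hphi : littlewood_paley phi.
Implicit Types (x y xi : plane R) (i : 'I_2) (j k : int) (mu f : plane R -> R).
Local Notation p := (lpr phi).
Local Notation q := (lpi phi).
Local Notation a := (lpa phi).
Local Notation b := (lpb phi).

Definition symbol mu := forall n i, cdiff n i mu.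

(** [kr] and [ki] are the real and imaginary parts of the kernel of the multiplier [mu] cut off to
    block j. The cutoff keeps away from the origin, so a homogeneous symbol singular there gives a
    rapid kernel. *)
Definition kr mu j : plane R -> R := K1 (fun xi => mu xi * a j xi) (fun xi => mu xi * b j xi).
Definition ki mu j : plane R -> R := K2 (fun xi => mu xi * a j xi) (fun xi => mu xi * b j xi).

Lemma symbol_crd i mu : symbol mu -> symbol (fun xi => crd i xi * mu xi).
Proof. by move=> smu n k; apply: cdiffM => //; exact: cdiff_crd. Qed.

Lemma nice_lp mu j : symbol mu -> nice (fun xi => mu xi * a j xi) /\ nice (fun xi => mu xi * b j xi).
Proof.
by move=> smu; split; apply: nice_smooth => n i; have [] := rapid_smooth_lp hphi j (smu n i).
Qed.

Lemma rapid_kr mu j : symbol mu -> rapid (kr mu j).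
Proof. by move=> /(nice_lp j)[h1 h2]; exact: rapid_K1. Qed.

Lemma rapid_ki mu j : symbol mu -> rapid (ki mu j).
Proof. by move=> /(nice_lp j)[h1 h2]; exact: rapid_K2. Qed.

Lemma is_derive_kr mu j i x : symbol mu ->
  is_derive x (basis2 R i) (kr mu j) (- ki (fun xi => crd i xi * mu xi) j x).
Proof.
move=> /(nice_lp j)[[h1 _ _] [h2 _ _]]; apply: (is_derive_eq (is_derive_K1 i x h1 h2)).
have E (c : plane R -> R) : (fun xi => crd i xi * (mu xi * c xi)) = (fun xi => crd i xi * mu xi * c xi).
  by apply/funext => xi; rewrite mulrA.
by rewrite (E (a j)) (E (b j)).
Qed.

Lemma is_derive_ki mu j i x : symbol mu ->
  is_derive x (basis2 R i) (ki mu j) (kr (fun xi => crd i xi * mu xi) j x).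
Proof.
move=> /(nice_lp j)[[h1 _ _] [h2 _ _]]; apply: (is_derive_eq (is_derive_K2 i x h1 h2)).
have E (c : plane R -> R) : (fun xi => crd i xi * (mu xi * c xi)) = (fun xi => crd i xi * mu xi * c xi).
  by apply/funext => xi; rewrite mulrA.
by rewrite (E (a j)) (E (b j)).
Qed.

Lemma continuous_rconv_kr mu j f : symbol mu -> moderate f -> continuous (rconv (kr mu j) f).
Proof.
move=> smu mf; apply: (@continuous_rconv _ _ (fun i x => - ki (fun xi => crd i xi * mu xi) j x)) => //.
- exact: rapid_kr.
- by move=> i; apply: rapidN; apply: rapid_ki; exact: symbol_crd.
- by move=> i x; exact: is_derive_kr.
Qed.

Lemma continuous_rconv_ki mu j f : symbol mu -> moderate f -> continuous (rconv (ki mu j) f).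
Proof.
move=> smu mf; apply: (@continuous_rconv _ _ (fun i x => kr (fun xi => crd i xi * mu xi) j x)) => //.
- exact: rapid_ki.
- by move=> i; apply: rapid_kr; exact: symbol_crd.
- by move=> i x; exact: is_derive_ki.
Qed.

Lemma continuous_rconv_schwartz h f : schwartzR h -> moderate f -> continuous (rconv h f).
Proof.
move=> sh mf; apply: (@continuous_rconv _ _ (fun i => partial i h)) => //.
- exact: schwartzR_rapid.
- by move=> i; apply: schwartzR_rapid; exact: schwartzR_partial.
- by move=> i x; exact: schwartzR_is_derive.
Qed.

Lemma tcos_sum n (F : nat -> plane R -> R) x : (forall m, rapid (F m)) ->
  tcos (fun xi => \sum_(m < n) F m xi) x = \sum_(m < n) tcos (F m) x /\
  tsin (fun xi => \sum_(m < n) F m xi) x = \sum_(m < n) tsin (F m) x /\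
  rapid (fun xi => \sum_(m < n) F m xi).
Proof.
move=> hF; elim: n => [|n [IH1 [IH2 IH3]]].
  rewrite !big_ord0 (_ : (fun xi => _) = (fun xi => 0 * F 0%N xi)); last first.
    by apply/funext => xi; rewrite big_ord0 mul0r.
  by rewrite tcosZ// tsinZ// !mul0r; split => //; split=> //; exact: rapidZ.
rewrite !big_ord_recr /= -IH1 -IH2 (_ : (fun xi => _) = (fun xi => \sum_(m < n) F m xi + F n xi)); last first.
  by apply/funext => xi; rewrite big_ord_recr.
by rewrite tcosD// tsinD//; split => //; split=> //; exact: rapidD.
Qed.

Lemma rconv_sum n (U : nat -> plane R -> R) f x : (forall m, rapid (U m)) -> moderate f ->
  rconv (fun y => \sum_(m < n) U m y) f x = \sum_(m < n) rconv (U m) f x.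
Proof.
move=> hU mf; suff [-> //] : rconv (fun y => \sum_(m < n) U m y) f x = \sum_(m < n) rconv (U m) f x /\
    rapid (fun y => \sum_(m < n) U m y).
elim: n => [|n [IH1 IH2]].
  rewrite !big_ord0 (_ : (fun xi => _) = (fun xi => 0 * U 0%N xi)); last first.
    by apply/funext => xi; rewrite big_ord0 mul0r.
  by rewrite rconvZl// mul0r; split=> //; exact: rapidZ.
rewrite !big_ord_recr /= -IH1 (_ : (fun xi => _) = (fun xi => \sum_(m < n) U m xi + U n xi)); last first.
  by apply/funext => xi; rewrite big_ord_recr.
by rewrite rconvDl//; split=> //; exact: rapidD.
Qed.

Lemma continuous_lp j : continuous (a j) /\ continuous (b j).
Proof.
have p1 := rapid_lpr hphi j; have q1 := rapid_lpi hphi j.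
split=> x; (apply: cvgM; first exact: cvg_cst).
  by apply: cvgD; [exact: (continuous_tcos p1)|exact: (continuous_tsin q1)].
by apply: cvgB; [exact: (continuous_tcos q1)|exact: (continuous_tsin p1)].
Qed.

Lemma symbol1 : symbol (fun=> 1).
Proof. by move=> n i; exact: cdiff_cst. Qed.

Lemma rapid_lp j : rapid (a j) /\ rapid (b j).
Proof.
have [[h1 _ _] [h2 _ _]] := nice_lp j symbol1.
have E (c : plane R -> R) : (fun xi => 1 * c xi) = c by apply/funext => x; rewrite mul1r.
by split; [rewrite -(E (a j))|rewrite -(E (b j))].
Qed.

Lemma kernel_reproduction mu j x : symbol mu ->
  \sum_(m < 5) (rconv (kr mu j) (p (j - 2 + m%:Z)) x - rconv (ki mu j) (q (j - 2 + m%:Z)) x)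
    = 2 * pi * kr mu j x /\
  \sum_(m < 5) (rconv (kr mu j) (q (j - 2 + m%:Z)) x + rconv (ki mu j) (p (j - 2 + m%:Z)) x)
    = 2 * pi * ki mu j x.
Proof.
move=> smu; have [nA nB] := nice_lp j smu; have [hA _ _] := nA; have [hB _ _] := nB.
pose F (m : nat) xi := mu xi * a j xi * a (j - 2 + m%:Z) xi - mu xi * b j xi * b (j - 2 + m%:Z) xi.
pose G (m : nat) xi := mu xi * a j xi * b (j - 2 + m%:Z) xi + mu xi * b j xi * a (j - 2 + m%:Z) xi.
have rM A k : rapid A -> rapid (fun xi => A xi * a k xi) /\ rapid (fun xi => A xi * b k xi).
  move=> rA; have [ca cb] := continuous_lp k; have [[_ /(_ 0%N)[M1 h1]] [_ /(_ 0%N)[M2 h2]]] := rapid_lp k.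
  by split; [apply: (rapid_mul_bounded (M := M1) rA ca)|apply: (rapid_mul_bounded (M := M2) rA cb)] => y;
    [have := h1 y|have := h2 y]; rewrite expr0 mulr1.
have rF m : rapid (F m).
  have [h1 _] := rM _ (j - 2 + m%:Z) hA; have [_ h2] := rM _ (j - 2 + m%:Z) hB.
  by apply: rapidD => //; exact: rapidN.
have rG m : rapid (G m).
  have [_ h1] := rM _ (j - 2 + m%:Z) hA; have [h2 _] := rM _ (j - 2 + m%:Z) hB.
  exact: rapidD.
have SF : (fun xi => \sum_(m < 5) F m xi) = (fun xi => mu xi * a j xi).
  apply/funext => xi; have [E _] := lp_partition hphi j xi.
  rewrite -[in RHS]E mulr_sumr; apply: eq_bigr => m _; rewrite /F; ring.
have SG : (fun xi => \sum_(m < 5) G m xi) = (fun xi => mu xi * b j xi).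
  apply/funext => xi; have [_ E] := lp_partition hphi j xi.
  rewrite -[in RHS]E mulr_sumr; apply: eq_bigr => m _; rewrite /G; ring.
have [tF [sF _]] := tcos_sum 5 x rF; have [tG [sG _]] := tcos_sum 5 x rG.
split.
  rewrite (eq_bigr (fun m : 'I_5 => 2 * pi * ((2 * pi)^-1 * (tcos (F m) x - tsin (G m) x)))); last first.
    by move=> m _; have [-> _] := kernel_conv x nA nB (rapid_lpr hphi (j - 2 + m%:Z)) (rapid_lpi hphi (j - 2 + m%:Z)).
  by rewrite -!mulr_sumr sumrB -tF -sG SF SG.
rewrite (eq_bigr (fun m : 'I_5 => 2 * pi * ((2 * pi)^-1 * (tcos (G m) x + tsin (F m) x)))); last first.
  by move=> m _; have [_ ->] := kernel_conv x nA nB (rapid_lpr hphi (j - 2 + m%:Z)) (rapid_lpi hphi (j - 2 + m%:Z)).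
by rewrite -!mulr_sumr big_split /= -tG -sF SF SG.
Qed.

(* The five neighbouring blocks sum to 1, on the Fourier side, on the support of block j. *)
Lemma reproduction mu j f x : symbol mu -> moderate f ->
  2 * pi * rconv (kr mu j) f x = \sum_(m < 5) (rconv (kr mu j) (rconv (p (j - 2 + m%:Z)) f) x
     - rconv (ki mu j) (rconv (q (j - 2 + m%:Z)) f) x) /\
  2 * pi * rconv (ki mu j) f x = \sum_(m < 5) (rconv (kr mu j) (rconv (q (j - 2 + m%:Z)) f) x
     + rconv (ki mu j) (rconv (p (j - 2 + m%:Z)) f) x).
Proof.
move=> smu mf; have r1 := rapid_kr j smu; have r2 := rapid_ki j smu.
have hp k := rapid_lpr hphi k; have hq k := rapid_lpi hphi k.
have mp k := rapid_is_moderate (hp k); have mq k := rapid_is_moderate (hq k).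
have c1 h : rapid h -> rapid (rconv (kr mu j) h).
  move=> hh; apply: rapid_rconv => //; apply: meas_continuous; apply: continuous_rconv_kr => //.
  exact: rapid_is_moderate.
have c2 h : rapid h -> rapid (rconv (ki mu j) h).
  move=> hh; apply: rapid_rconv => //; apply: meas_continuous; apply: continuous_rconv_ki => //.
  exact: rapid_is_moderate.
split.
  rewrite -rconvZl// (_ : (fun y => _) = fun y => \sum_(m < 5)
    (fun (m : nat) y => rconv (kr mu j) (p (j - 2 + m%:Z)) y - rconv (ki mu j) (q (j - 2 + m%:Z)) y) m y); last first.
    by apply/funext => y; have [-> _] := kernel_reproduction j y smu.
  rewrite (rconv_sum 5 (U := fun (m : nat) y => rconv (kr mu j) (p (j - 2 + m%:Z)) y - rconv (ki mu j) (q (j - 2 + m%:Z)) y))//; last first.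
    by move=> m; apply: rapidD; [exact: c1|apply: rapidN; exact: c2].
  apply: eq_bigr => m _; rewrite rconvDl//; [|exact: c1|by apply: rapidN; exact: c2].
  by rewrite rconvNl ?rconv_assoc//; exact: c2.
rewrite -rconvZl// (_ : (fun y => _) = fun y => \sum_(m < 5)
    (fun (m : nat) y => rconv (kr mu j) (q (j - 2 + m%:Z)) y + rconv (ki mu j) (p (j - 2 + m%:Z)) y) m y); last first.
  by apply/funext => y; have [_ ->] := kernel_reproduction j y smu.
rewrite (rconv_sum 5 (U := fun (m : nat) y => rconv (kr mu j) (q (j - 2 + m%:Z)) y + rconv (ki mu j) (p (j - 2 + m%:Z)) y))//; last first.
  by move=> m; apply: rapidD; [exact: c1|exact: c2].
apply: eq_bigr => m _; rewrite rconvDl//; [|exact: c1|exact: c2].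
by rewrite !rconv_assoc.
Qed.

(** After reproduction, Young's inequality meets blocks of [f] instead of [f], which may be
    unbounded. *)
Lemma kernel_bound mu j f x (N : int -> R) : symbol mu -> moderate f ->
  (forall k y, `|rconv (p k) f y| <= N k) -> (forall k y, `|rconv (q k) f y| <= N k) ->
  `|rconv (kr mu j) f x| <= (L1 (kr mu j) + L1 (ki mu j)) * \sum_(m < 5) N (j - 2 + m%:Z) /\
  `|rconv (ki mu j) f x| <= (L1 (kr mu j) + L1 (ki mu j)) * \sum_(m < 5) N (j - 2 + m%:Z).
Proof.
move=> smu mf hN1 hN2; have r1 := rapid_kr j smu; have r2 := rapid_ki j smu.
have m1 k : meas (rconv (p k) f).
  by apply: meas_continuous; apply: continuous_rconv_schwartz => //; exact: schwartz_lpr.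
have m2 k : meas (rconv (q k) f).
  by apply: meas_continuous; apply: continuous_rconv_schwartz => //; exact: schwartz_lpi.
have pi2 : 1 <= 2 * pi :> R by have := @pi_ge2 R; lra.
have red (t s : R) : 2 * pi * t = s -> `|t| <= `|s|.
  move=> <-; rewrite normrM ler_peMl// ger0_norm// (le_trans _ pi2)//.
have [E1 E2] := reproduction j x smu mf.
split.
  apply: (le_trans (red _ _ E1)); apply: (le_trans (ler_norm_sum _ _ _)).
  rewrite mulr_sumr; apply: ler_sum => m _; rewrite (le_trans (ler_normB _ _))// mulrDl.
  by apply: lerD; rewrite mulrC; apply: rconv_bound.
apply: (le_trans (red _ _ E2)); apply: (le_trans (ler_norm_sum _ _ _)).
rewrite mulr_sumr; apply: ler_sum => m _; rewrite (le_trans (ler_normD _ _))// mulrDl.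
by apply: lerD; rewrite mulrC; apply: rconv_bound.
Qed.

Lemma lp_inversion j x : p j x = K1 (a j) (b j) x /\ q j x = K2 (a j) (b j) x.
Proof.
have hp := rapid_lpr hphi j; have hq := rapid_lpi hphi j; have [ra rb] := rapid_lp j.
have cp := schwartzR_continuous (schwartz_lpr hphi j); have cq := schwartzR_continuous (schwartz_lpi hphi j).
have pi0 : (2 * pi : R) != 0 by rewrite mulf_neq0 ?pnatr_eq0// gt_eqF ?pi_gt0.
pose u xi := tcos (p j) xi + tsin (q j) xi; pose v xi := tcos (q j) xi - tsin (p j) xi.
have ru : rapid u.
  rewrite (_ : u = fun xi => 2 * pi * a j xi); first exact: rapidZ.
  by apply/funext => xi; rewrite /lpa /fre mulrA mulfV// mul1r.
have rv : rapid v.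
  rewrite (_ : v = fun xi => 2 * pi * b j xi); first exact: rapidZ.
  by apply/funext => xi; rewrite /lpb /fim mulrA mulfV// mul1r.
have I1 : tcos u x - tsin v x = (2 * pi) ^+ 2 * p j x by exact: inversion.
have F (t s : R) : t = (2 * pi) ^+ 2 * s -> s = (2 * pi)^-1 * ((2 * pi)^-1 * t).
  by move: (2 * pi) pi0 => z z0 ->; field.
rewrite /K1 /K2 -[a j]/(fun xi => (2 * pi)^-1 * u xi) -[b j]/(fun xi => (2 * pi)^-1 * v xi).
rewrite !tcosZ// !tsinZ// -mulrBr -mulrDr; split; first exact: F.
(* The imaginary part is the real part of q - i p = -i (p + i q), whose transform is v - i u. *)
have nq : rapid (fun xi => - p j xi) by exact: rapidN.
have N1 : (fun xi => - p j xi) = (fun xi => (-1) * p j xi) by apply/funext => xi; rewrite mulN1r.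
have En xi : tcos (fun xi => - p j xi) xi = - tcos (p j) xi by rewrite N1 tcosZ// mulN1r.
have Es xi : tsin (fun xi => - p j xi) xi = - tsin (p j) xi by rewrite N1 tsinZ// mulN1r.
have Ev : (fun xi => tcos (q j) xi + tsin (fun y => - p j y) xi) = v.
  by apply/funext => xi; rewrite Es.
have Eu : (fun xi => tcos (fun y => - p j y) xi - tsin (q j) xi) = (fun xi => (-1) * u xi).
  by apply/funext => xi; rewrite En /u; ring.
have := @inversion _ (q j) (fun xi => - p j xi) x hq cq nq.
rewrite Ev Eu => /(_ rv (rapidZ _ ru)); rewrite tsinZ// => I2'.
by apply: F; rewrite -I2'; ring.
Qed.

End reproduction.

(** * Essential suprema of continuous functions *)

Section essential_supremum.
Variable R : realType.
Local Notation P := (measurableTypeR R * measurableTypeR R)%type.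
Local Notation mu := (@lebesgue_measure R).

Lemma leb2_box_gt0 (a b c d : R) : a < b -> c < d ->
  (0 < leb2 (`]a, b[%classic `*` `]c, d[%classic))%E.
Proof.
move=> ab cd; have H : ((mu \x mu)%E (`]a, b[%classic `*` `]c, d[%classic) = ((b - a) * (d - c))%:E)%E.
  have E (u v : R) : u < v -> mu `]u, v[%classic = (v - u)%:E.
    by move=> uv; rewrite lebesgue_measure_itv/= lte_fin uv -EFinB.
  rewrite product_measure1E; [|exact: measurable_itv|exact: measurable_itv].
  by rewrite EFinM -(E _ _ ab) -(E _ _ cd).
by rewrite [X in (_ < X)%E]H lte_fin mulr_gt0// subr_gt0.
Qed.

Lemma leb2_open_gt0 (U : set (plane R)) x (A : set P) : open U -> U x -> U `<=` A ->
  measurable A -> (0 < leb2 A)%E.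
Proof.
move=> oU Ux UA mA.
have [/= e e0 he] := (@nbhs_ballP _ (plane R) x U).1 (open_nbhs_nbhs (conj oU Ux)).
have e1 t : t - e < t + e by rewrite ltrBlDr -addrA ltrDl addr_gt0.
apply: (lt_le_trans (leb2_box_gt0 (e1 x.1) (e1 x.2))).
apply: (@le_measure _ _ _ (mu \x mu)%E); rewrite ?inE//.
  by apply: measurableX; exact: measurable_itv.
move=> y [/=]; rewrite !in_itv/= => y1 y2; apply: UA; apply: he.
by split; rewrite /= /ball /= ltr_distlC.
Qed.

Lemma leb2_setT_gt0 : (0 < leb2 [set: P])%E.
Proof. by apply: (@leb2_open_gt0 setT 0) => //; exact: openT. Qed.

Lemma Linf_le (g : plane R -> R) (M : R) : (forall x, `|g x| <= M) ->
  ('N[leb2]_+oo [EFin \o g] <= M%:E)%E.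
Proof.
move=> gM; rewrite unlock /Lnorm leb2_setT_gt0.
apply/ess_supP; apply: nearW => x /=.
by rewrite lee_fin.
Qed.

(** Where |g| exceeds M the set is open, and a nonempty open set has positive measure. *)
Lemma Linf_ge (g : plane R -> R) (M : R) : continuous g ->
  ('N[leb2]_+oo [EFin \o g] <= M%:E)%E -> forall x, `|g x| <= M.
Proof.
move=> cg; rewrite unlock /Lnorm leb2_setT_gt0 => /ess_supP [A [mA A0 hA]] x.
rewrite leNgt; apply/negP => gx.
pose U := [set y : plane R | M < `|g y|].
have oU : open U.
  rewrite (_ : U = (fun y => `|g y|) @^-1` [set t | M < t]); last by [].
  apply: open_comp; last exact: open_gt.
  by move=> y _; apply: cvg_norm; exact: cg.
have UA : U `<=` A.
  by move=> y Uy; apply: hA => /=; rewrite lee_fin => /le_lt_trans/(_ Uy); rewrite ltxx.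
by have := leb2_open_gt0 oU gx UA mA; rewrite A0 ltxx.
Qed.

Lemma Linf_ge0 (g : plane R -> \bar R) : (0 <= 'N[leb2]_+oo [g])%E.
Proof. exact: Lnorm_ge0. Qed.

End essential_supremum.

Section lp_blocks.
Variables (R : realType) (phi : int -> plane R -> R[i]).
Hypothesis hphi : littlewood_paley phi.
Implicit Types (x y xi : plane R) (j k : int) (f : plane R -> R).
Local Notation p := (lpr phi).
Local Notation q := (lpi phi).

Definition lpG (I : finType) (F : I -> plane R -> R) j x : R :=
  Num.sqrt (\sum_(i : I) cmod (convolution (phi j) (F i) x) ^+ 2).

Definition lpN (I : finType) (F : I -> plane R -> R) j : \bar R :=
  'N[leb2]_+oo [EFin \o lpG F j].

Lemma cmod_convolution_sqr j f x :
  cmod (convolution (phi j) f x) ^+ 2 = rconv (p j) f x ^+ 2 + rconv (q j) f x ^+ 2.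
Proof. by rewrite convolutionE /cmod /= sqr_sqrtr// addr_ge0 ?sqr_ge0. Qed.

Lemma lpG_ge0 (I : finType) (F : I -> plane R -> R) j x : 0 <= lpG F j x.
Proof. exact: sqrtr_ge0. Qed.

Lemma lpG_ge (I : finType) (F : I -> plane R -> R) j x i :
  `|rconv (p j) (F i) x| <= lpG F j x /\ `|rconv (q j) (F i) x| <= lpG F j x.
Proof.
have H : cmod (convolution (phi j) (F i) x) ^+ 2 <= \sum_(i : I) cmod (convolution (phi j) (F i) x) ^+ 2.
  by rewrite (bigD1 i)//= lerDl sumr_ge0// => k _; rewrite sqr_ge0.
rewrite cmod_convolution_sqr in H.
by split; rewrite -sqrtr_sqr ler_wsqrtr// (le_trans _ H)// ?lerDl ?lerDr sqr_ge0.
Qed.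

Lemma lpG_le (I : finType) (F : I -> plane R -> R) j x :
  lpG F j x <= \sum_(i : I) (`|rconv (p j) (F i) x| + `|rconv (q j) (F i) x|).
Proof.
rewrite -[leRHS]ger0_norm; last by rewrite sumr_ge0// => i _; rewrite addr_ge0.
rewrite -sqrtr_sqr ler_wsqrtr//.
have H (r : seq I) (u : I -> R) : (forall i, 0 <= u i) -> \sum_(i <- r) u i ^+ 2 <= (\sum_(i <- r) u i) ^+ 2.
  move=> u0; elim: r => [|i r IH]; first by rewrite !big_nil expr0n.
  rewrite !big_cons sqrrD -addrA lerD2l (le_trans IH)// lerDr mulrn_wge0//.
  by rewrite mulr_ge0// sumr_ge0.
apply: le_trans (H _ _ _); last by move=> i; rewrite addr_ge0.
apply: ler_sum => i _; rewrite cmod_convolution_sqr sqrrD.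
by rewrite !real_normK ?num_real// addrAC lerDl mulrn_wge0// mulr_ge0.
Qed.

Lemma continuous_sum_seq (I : Type) (r : seq I) (F : I -> plane R -> R) :
  (forall i, continuous (F i)) -> continuous (fun x => \sum_(i <- r) F i x).
Proof.
move=> cF; elim: r => [|i r IH].
  rewrite (_ : (fun x => _) = fun=> 0); first by move=> x; exact: cvg_cst.
  by apply/funext => x; rewrite big_nil.
rewrite (_ : (fun x => _) = fun x => F i x + \sum_(i <- r) F i x); last first.
  by apply/funext => x; rewrite big_cons.
by move=> x; apply: cvgD; [exact: cF|exact: IH].
Qed.

Lemma lpG_continuous (I : finType) (F : I -> plane R -> R) j :
  (forall i, moderate (F i)) -> continuous (lpG F j).
Proof.
move=> mF x; apply: (@continuous_comp _ _ _ (fun x => \sum_(i : I) cmod (convolution (phi j) (F i) x) ^+ 2) Num.sqrt);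
  last exact: sqrt_continuous.
rewrite (_ : (fun x => _) = (fun x => \sum_(i : I) (rconv (p j) (F i) x ^+ 2 + rconv (q j) (F i) x ^+ 2))); last first.
  by apply/funext => y; apply: eq_bigr => i _; rewrite cmod_convolution_sqr.
apply: continuous_sum_seq => i {}x.
have c1 := continuous_rconv_schwartz (schwartz_lpr hphi j) (mF i).
have c2 := continuous_rconv_schwartz (schwartz_lpi hphi j) (mF i).
have sq (g : plane R -> R) : continuous g -> continuous (fun x => g x ^+ 2).
  by move=> cg y; exact: (cvgM (cg y) (cg y)).
exact: (cvgD (sq _ c1 x) (sq _ c2 x)).
Qed.

Lemma lpN_ge0 (I : finType) (F : I -> plane R -> R) j : (0 <= lpN F j)%E.
Proof. exact: Linf_ge0. Qed.

Lemma lpG_le_lpN (I : finType) (F : I -> plane R -> R) j x : (forall i, moderate (F i)) ->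
  (lpN F j < +oo)%E -> lpG F j x <= fine (lpN F j).
Proof.
move=> mF Noo; have fN : lpN F j \is a fin_num by rewrite ge0_fin_numE// lpN_ge0.
have := @Linf_ge _ _ (fine (lpN F j)) (lpG_continuous (j := j) mF).
by rewrite fineK// => /(_ (lexx _) x); rewrite ger0_norm ?lpG_ge0.
Qed.

Lemma lpN_le (I : finType) (F : I -> plane R -> R) j M : (forall x, lpG F j x <= M) ->
  (lpN F j <= M%:E)%E.
Proof. by move=> GM; apply: Linf_le => x; rewrite ger0_norm ?lpG_ge0. Qed.

Lemma besov0E (I : finType) (F : I -> plane R -> R) :
  besov_norm phi 0 F = (\esum_(j in [set: int]) lpN F j)%E.
Proof. by apply: eq_esum => j _; rewrite mul0r powRr0 mul1e. Qed.

Lemma besov1E (I : finType) (F : I -> plane R -> R) :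
  besov_norm phi 1 F = (\esum_(j in [set: int]) (((2 : R) ^ j)%:E * lpN F j))%E.
Proof. by apply: eq_esum => j _; rewrite mul1r powR_intmul. Qed.

End lp_blocks.

(** * Functions recovered from their Littlewood-Paley series *)

Section recovered_functions.
Variables (R : realType) (phi : int -> plane R -> R[i]).
Hypothesis hphi : littlewood_paley phi.
Implicit Types (x y : plane R) (j : int) (f : plane R -> R) (c : int -> R) (n m : nat).
Local Notation p := (lpr phi).

(** The sum over -n, ..., n, indexed as in [lp_recovered]. *)
Definition symsum (c : int -> R) n : R := \sum_(k < (2 * n).+1) c (k%:Z - n%:Z).

Lemma symsumS c n : symsum c n.+1 = symsum c n + (c (- n.+1%:Z) + c n.+1%:Z).
Proof.
rewrite /symsum (_ : (2 * n.+1).+1 = (2 * n).+3); last by rewrite mulnS.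
rewrite big_ord_recl big_ord_recr addrCA; congr (_ + (_ + _)).
- by apply: eq_bigr => k _; congr c; rewrite /= /bump /=; lia.
- by congr c; rewrite /= sub0r.
- by congr c; rewrite /= /bump /=; lia.
Qed.

Lemma ler_symsum c n m : (forall j, 0 <= c j) -> (n <= m)%N -> symsum c n <= symsum c m.
Proof.
move=> c0; elim: m => [|m IH]; first by rewrite leqn0 => /eqP ->.
rewrite leq_eqVlt => /predU1P[-> //|/IH h]; rewrite symsumS (le_trans h)// lerDl.
by rewrite addr_ge0.
Qed.

Lemma symsum_dist (d : int -> R) c n m : (forall j, `|d j| <= c j) -> (n <= m)%N ->
  `|symsum d m - symsum d n| <= symsum c m - symsum c n.
Proof.
move=> dc; elim: m => [|m IH]; first by rewrite leqn0 => /eqP ->; rewrite !subrr normr0.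
rewrite leq_eqVlt => /predU1P[->|/IH h]; first by rewrite !subrr normr0.
rewrite !symsumS addrAC [X in _ <= X]addrAC (le_trans (ler_normD _ _))// lerD//.
by rewrite (le_trans (ler_normD _ _))// lerD.
Qed.

Lemma symsum_esum (N : int -> \bar R) n : (forall j, 0 <= N j)%E ->
  (\esum_(j in [set: int]) N j < +oo)%E ->
  symsum (fun j => fine (N j)) n <= fine (\esum_(j in [set: int]) N j).
Proof.
move=> N0 Noo.
have eN0 : (0 <= \esum_(j in [set: int]) N j)%E by apply: esum_ge0.
have fe : (\esum_(j in [set: int]) N j)%E \is a fin_num by rewrite ge0_fin_numE.
pose r := [seq (k%:Z - n%:Z : int) | k <- iota 0 (2 * n).+1].
have ur : uniq r by rewrite map_inj_uniq ?iota_uniq// => a b /addIr [].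
have H : (\sum_(j <- r) N j <= \esum_(j in [set: int]) N j)%E.
  rewrite fsbig_seq//; apply: ereal_sup_ubound; exists [set` r] => //.
  by split => //; exact: finite_seq.
have fN j : N j \is a fin_num.
  rewrite ge0_fin_numE//; apply: le_lt_trans Noo.
  have : (N j <= \esum_(i in [set j]) N i)%E by rewrite esum_set1.
  move/le_trans; apply; apply: (@le_trans _ _ (\sum_(i <- [:: j]) N i)%E).
    by rewrite esum_set1// big_seq1.
  rewrite fsbig_seq//; apply: ereal_sup_ubound; exists [set` [:: j]] => //.
  by split => //; exact: finite_seq.
rewrite -lee_fin fineK//; apply: le_trans H.
rewrite big_map -[iota _ _]/(index_iota 0 (2 * n).+1) big_mkord /symsum -sumEFin.
by apply: lee_sum => k _; rewrite fineK.
Qed.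

Variables (f : plane R -> R) (c : int -> R) (S : R).
Hypothesis hf : lp_recovered phi f.
Hypothesis hc : forall j x, `|rconv (p j) f x| <= c j.
Hypothesis hS : forall n, symsum c n <= S.

Let pi2 : 0 < (2 * pi : R)^-1. Proof. by rewrite invr_gt0 mulr_gt0// pi_gt0. Qed.

Let c0 j : 0 <= c j. Proof. exact: le_trans (hc j 0). Qed.

(** The limit is real, so the real parts of the blocks alone converge to it. *)
Lemma recovered_limit x :
  (fun n => (2 * pi)^-1 * symsum (fun j => rconv (p j) f x) n) @ \oo --> f x.
Proof.
have [_ _ /(_ x) H] := hf; apply/cvgrPdist_le => e e0.
move/cvgrPdist_le : H => /(_ _ e0); apply: filterS => n; rewrite sub0r normrN => h.
apply: le_trans h; rewrite distrC.
set z := (X in cmod X); have -> : (2 * pi)^-1 * symsum (fun j => rconv (p j) f x) n - f x = complex.Re z.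
  rewrite /z raddfB /=; congr (_ - _).
  have -> : (\sum_(k < (2 * n).+1) convolution (phi (k%:Z - n%:Z)) f x) =
     symsum (fun j => rconv (p j) f x) n +i* symsum (fun j => rconv (lpi phi j) f x) n.
    rewrite /symsum; elim: (2 * n).+1 => [|m IH]; first by rewrite !big_ord0.
    by rewrite !big_ord_recr IH convolutionE.
  by rewrite mulcE.
rewrite (le_trans _ (ler_norm _))// /cmod; case: z => u v /=.
by rewrite -sqrtr_sqr ler_wsqrtr// lerDl sqr_ge0.
Qed.

Lemma recovered_bound x : `|f x| <= (2 * pi)^-1 * S.
Proof.
have H : (fun n => `|(2 * pi)^-1 * symsum (fun j => rconv (p j) f x) n|) @ \oo --> `|f x|.
  by apply: cvg_norm; exact: recovered_limit.
apply: (cvgr_to_le H).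
apply: nearW => n /=; rewrite normrM gtr0_norm// ler_wpM2l ?(ltW pi2)//.
apply: le_trans (hS n); apply: le_trans (ler_norm_sum _ _ _) _.
by apply: ler_sum => k _; exact: hc.
Qed.

Lemma symsum_tail e : 0 < e -> exists n, forall m, (n <= m)%N -> symsum c m - symsum c n <= e.
Proof.
move=> e0; have nd : {homo symsum c : n m / (n <= m)%N >-> n <= m}.
  by move=> n m; exact: ler_symsum.
have cv : cvgn (symsum c).
  by apply: nondecreasing_is_cvgn => //; exists S => _ [n _ <-].
have : \forall n \near \oo, `|limn (symsum c) - symsum c n| <= e.
  by move/cvgrPdist_le : cv; apply.
case=> n _ /(_ n (leqnn n)) hn; exists n => m nm; apply: le_trans hn.
apply: le_trans (ler_norm _); rewrite lerD2r.
exact: nondecreasing_cvgn_le.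
Qed.

(** The tails of [c] bound the remainders uniformly in the point, so [f] is a uniform limit of
    continuous partial sums. *)
Lemma recovered_continuous : (forall j, continuous (rconv (p j) f)) -> continuous f.
Proof.
move=> cc x; apply/cvgrPdist_le => e e0.
have e3 : 0 < e / 3 by rewrite divr_gt0.
have [n hn] := symsum_tail e3.
pose g y := (2 * pi)^-1 * symsum (fun j => rconv (p j) f y) n.
have fg y : `|f y - g y| <= e / 3.
  have H : (fun m => `|(2 * pi)^-1 * symsum (fun j => rconv (p j) f y) m - g y|) @ \oo --> `|f y - g y|.
    by apply: cvg_norm; apply: cvgB; [exact: recovered_limit|exact: cvg_cst].
  apply: (cvgr_to_le H).
  exists n => // m /= nm; rewrite /g -mulrBr normrM gtr0_norm//.
  apply: (@le_trans _ _ (1 * (e / 3))); last by rewrite mul1r.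
  apply: ler_pM => //; first exact: ltW.
    rewrite invf_le1; last by rewrite mulr_gt0// pi_gt0.
    by have := @pi_ge2 R; lra.
  by apply: le_trans (symsum_dist _ nm) (hn m nm) => j; exact: hc.
have cg : continuous g.
  by move=> y; apply: cvgM; [exact: cvg_cst|apply: continuous_sum_seq => k; exact: cc].
move/cvgrPdist_le : (cg x) => /(_ _ e3); apply: filterS => y gxy.
have -> : f x - f y = (f x - g x) + (g x - g y) + (g y - f y) by ring.
rewrite (_ : e = e / 3 + e / 3 + e / 3); last by field.
apply: le_trans (ler_normD _ _) _; apply: lerD; last by rewrite distrC.
by apply: le_trans (ler_normD _ _) _; apply: lerD.
Qed.

End recovered_functions.

Section extended_sums.
Variable R : realType.
Implicit Types (W : int -> \bar R) (c : R).

Lemma esum_scale_le W c : 0 <= c -> (forall j, 0 <= W j)%E ->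
  (\esum_(j in [set: int]) (c%:E * W j) <= c%:E * \esum_(j in [set: int]) W j)%E.
Proof.
move=> c0 W0; apply: ge_ereal_sup => _ [X [fX _] <-].
rewrite fsbig_finite//= -ge0_sume_distrr//; apply: lee_wpmul2l; first by rewrite lee_fin.
by rewrite -fsbig_finite//; apply: ereal_sup_ubound; exists X.
Qed.

Lemma esum_shift W : (forall j, 0 <= W j)%E -> forall k : int,
  (\esum_(j in [set: int]) W (j + k)%R = \esum_(j in [set: int]) W j)%E.
Proof.
move=> W0 k; apply/esym.
apply: (@reindex_esum _ _ _ [set: int] [set: int] (fun j : int => j + k)%R) => //.
split=> //; first by move=> x y _ _ /addIr.
by move=> y _; exists (y - k) => //; rewrite subrK.
Qed.

Lemma esum_block_le W (V : int -> \bar R) : (forall j, 0 <= W j)%E ->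
  (forall j, V j <= \sum_(m < 5) W (j - 2 + m%:Z)%R)%E ->
  (\esum_(j in [set: int]) V j <= 5%:E * \esum_(j in [set: int]) W j)%E.
Proof.
move=> W0 VW; apply: (@le_trans _ _ (\esum_(j in [set: int]) \sum_(m < 5) W (j - 2 + m%:Z)%R)%E).
  by apply: le_esum => j _.
rewrite esum_sum//.
rewrite (eq_bigr (fun=> \esum_(j in [set: int]) W j)%E); last first.
  move=> m _; rewrite -(esum_shift W0 (m%:Z - 2)); apply: eq_esum => j _.
  by congr W; rewrite -addrA; congr (_ + _); rewrite addrC.
by rewrite !big_ord_recl big_ord0 adde0 mule_natl.
Qed.

End extended_sums.

Section moderate_growth.
Variable R : realType.
Implicit Types (f : plane R -> R) (x : plane R).

Lemma moderate_of_partials f M : (forall x, differentiable f x) ->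
  (forall i x, `|partial i f x| <= M) -> moderate f.
Proof.
move=> df dM; split.
  by apply: meas_continuous => x; exact: differentiable_continuous.
exists (`|f 0| + M * 2) => x.
have w1 := weight_gt0 x.
have M0 : 0 <= M by exact: le_trans (dM 0 0).
have H := lip_partials (fun i x => is_derive_partial i (df x)) dM x 0.
rewrite !subr0 in H.
have c1 := coord1_weight x; have c2 := coord2_weight x.
have w2 : 1 <= (weight x)^-1 by rewrite invf_ge1// weight_le1.
rewrite -(subrK (f 0) (f x)) (le_trans (ler_normD _ _))// mulrDl addrC lerD//.
  by rewrite ler_peMr.
rewrite (le_trans H)// -mulrA ler_wpM2l// (_ : 2 * _ = (weight x)^-1 + (weight x)^-1); last by ring.
exact: lerD.
Qed.

End moderate_growth.

(** * Scaling of kernels and Bernstein's inequality *)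

Section bernstein_riesz.
Variables (R : realType) (phi : int -> plane R -> R[i]).
Hypothesis hphi : littlewood_paley phi.
Implicit Types (x y xi : plane R) (j k : int) (f mu nu : plane R -> R) (i : 'I_2).
Local Notation p := (lpr phi).
Local Notation q := (lpi phi).
Local Notation a := (lpa phi).
Local Notation b := (lpb phi).
Local Notation kr := (kr phi).
Local Notation ki := (ki phi).

Definition homogeneous (d : nat) mu := forall (l : R) x, 0 < l -> mu (l *: x) = l ^+ d * mu x.

(** Block j is a dilate of block 0, and the dilation of kernels dual to it preserves L1 norms; a
    homogeneous symbol adds only the factor 2^(jd). Degree 1 is a derivative, degree 0 a Riesz
    transform. *)
Lemma kernel_scale d mu j : symbol mu -> homogeneous d mu ->
  L1 (kr mu j) = (2 ^ j) ^+ d * L1 (kr mu 0) /\ L1 (ki mu j) = (2 ^ j) ^+ d * L1 (ki mu 0).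
Proof.
move=> smu hmu; pose l : R := 2 ^ j; have l0 : 0 < l by exact: lam_gt0.
have [[rA _ _] [rB _ _]] := nice_lp hphi 0 smu.
have V xi : (2 ^ (- j) * xi.1, 2 ^ (- j) * xi.2) = l^-1 *: xi.
  by rewrite /l -invr_expz; case: xi.
have Em xi : mu xi = l ^+ d * mu (l^-1 *: xi).
  by rewrite -hmu// scalerA divff ?gt_eqF// scale1r.
have EA : (fun xi => mu xi * a j xi) = (fun xi => l ^+ d * (mu (l^-1 *: xi) * a 0 (l^-1 *: xi))).
  by apply/funext => xi; have [-> _] := lp_scale hphi j xi; rewrite V {1}Em mulrA.
have EB : (fun xi => mu xi * b j xi) = (fun xi => l ^+ d * (mu (l^-1 *: xi) * b 0 (l^-1 *: xi))).
  by apply/funext => xi; have [_ ->] := lp_scale hphi j xi; rewrite V {1}Em mulrA.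
have rs (A : plane R -> R) : rapid A -> rapid (fun xi => A (l^-1 *: xi)).
  move=> [mA hA]; split.
    rewrite (_ : (fun xi => _) = A \o affine2 l^-1 0); first exact: meas_affine.
    by apply/funext => xi /=; rewrite affine2_0.
  move=> n; have [K hK] := hA n; have K0 := rapid_ge0 hK.
  pose L := 1 + l ^+ 2; exists (K * (L * L) ^+ n) => xi.
  apply: (le_trans (hK _)); rewrite -mulrA -exprMn ler_wpM2l//.
  have L0 : 1 <= L by rewrite lerDl sqr_ge0.
  have Lg : 0 < L by exact: lt_le_trans L0.
  rewrite lerXn2r ?nnegrE ?weight_ge0//.
    by rewrite mulr_ge0 ?weight_ge0// mulr_ge0// ltW.
  have H (t : R) : (1 + (l^-1 * t) ^+ 2)^-1 <= L * (1 + t ^+ 2)^-1.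
    have t1 : 0 < 1 + t ^+ 2 by rewrite ltr_pwDl// sqr_ge0.
    have t2 : 0 < 1 + (l^-1 * t) ^+ 2 by rewrite ltr_pwDl// sqr_ge0.
    rewrite ler_pdivlMr// mulrC ler_pdivrMr// /L exprMn exprVn.
    set s := t ^+ 2; have s0 : 0 <= s by exact: sqr_ge0.
    have l2 : 0 < l ^+ 2 by rewrite exprn_gt0.
    have -> : (1 + l ^+ 2) * (1 + (l ^+ 2)^-1 * s) = 1 + s + (l ^+ 2 + (l ^+ 2)^-1 * s).
      by field; rewrite gt_eqF.
    by rewrite lerDl addr_ge0 ?(ltW l2)// mulr_ge0// invr_ge0 ltW.
  rewrite /weight (_ : L * L * _ = (L * (1 + xi.1 ^+ 2)^-1) * (L * (1 + xi.2 ^+ 2)^-1)); last by ring.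
  by apply: ler_pM; rewrite ?invr_ge0 ?addr_ge0 ?sqr_ge0//; exact: H.
have sA := rs _ rA; have sB := rs _ rB.
have l20 : 0 <= l ^+ d by rewrite exprn_ge0// ltW.
split.
  have E x : kr mu j x = l ^+ d * l ^+ 2 * kr mu 0 (l *: x).
    rewrite -[LHS]/(K1 (fun xi => mu xi * a j xi) (fun xi => mu xi * b j xi) x) EA EB /K1.
    rewrite (tcosZ _ _ sA) (tsinZ _ _ sB).
    rewrite -[X in _ = _ * X]/(K1 (fun xi => mu xi * a 0 xi) (fun xi => mu xi * b 0 xi) (l *: x)) /K1.
    by rewrite (tcos_scale x l0 rA) (tsin_scale x l0 rB); ring.
  exact: (L1_scale l0 (rapid_kr hphi 0 smu) E l20).
have E x : ki mu j x = l ^+ d * l ^+ 2 * ki mu 0 (l *: x).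
  rewrite -[LHS]/(K2 (fun xi => mu xi * a j xi) (fun xi => mu xi * b j xi) x) EA EB /K2.
  rewrite (tcosZ _ _ sB) (tsinZ _ _ sA).
  rewrite -[X in _ = _ * X]/(K2 (fun xi => mu xi * a 0 xi) (fun xi => mu xi * b 0 xi) (l *: x)) /K2.
  by rewrite (tcos_scale x l0 rB) (tsin_scale x l0 rA); ring.
exact: (L1_scale l0 (rapid_ki hphi 0 smu) E l20).
Qed.

Lemma is_derive_lp j i x :
  is_derive x (basis2 R i) (p j) (- ki (crd i) j x) /\ is_derive x (basis2 R i) (q j) (kr (crd i) j x).
Proof.
have [ra rb] := rapid_lp hphi j.
have -> : p j = K1 (a j) (b j) by apply/funext => y; have [] := lp_inversion hphi j y.
have -> : q j = K2 (a j) (b j) by apply/funext => y; have [] := lp_inversion hphi j y.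
by split; [exact: is_derive_K1|exact: is_derive_K2].
Qed.

Lemma symbol_coord i : symbol (crd i : plane R -> R).
Proof. by move=> n i'; exact: cdiff_crd. Qed.

Lemma rconv_lp_partial j i f x : (forall x, differentiable f x) -> moderate f ->
  moderate (partial i f) ->
  rconv (p j) (partial i f) x = - rconv (ki (crd i) j) f x /\
  rconv (q j) (partial i f) x = rconv (kr (crd i) j) f x.
Proof.
move=> df mf mdf; have fd y := is_derive_partial i (df y).
have sc := symbol_coord i; have rk := rapid_kr hphi j sc; have rki := rapid_ki hphi j sc.
split.
  rewrite -rconvNl//; apply: (rconv_partial (i := i)) => //.
  - exact: rapid_lpr.
  - exact: rapidN.
  - by move=> y; have [] := is_derive_lp j i y.
apply: (rconv_partial (i := i)) => //.
- exact: rapid_lpi.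
- by move=> y; have [] := is_derive_lp j i y.
Qed.

Lemma block_bound (I : finType) (F : I -> plane R -> R) mu j (s : I) x : symbol mu ->
  (forall s, moderate (F s)) -> (forall k, lpN phi F k < +oo)%E ->
  `|rconv (kr mu j) (F s) x| <= (L1 (kr mu j) + L1 (ki mu j)) *
     \sum_(m < 5) fine (lpN phi F (j - 2 + m%:Z)) /\
  `|rconv (ki mu j) (F s) x| <= (L1 (kr mu j) + L1 (ki mu j)) *
     \sum_(m < 5) fine (lpN phi F (j - 2 + m%:Z)).
Proof.
move=> smu mF Noo.
have h1 k y : `|rconv (p k) (F s) y| <= fine (lpN phi F k).
  by have [h _] := lpG_ge phi F k y s; exact: (le_trans h (lpG_le_lpN hphi y mF (Noo k))).
have h2 k y : `|rconv (q k) (F s) y| <= fine (lpN phi F k).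
  by have [_ h] := lpG_ge phi F k y s; exact: (le_trans h (lpG_le_lpN hphi y mF (Noo k))).
exact: (kernel_bound hphi j x smu (mF s) h1 h2).
Qed.

Lemma besov_lpN_lty (I : finType) (F : I -> plane R -> R) (s : R) k :
  (besov_norm phi s F < +oo)%E -> (lpN phi F k < +oo)%E.
Proof.
move=> Boo; rewrite ltey; apply/eqP => E; move: Boo.
rewrite (_ : besov_norm phi s F = +oo%E) ?ltxx//; apply/eqP; rewrite -leye_eq.
have h : ((2 `^ (s * k%:~R))%:E * lpN phi F k = +oo)%E by rewrite E gt0_muley// lte_fin powR_gt0.
rewrite -h -/(lpN phi F k).
apply: (@le_trans _ _ (\sum_(l <- [:: k]) (2 `^ (s * l%:~R))%:E * lpN phi F l)%E); first by rewrite big_seq1.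
rewrite fsbig_seq//; apply: ereal_sup_ubound; exists [set` [:: k]] => //.
by split => //; exact: finite_seq.
Qed.

(** 40 = 5 * 2 * 4: five neighbouring blocks, two parts of a complex value, and 2^j <= 4 * 2^k for k
    >= j - 2. *)
Definition bernstein_cst : R := 40 * \sum_(i < 2) (L1 (kr (crd i) 0) + L1 (ki (crd i) 0)).

Lemma bernstein_cst_ge0 : 0 <= bernstein_cst.
Proof. by rewrite mulr_ge0// sumr_ge0// => i _; rewrite addr_ge0 ?L1_ge0. Qed.

(** Transfers what is assumed of theta in the space of order 1 to B: applied to theta it gives
    finiteness, applied to a difference of two times it gives continuity. *)
Lemma bernstein f : (forall x, differentiable f x) -> moderate f ->
  (forall i, moderate (partial i f)) -> (besov_norm phi 1 (scalar_field f) < +oo)%E ->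
  (besov_norm phi 0 (grad f) <= bernstein_cst%:E * besov_norm phi 1 (scalar_field f))%E.
Proof.
move=> df mf mdf Boo.
have Noo k := besov_lpN_lty k Boo.
have N0 k : (0 <= lpN phi (scalar_field f) k)%E by exact: lpN_ge0.
have fN k : lpN phi (scalar_field f) k \is a fin_num by rewrite ge0_fin_numE.
pose N k := fine (lpN phi (scalar_field f) k).
have Nn0 k : 0 <= N k by exact: fine_ge0.
pose D := \sum_(i < 2) (L1 (kr (crd i) 0) + L1 (ki (crd i) 0)).
have D0 : 0 <= D by rewrite sumr_ge0// => i _; rewrite addr_ge0 ?L1_ge0.
have hom i : homogeneous 1 (crd i : plane R -> R).
  by move=> l x _; rewrite expr1 /crd; case: ifP.
rewrite besov0E besov1E.
pose W k := ((8 * D)%:E * (((2 : R) ^ k)%:E * lpN phi (scalar_field f) k))%E.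
have W0 k : (0 <= W k)%E.
  by rewrite mule_ge0// ?lee_fin ?mulr_ge0// mule_ge0// lee_fin ltW// lam_gt0.
apply: (@le_trans _ _ (5%:E * \esum_(k in [set: int]) W k)%E); last first.
  rewrite /bernstein_cst -/D (_ : 40 * D = 5 * (8 * D)); last by ring.
  rewrite EFinM -muleA; apply: lee_wpmul2l; first by rewrite lee_fin.
  apply: esum_scale_le; first by rewrite mulr_ge0.
  by move=> k; rewrite mule_ge0// lee_fin ltW// lam_gt0.
apply: esum_block_le => // j.
have -> : (\sum_(m < 5) W (j - 2 + m%:Z)%R = (\sum_(m < 5) 8 * D * (2 ^ (j - 2 + m%:Z) * N (j - 2 + m%:Z)))%R%:E)%E.
  by rewrite -sumEFin; apply: eq_bigr => m _; rewrite /W -[lpN _ _ _]fineK// -!EFinM.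
apply: lpN_le => x; apply: (le_trans (lpG_le _ _ _ _)).
have key i : `|rconv (p j) (grad f i) x| + `|rconv (q j) (grad f i) x| <=
   2 * (2 ^ j * (L1 (kr (crd i) 0) + L1 (ki (crd i) 0)) * \sum_(m < 5) N (j - 2 + m%:Z)).
  have [-> ->] := rconv_lp_partial j x df mf (mdf i).
  have [h1 h2] := @block_bound unit (scalar_field f) (crd i) j tt x (symbol_coord i) (fun=> mf) Noo.
  have [e1 e2] := kernel_scale j (symbol_coord i) (hom i).
  rewrite e1 e2 expr1 -mulrDr in h1 h2.
  by rewrite normrN mulr_natl mulr2n lerD.
apply: (le_trans (ler_sum _ (fun i _ => key i))).
rewrite -mulr_sumr -mulr_suml -mulr_sumr -/D mulr_sumr mulr_sumr.
apply: ler_sum => m _.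
have -> : 2 ^ (j - 2 + m%:Z) = 2 ^ j * (4^-1 * 2 ^+ m) :> R.
  by rewrite !expfzDr ?pnatr_eq0// -mulrA; congr (_ * (_ * _)); rewrite -invr_expz -exprnP -natrX.
have m1 : 1 <= (2 : R) ^+ m by rewrite exprn_ege1// ler1n.
have l0 : 0 < (2 : R) ^ j by exact: lam_gt0.
rewrite -subr_ge0 (_ : _ - _ = 2 * D * (2 ^ j) * N (j - 2 + m%:Z) * (2 ^+ m - 1)); last by field.
by rewrite mulr_ge0 ?subr_ge0// mulr_ge0// mulr_ge0 ?(ltW l0)// mulr_ge0.
Qed.

End bernstein_riesz.

Lemma sum2_ge (R : realDomainType) (F : 'I_2 -> 'I_2 -> R) (k i : 'I_2) :
  (forall l m, 0 <= F l m) -> F k i <= \sum_(l < 2) \sum_(m < 2) F l m.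
Proof.
move=> H; apply: (@le_trans _ _ (\sum_(m < 2) F k m)).
  by rewrite (bigD1 i)//= lerDl sumr_ge0.
by rewrite [leRHS](bigD1 k)//= lerDl sumr_ge0// => m _; exact: sumr_ge0.
Qed.

Lemma besov_norm_ge0 (R : realType) (phi : int -> plane R -> R[i]) (s : R) (I : finType)
  (F : I -> plane R -> R) : (0 <= besov_norm phi s F)%E.
Proof.
by apply: esum_ge0 => j _; apply: mule_ge0; [rewrite lee_fin powR_ge0|exact: Lnorm_ge0].
Qed.

(** * The velocity gradient as a Riesz transform of the gradient of theta *)

Section riesz.
Variables (R : realType) (phi : int -> plane R -> R[i]).
Hypothesis hphi : littlewood_paley phi.
Implicit Types (x y xi : plane R) (j : int) (f mu nu : plane R -> R) (i k : 'I_2).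
Local Notation p := (lpr phi).
Local Notation q := (lpi phi).
Local Notation a := (lpa phi).
Local Notation b := (lpb phi).

Definition perp_sign k : R := if k == 0 then -1 else 1.
Definition perp_index k : 'I_2 := if k == 0 then 1 else 0.

(** Up to the factor i, the symbol taking the derivative of theta in direction [perp_index k] to the
    derivative of v_k in direction [i]. The coordinate from the perpendicular gradient goes to theta
    and the one from differentiating v stays, so the degree is 0. *)
Definition riesz_symbol i k xi : R := perp_sign k * (crd i xi * invnorm xi).

Lemma symbol_riesz i k : symbol (riesz_symbol i k).
Proof.
move=> n l; apply: cdiffM; first exact: cdiff_cst.
by apply: cdiffM; [exact: cdiff_crd|exact: cdiff_invnorm].
Qed.

Lemma homogeneous_riesz i k : homogeneous 0 (riesz_symbol i k).
Proof.
move=> l x l0; rewrite expr0 mul1r /riesz_symbol; congr (_ * _).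
have -> : crd i (l *: x) = l * crd i x by rewrite /crd; case: ifP.
have -> : invnorm (l *: x) = l^-1 * invnorm x.
  rewrite /invnorm (_ : l *: x = (l * x.1, l * x.2)); last by case: x.
  by rewrite enormZ gtr0_norm// invfM.
by rewrite mulrACA divff ?gt_eqF// mul1r.
Qed.

Definition riesz_cst : R := \sum_(k < 2) \sum_(i < 2)
  5 * (L1 (kr phi (riesz_symbol i k) 0) + L1 (ki phi (riesz_symbol i k) 0)).

Lemma riesz_cst_ge i k :
  5 * (L1 (kr phi (riesz_symbol i k) 0) + L1 (ki phi (riesz_symbol i k) 0)) <= riesz_cst.
Proof.
apply: (sum2_ge (F := fun k i => 5 * (L1 (kr phi (riesz_symbol i k) 0) + L1 (ki phi (riesz_symbol i k) 0)))).
by move=> l m; rewrite mulr_ge0// addr_ge0 ?L1_ge0.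
Qed.

Definition lp_partial i j x : R[i] := partial i (p j) x +i* partial i (q j) x.

Lemma schwartz_lp_partial i j : schwartz (lp_partial i j).
Proof.
by split; apply: schwartzR_partial; [exact: schwartz_lpr|exact: schwartz_lpi].
Qed.

Lemma fourier_lp_partial i j xi :
  fourier (lp_partial i j) xi = (- (crd i xi * b j xi)) +i* (crd i xi * a j xi).
Proof.
have sp := schwartz_lpr hphi j; have sq := schwartz_lpi hphi j.
have rp := schwartzR_rapid sp; have rq := schwartzR_rapid sq.
have rdp := schwartzR_rapid (schwartzR_partial i sp).
have rdq := schwartzR_rapid (schwartzR_partial i sq).
have dp x := schwartzR_is_derive i x sp; have dq x := schwartzR_is_derive i x sq.
rewrite fourierE// -[X in X +i* _]/((2 * pi)^-1 * (tcos (partial i (p j)) xi + tsin (partial i (q j)) xi)).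
rewrite -[X in _ +i* X]/((2 * pi)^-1 * (tcos (partial i (q j)) xi - tsin (partial i (p j)) xi)).
rewrite (tcos_partial rp rdp dp) (tsin_partial rq rdq dq) (tcos_partial rq rdq dq) (tsin_partial rp rdp dp).
rewrite -[b j xi]/((2 * pi)^-1 * (tcos (q j) xi - tsin (p j) xi)).
rewrite -[a j xi]/((2 * pi)^-1 * (tcos (p j) xi + tsin (q j) xi)).
by congr (_ +i* _); ring.
Qed.

Lemma perp_symbolE k xi : symbol_perp_grad k xi * symbol_inv_sqrt_lap xi =
  0 +i* (perp_sign k * crd (perp_index k) xi * invnorm xi).
Proof.
rewrite /symbol_perp_grad /symbol_inv_sqrt_lap /perp_sign /perp_index /crd.
by case: ifP => _ /=; apply/eqP; rewrite eq_complex /= !mul0r !mulr0 ?subr0 ?addr0 ?add0r ?oppr0 eqxx/=;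
  rewrite ?mulN1r ?mul1r.
Qed.

Variables (theta : plane R -> R) (v : 'I_2 -> plane R -> R).
Hypotheses (dtheta : forall x, differentiable theta x) (mtheta : moderate theta).
Hypothesis mdtheta : forall i, moderate (partial i theta).
Hypothesis Boo : (besov_norm phi 0 (grad theta) < +oo)%E.
Hypothesis hv : qg_velocity phi theta v.

Lemma velocity_moderate k : moderate (v k) /\ forall i, moderate (partial i (v k)).
Proof.
have [_ _ dv rv] := hv k.
have [m0 [M0 h0] _] := rv 0; have [m1 [M1 h1] _] := rv 1.
split.
  apply: (@moderate_of_partials _ _ (Num.max M0 M1)) => // i x.
  by case: (ord2_cases i) => ->; rewrite le_max; apply/orP; [left|right].
move=> i; have [mi [Mi hi] _] := rv i.
by apply: (moderate_bounded (K := Mi)) => //; exact: measP.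
Qed.

(* [fourier_multiplier] only accepts test functions whose transform vanishes near the
   origin; the derivative of phi_j is one, and its derivative is moved onto theta. *)
Lemma velocity_block i k j x :
  rconv (p j) (partial i (v k)) x =
  - rconv (ki phi (riesz_symbol i k) j) (partial (perp_index k) theta) x.
Proof.
have [mv mdv] := velocity_moderate k; have [_ mult dv _] := hv k.
have sp := schwartz_lpr hphi j; have rp := schwartzR_rapid sp.
have rdp := schwartzR_rapid (schwartzR_partial i sp).
have sr := symbol_riesz i k; have sr' := symbol_crd (perp_index k) sr.
set nu := riesz_symbol i k in sr sr' *; set k' := perp_index k in sr' *.
pose mu xi := crd k' xi * nu xi.
rewrite (rconv_partial x rp rdp (fun y => schwartzR_is_derive i y sp) mv (mdv i) (fun y => is_derive_partial i (dv y))).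
have van : exists2 e : R, 0 < e & forall xi, enorm xi < e -> fourier (lp_partial i j) xi = 0.
  exists (2 ^ (j - 1)); first exact: lam_gt0.
  move=> xi xie; have [|a0 b0] := @lp_support _ _ hphi j xi.
    by rewrite /off_annulus negb_and -ltNge xie.
  by rewrite fourier_lp_partial a0 b0 !mulr0 oppr0.
have := mult _ (schwartz_lp_partial i j) van x.
have [[rA _ _] [rB _ _]] := nice_lp hphi j sr'.
have -> : (fun xi => symbol_perp_grad k xi * symbol_inv_sqrt_lap xi * fourier (lp_partial i j) xi) =
    (fun xi => ((-1) * (mu xi * a j xi)) +i* ((-1) * (mu xi * b j xi))).
  apply/funext => xi; rewrite perp_symbolE fourier_lp_partial.
  rewrite /mu /nu /riesz_symbol -/k'; move: (a j xi) (b j xi) => u w.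
  apply/eqP; rewrite eq_complex /=.
  by apply/andP; split; apply/eqP; ring.
rewrite !convolutionE => -[+ _].
have -> : (fun x => complex.Re (inv_fourier (fun xi => (-1 * (mu xi * a j xi)) +i* (-1 * (mu xi * b j xi))) x))
   = (fun x => - kr phi mu j x).
  apply/funext => y; rewrite inv_fourierE; [|exact: rapidZ|exact: rapidZ].
  rewrite [LHS]/= !tcosZ// !tsinZ//.
  rewrite -[kr phi mu j y]/((2 * pi)^-1 * (tcos (fun xi => mu xi * a j xi) y - tsin (fun xi => mu xi * b j xi) y)).
  by ring.
move=> E; rewrite [LHS]E rconvNl//; last exact: rapid_kr.
congr (- _); apply/esym.
exact: (rconv_partial x (rapid_ki hphi j sr) (rapid_kr hphi j sr') (fun y => is_derive_ki hphi j k' y sr)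
  mtheta (mdtheta k') (fun y => is_derive_partial k' (dtheta y))).
Qed.

(** Each block of the derivative of v is bounded by five blocks of grad theta with one constant, and
    summing costs the factor 5. Only [lp_recovered] makes the sum a bound on the function itself,
    which the equation leaves open up to a constant. *)
Lemma riesz_bound i k x :
  `|partial i (v k) x| <= riesz_cst * fine (besov_norm phi 0 (grad theta)).
Proof.
have [_ _ _ rv] := hv k; have [mv mdv] := velocity_moderate k.
have Noo j := besov_lpN_lty j Boo.
have N0 j : (0 <= lpN phi (grad theta) j)%E by exact: lpN_ge0.
have fN j : lpN phi (grad theta) j \is a fin_num by rewrite ge0_fin_numE.
pose N j := fine (lpN phi (grad theta) j).
have Nn0 j : 0 <= N j by exact: fine_ge0.
pose D := L1 (kr phi (riesz_symbol i k) 0) + L1 (ki phi (riesz_symbol i k) 0).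
have D0 : 0 <= D by rewrite addr_ge0 ?L1_ge0.
pose c j := D * \sum_(m < 5) N (j - 2 + m%:Z).
have c0 j : 0 <= c j by rewrite mulr_ge0// sumr_ge0.
have hc j y : `|rconv (p j) (partial i (v k)) y| <= c j.
  rewrite velocity_block normrN.
  have [_ h] := @block_bound _ _ hphi 'I_2 (grad theta) (riesz_symbol i k) j (perp_index k) y (symbol_riesz i k) mdtheta Noo.
  have [e1 e2] := kernel_scale hphi j (symbol_riesz i k) (@homogeneous_riesz i k).
  by rewrite e1 e2 expr0 !mul1r in h.
have B0 := @besov_norm_ge0 _ phi 0 _ (grad theta).
have fB : besov_norm phi 0 (grad theta) \is a fin_num by rewrite ge0_fin_numE.
have cE : (\esum_(j in [set: int]) (c j)%:E <= (5 * D * fine (besov_norm phi 0 (grad theta)))%:E)%E.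
  apply: (@le_trans _ _ (5%:E * \esum_(j in [set: int]) (D%:E * lpN phi (grad theta) j))%E).
    apply: esum_block_le; first by move=> j; rewrite mule_ge0.
    move=> j; rewrite /c mulr_sumr -sumEFin; apply: lee_sum => m _.
    by rewrite EFinM /N fineK.
  rewrite -mulrA EFinM; apply: lee_wpmul2l; first by rewrite lee_fin.
  by rewrite EFinM fineK// besov0E; exact: esum_scale_le.
have cS n : symsum c n <= 5 * D * fine (besov_norm phi 0 (grad theta)).
  apply: le_trans (_ : fine (\esum_(j in [set: int]) (c j)%:E) <= _).
    exact: (@symsum_esum _ (fun j => (c j)%:E) n) (fun j => c0 j) (le_lt_trans cE (ltry _)).
  rewrite -lee_fin fineK// ge0_fin_numE; first exact: le_lt_trans cE (ltry _).
  by apply: esum_ge0 => j _; rewrite lee_fin.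
apply: (le_trans (recovered_bound (rv i) hc cS x)).
have fB0 : 0 <= fine (besov_norm phi 0 (grad theta)) by exact: fine_ge0.
apply: (@le_trans _ _ (1 * (5 * D * fine (besov_norm phi 0 (grad theta))))).
  apply: ler_wpM2r; first by rewrite !mulr_ge0.
  rewrite invf_le1; last by rewrite mulr_gt0// pi_gt0.
  by have := @pi_ge2 R; lra.
by rewrite mul1r ler_wpM2r// riesz_cst_ge.
Qed.

End riesz.

(** * The sup norm of the gradient as a Lipschitz constant *)

Section gradient.
Variable R : realType.
Implicit Types (x z v : plane R) (f : plane R -> R).

Lemma cauchy_schwarz2 (a b c d : R) :
  `|a * c + b * d| <= Num.sqrt (a ^+ 2 + b ^+ 2) * Num.sqrt (c ^+ 2 + d ^+ 2).
Proof.
rewrite -sqrtrM ?addr_ge0 ?sqr_ge0// -sqrtr_sqr ler_wsqrtr//.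
by rewrite -subr_ge0 (_ : _ - _ = (a * d - b * c) ^+ 2) ?sqr_ge0//; ring.
Qed.

Lemma minkowski2 (a b c d : R) :
  Num.sqrt ((a + c) ^+ 2 + (b + d) ^+ 2) <= Num.sqrt (a ^+ 2 + b ^+ 2) + Num.sqrt (c ^+ 2 + d ^+ 2).
Proof.
have h := cauchy_schwarz2 a b c d.
set u := Num.sqrt (a ^+ 2 + b ^+ 2) in h *; set w := Num.sqrt (c ^+ 2 + d ^+ 2) in h *.
have u2 : u ^+ 2 = a ^+ 2 + b ^+ 2 by rewrite sqr_sqrtr// addr_ge0 ?sqr_ge0.
have w2 : w ^+ 2 = c ^+ 2 + d ^+ 2 by rewrite sqr_sqrtr// addr_ge0 ?sqr_ge0.
have u0 : 0 <= u by exact: sqrtr_ge0.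
have w0 : 0 <= w by exact: sqrtr_ge0.
rewrite -[leRHS]ger0_norm ?addr_ge0// -sqrtr_sqr ler_wsqrtr//.
have := le_trans (ler_norm _) h; rewrite !sqrrD u2 w2 => h'; lra.
Qed.

Definition speed f x : R := Num.sqrt (\sum_(i : 'I_2) partial i f x ^+ 2).

Lemma speedE f x : speed f x = Num.sqrt (partial 0 f x ^+ 2 + partial 1 f x ^+ 2).
Proof. by rewrite /speed big_ord_recl big_ord1. Qed.

Lemma is_derive_direction f x v : differentiable f x ->
  is_derive x v f (v.1 * partial 0 f x + v.2 * partial 1 f x).
Proof.
move=> df; apply: DeriveDef; first exact: diff_derivable.
rewrite /partial !deriveE//.
rewrite {1}(_ : v = v.1 *: basis2 R 0 + v.2 *: basis2 R 1); first by rewrite linearD !linearZ.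
by case: v => a b; rewrite /basis2 /= [LHS](_ : _ = (a * 1 + b * 0, a * 0 + b * 1))//;
  rewrite !mulr1 !mulr0 add0r addr0.
Qed.

Lemma lipschitz_of_speed f Y : (forall x, differentiable f x) ->
  (forall x, speed f x <= Y) -> forall x z, `|f x - f z| <= Y * enorm (x - z).
Proof.
move=> df sY x z.
have := @line_mvt _ f (fun y => (x - z).1 * partial 0 f y + (x - z).2 * partial 1 f y) z (x - z)
  (Y * enorm (x - z)) 1 (fun y => is_derive_direction _ (df y)).
rewrite scale1r (addrC z) subrK normr1 mulr1; apply=> t _.
apply: le_trans (cauchy_schwarz2 _ _ _ _) _; rewrite mulrC ler_wpM2r ?sqrtr_ge0//.
by rewrite -speedE.
Qed.

(** Difference quotients in the direction of the gradient tend to |grad f|^2 and are at most Y |grad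
    f|. *)
Lemma speed_of_lipschitz f Y : (forall x, differentiable f x) ->
  (forall x z, `|f x - f z| <= Y * enorm (x - z)) -> forall x, speed f x <= Y.
Proof.
move=> df lip x.
pose v : plane R := (partial 0 f x, partial 1 f x).
have vE : enorm v = speed f x by rewrite speedE.
have d : v.1 * partial 0 f x + v.2 * partial 1 f x = speed f x ^+ 2.
  by rewrite speedE sqr_sqrtr ?addr_ge0 ?sqr_ge0// !expr2.
have /is_derive_seqP H := is_derive_direction v (df x); rewrite d in H.
have {}H := H (fun n => n.+1%:R^-1) (fun n => invr_neq0 (lt0r_neq0 (ltr0Sn _ _))) (@inv_succ_cvg0 R).
have s2 : speed f x ^+ 2 <= Y * speed f x.
  apply: (cvgr_to_le H); apply: nearW => n.
  apply: le_trans (ler_norm _) _; rewrite normrM.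
  apply: le_trans (ler_wpM2l (normr_ge0 _) (lip _ _)) _.
  rewrite (_ : x + _ - x = n.+1%:R^-1 *: v); last by rewrite addrC addKr.
  rewrite (_ : n.+1%:R^-1 *: v = (n.+1%:R^-1 * v.1, n.+1%:R^-1 * v.2))// enormZ vE.
  have : `|n.+1%:R^-1 : R| != 0 by rewrite normr_eq0 invr_neq0// pnatr_eq0.
  rewrite [X in _ -> X * _ <= _]normfV; move: (`|n.+1%:R^-1|) (speed f x) => w s w0.
  by rewrite (_ : w^-1 * _ = Y * s)//; field.
have s0 : 0 <= speed f x by exact: sqrtr_ge0.
(* Needed where the gradient vanishes and division by its length is impossible. *)
have Y0 : 0 <= Y.
  have := lip (1, 0) 0; rewrite subr0 /enorm /= expr1n expr0n /= addr0 sqrtr1 mulr1.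
  exact: le_trans.
move: s0; rewrite le_eqVlt => /predU1P[<-//|s0].
by rewrite -(ler_pM2r s0) -expr2.
Qed.

End gradient.

Section besov_gradient.
Variables (R : realType) (phi : int -> plane R -> R[i]).
Hypothesis hphi : littlewood_paley phi.
Implicit Types (x y : plane R) (j : int) (f : plane R -> R) (i : 'I_2).
Local Notation p := (lpr phi).
Local Notation q := (lpi phi).

Lemma recovered_moderate f : (forall x, differentiable f x) ->
  (forall i, lp_recovered phi (partial i f)) ->
  moderate f /\ forall i, moderate (partial i f).
Proof.
move=> df rf; have [m0 [M0 h0] _] := rf 0; have [m1 [M1 h1] _] := rf 1.
split.
  apply: (@moderate_of_partials _ _ (Num.max M0 M1)) => // i x.
  by case: (ord2_cases i) => ->; rewrite le_max; apply/orP; [left|right].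
move=> i; have [mi [Mi hi] _] := rf i.
by apply: (moderate_bounded (K := Mi)) => //; exact: measP.
Qed.

Variable f : plane R -> R.
Hypotheses (df : forall x, differentiable f x) (rf : forall i, lp_recovered phi (partial i f)).
Hypothesis Boo : (besov_norm phi 0 (grad f) < +oo)%E.
Let B := fine (besov_norm phi 0 (grad f)).

Let hc i j x : `|rconv (p j) (partial i f) x| <= fine (lpN phi (grad f) j).
Proof.
have [mf mdf] := recovered_moderate df rf.
apply: le_trans (lpG_le_lpN hphi x mdf (besov_lpN_lty j Boo)).
by have [] := @lpG_ge _ phi _ (grad f) j x i.
Qed.

Let hS n : symsum (fun j => fine (lpN phi (grad f) j)) n <= B.
Proof.
rewrite /B besov0E; apply: symsum_esum => [j|]; first exact: lpN_ge0.
by rewrite -besov0E.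
Qed.

Lemma gradient_bound i x : `|partial i f x| <= (2 * pi)^-1 * B.
Proof. exact: (recovered_bound (rf i) (hc i) hS). Qed.

(** Continuity turns the essential supremum in [Linf_norm] into a true supremum, hence into a
    Lipschitz constant. *)
Lemma gradient_continuous i : continuous (partial i f).
Proof.
have [mf mdf] := recovered_moderate df rf.
apply: (recovered_continuous (rf i) (hc i) hS) => j.
apply: continuous_rconv_schwartz => //; exact: schwartz_lpr.
Qed.

(** The constant 1 comes from (2 pi)^-1 <= 1/2: each component is at most B/2, which leaves room for
    the Euclidean norm of both. *)
Lemma speed_le_besov x : speed f x <= B.
Proof.
have B0 : 0 <= B by exact/fine_ge0/besov_norm_ge0.
rewrite speedE; have h0 := gradient_bound 0 x; have h1 := gradient_bound 1 x.
rewrite -(ger0_norm B0) -sqrtr_sqr ler_wsqrtr//.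
have c : (2 * pi)^-1 * B <= 2^-1 * B.
  by rewrite ler_wpM2r// lef_pV2 ?posrE//; have := @pi_ge2 R; lra.
have H (u : R) : `|u| <= (2 * pi)^-1 * B -> u ^+ 2 <= 2^-1 * B ^+ 2.
  move=> h; have {}h := le_trans h c; rewrite -(real_normK (num_real u)).
  have : `|u| ^+ 2 <= (2^-1 * B) ^+ 2 by rewrite ler_pXn2r ?nnegrE// mulr_ge0.
  by move/le_trans; apply; rewrite exprMn ler_wpM2r ?sqr_ge0//; lra.
by have := lerD (H _ h0) (H _ h1); rewrite -mulrDl (_ : 2^-1 + 2^-1 = 1) ?mul1r//; field.
Qed.

Let speed_continuous : continuous (speed f).
Proof.
move=> x; apply: (@continuous_comp _ _ _ (fun x => \sum_(i : 'I_2) partial i f x ^+ 2) Num.sqrt);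
  last exact: sqrt_continuous.
apply: continuous_sum_seq => i y.
apply: (@continuous_comp _ _ _ (partial i f) (fun r : R => r ^+ 2)).
  exact: gradient_continuous.
exact: exprn_continuous.
Qed.

Let LinfE : Linf_norm (grad f) = ('N[leb2]_+oo [EFin \o speed f])%E.
Proof. by []. Qed.

Let Linf_fin : Linf_norm (grad f) \is a fin_num.
Proof.
rewrite ge0_fin_numE; last exact: Lnorm_ge0.
apply: le_lt_trans (ltry B); rewrite LinfE; apply: Linf_le => x.
by rewrite ger0_norm ?speed_le_besov// sqrtr_ge0.
Qed.

Lemma speed_le_Linf x : speed f x <= fine (Linf_norm (grad f)).
Proof.
have := @Linf_ge _ _ (fine (Linf_norm (grad f))) speed_continuous.
by rewrite fineK// LinfE => /(_ (lexx _) x); rewrite ger0_norm ?sqrtr_ge0.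
Qed.

Lemma Linf_le_speed M : (forall x, speed f x <= M) -> fine (Linf_norm (grad f)) <= M.
Proof.
move=> h; rewrite -lee_fin fineK// LinfE; apply: Linf_le => x.
by rewrite ger0_norm ?h// sqrtr_ge0.
Qed.

Lemma Linf_le_besov : fine (Linf_norm (grad f)) <= B.
Proof. by apply: Linf_le_speed => x; exact: speed_le_besov. Qed.

End besov_gradient.

Lemma moderateB (R : realType) (f g : plane R -> R) :
  moderate f -> moderate g -> moderate (fun x => f x - g x).
Proof.
move=> [mf [K hK]] [mg [L hL]]; split; first exact: measB.
by exists (K + L) => x; rewrite mulrDl (le_trans (ler_normB _ _))// lerD.
Qed.

(** * Variation of the Besov norm of a gradient *)

Section besov_distance.
Variables (R : realType) (phi : int -> plane R -> R[i]).
Hypothesis hphi : littlewood_paley phi.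
Implicit Types (x y : plane R) (j : int) (F G : 'I_2 -> plane R -> R) (i : 'I_2).
Local Notation p := (lpr phi).
Local Notation q := (lpi phi).

Lemma minkowski_ord2 (u v w : 'I_2 -> R) : (forall i, 0 <= u i <= v i + w i) ->
  Num.sqrt (\sum_(i < 2) u i ^+ 2) <= Num.sqrt (\sum_(i < 2) v i ^+ 2) + Num.sqrt (\sum_(i < 2) w i ^+ 2).
Proof.
move=> h; rewrite !big_ord_recl !big_ord0 !addr0; apply: le_trans (minkowski2 _ _ _ _).
apply: ler_wsqrtr; have H i : u i ^+ 2 <= (v i + w i) ^+ 2.
  by have /andP[u0 uvw] := h i; rewrite ler_pXn2r ?nnegrE// (le_trans u0).
exact: lerD.
Qed.

Lemma cmod_convolutionE j (f : plane R -> R) x :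
  cmod (convolution (phi j) f x) = Num.sqrt (rconv (p j) f x ^+ 2 + rconv (q j) f x ^+ 2).
Proof. by rewrite convolutionE. Qed.

Lemma lpG_dist F G j x : (forall i, moderate (F i)) -> (forall i, moderate (G i)) ->
  let H := fun i y => F i y - G i y in
  lpG phi F j x <= lpG phi G j x + lpG phi H j x /\
  lpG phi G j x <= lpG phi F j x + lpG phi H j x.
Proof.
move=> mF mG H; have rp := schwartzR_rapid (schwartz_lpr hphi j); have rq := schwartzR_rapid (schwartz_lpi hphi j).
have ep i : rconv (p j) (H i) x = rconv (p j) (F i) x - rconv (p j) (G i) x := rconvBr x rp (mF i) (mG i).
have eq i : rconv (q j) (H i) x = rconv (q j) (F i) x - rconv (q j) (G i) x := rconvBr x rq (mF i) (mG i).
split; apply: minkowski_ord2 => i; rewrite !cmod_convolutionE sqrtr_ge0/= ep eq;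
  move: (rconv (p j) (F i) x) (rconv (p j) (G i) x) (rconv (q j) (F i) x) (rconv (q j) (G i) x) => a b c d.
  by have := minkowski2 b d (a - b) (c - d); rewrite !(addrC b) !(addrC d) !subrK.
have := minkowski2 a c (b - a) (d - c).
have sq (s t : R) : (s - t) ^+ 2 = (t - s) ^+ 2 by rewrite -(opprB t s) sqrrN.
by rewrite (addrC a) (addrC c) !subrK (sq b) (sq d).
Qed.

Lemma besov0_subadditive F G H : (forall j x, lpG phi F j x <= lpG phi G j x + lpG phi H j x) ->
  (forall i, moderate (G i)) -> (forall i, moderate (H i)) -> (besov_norm phi 0 F < +oo)%E ->
  (besov_norm phi 0 G < +oo)%E -> (besov_norm phi 0 H < +oo)%E ->
  fine (besov_norm phi 0 F) <= fine (besov_norm phi 0 G) + fine (besov_norm phi 0 H).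
Proof.
move=> FG mG mH Foo Goo Hoo.
have fn (K : 'I_2 -> plane R -> R) : (besov_norm phi 0 K < +oo)%E -> besov_norm phi 0 K \is a fin_num.
  by move=> h; rewrite ge0_fin_numE// besov_norm_ge0.
have N (K : 'I_2 -> plane R -> R) j : (besov_norm phi 0 K < +oo)%E -> lpN phi K j \is a fin_num.
  by move=> /(besov_lpN_lty j) h; rewrite ge0_fin_numE// lpN_ge0.
have E : (besov_norm phi 0 F <= besov_norm phi 0 G + besov_norm phi 0 H)%E.
  rewrite !besov0E -esumD; [|by move=> j _; exact: lpN_ge0|by move=> j _; exact: lpN_ge0].
  apply: le_esum => j _.
  rewrite -[lpN phi G j](fineK (N _ _ Goo)) -[lpN phi H j](fineK (N _ _ Hoo)) -EFinD.
  apply: lpN_le => x; apply: le_trans (FG j x) _.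
  apply: lerD; first exact: (lpG_le_lpN hphi x mG (besov_lpN_lty j Goo)).
  exact: (lpG_le_lpN hphi x mH (besov_lpN_lty j Hoo)).
move: E (fn _ Foo) (fn _ Goo) (fn _ Hoo); move: (besov_norm phi 0 F) (besov_norm phi 0 G) (besov_norm phi 0 H).
by move=> [a| |] [b| |] [c| |].
Qed.

Lemma besov0_triangle F G H : H = (fun i y => F i y - G i y) ->
  (forall i, moderate (F i)) -> (forall i, moderate (G i)) -> (forall i, moderate (H i)) ->
  (besov_norm phi 0 F < +oo)%E -> (besov_norm phi 0 G < +oo)%E -> (besov_norm phi 0 H < +oo)%E ->
  `|fine (besov_norm phi 0 F) - fine (besov_norm phi 0 G)| <= fine (besov_norm phi 0 H).
Proof.
move=> HE mF mG mH Foo Goo Hoo.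
have D j x : lpG phi F j x <= lpG phi G j x + lpG phi H j x /\
  lpG phi G j x <= lpG phi F j x + lpG phi H j x by rewrite HE; exact: lpG_dist.
have A (a b c : R) : a <= b + c -> b <= a + c -> `|a - b| <= c.
  by move=> h1 h2; rewrite ler_norml; apply/andP; split; lra.
exact: (A _ _ _ (besov0_subadditive (fun j x => (D j x).1) mG mH Foo Goo Hoo)
  (besov0_subadditive (fun j x => (D j x).2) mF mH Goo Foo Hoo)).
Qed.

(** Triangle inequality in order 0 followed by Bernstein for the difference; with f and g taken at
    two times it gives continuity of B. *)
Lemma besov_gradient_dist (f g h : plane R -> R) : h = (fun x => f x - g x) ->
  (forall x, differentiable f x) -> (forall i, lp_recovered phi (partial i f)) ->
  (forall x, differentiable g x) -> (forall i, lp_recovered phi (partial i g)) ->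
  (besov_norm phi 0 (grad f) < +oo)%E -> (besov_norm phi 0 (grad g) < +oo)%E ->
  (besov_norm phi 1 (scalar_field h) < +oo)%E ->
  `|fine (besov_norm phi 0 (grad f)) - fine (besov_norm phi 0 (grad g))| <=
    bernstein_cst phi * fine (besov_norm phi 1 (scalar_field h)).
Proof.
move=> hE df rf dg rg Foo Goo hoo.
have [mf mdf] := recovered_moderate df rf; have [mg mdg] := recovered_moderate dg rg.
have dh x : differentiable h x by rewrite hE; exact: differentiableB.
have pE i : partial i h = fun x => partial i f x - partial i g x.
  by apply/funext => x; rewrite hE; apply: deriveB; exact: diff_derivable.
have mdh i : moderate (partial i h) by rewrite pE; exact: moderateB.
have mh : moderate h by rewrite hE; exact: moderateB.
have bh := bernstein hphi dh mh mdh hoo.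
have b1 : besov_norm phi 1 (scalar_field h) \is a fin_num by rewrite ge0_fin_numE// besov_norm_ge0.
have Hoo : (besov_norm phi 0 (grad h) < +oo)%E.
  by apply: le_lt_trans bh _; rewrite -(fineK b1) -EFinM ltry.
have gE : grad h = fun i x => partial i f x - partial i g x by apply/funext => i; exact: pE.
have mdh' i : moderate (grad h i) by exact: mdh.
apply: le_trans (besov0_triangle gE mdf mdg mdh' Foo Goo Hoo) _.
move: bh Hoo b1 (besov_norm_ge0 phi 0 (grad h)).
by move: (besov_norm phi 0 (grad h)) (besov_norm phi 1 (scalar_field h)) => [a| |] [b| |].
Qed.

Lemma besov_gradient_lty (f : plane R -> R) :
  (forall x, differentiable f x) -> (forall i, lp_recovered phi (partial i f)) ->
  (besov_norm phi 1 (scalar_field f) < +oo)%E -> (besov_norm phi 0 (grad f) < +oo)%E.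
Proof.
move=> df rf hoo; have [mf mdf] := recovered_moderate df rf.
have b1 : besov_norm phi 1 (scalar_field f) \is a fin_num by rewrite ge0_fin_numE// besov_norm_ge0.
by apply: le_lt_trans (bernstein hphi df mf mdf hoo) _; rewrite -(fineK b1) -EFinM ltry.
Qed.

End besov_distance.

(** * Doubling of variables *)

Section touching.
Variable R : realType.
Implicit Types (x y v : plane R) (f : plane R -> R).

(** Difference quotients along positive and negative steps give the two inequalities, and the
    quadratic term vanishes in the limit. No second derivative of [f] is involved. *)
Lemma is_derive_touch_above f x v d (alpha beta : R) : is_derive x v f d ->
  (forall r, f (x + r *: v) - f x <= alpha * r + beta * r ^+ 2) -> d = alpha.
Proof.
move=> /is_derive_seqP H h; pose u n : R := n.+1%:R^-1.
have u0 n : 0 < u n by rewrite invr_gt0.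
have uc : u @ \oo --> 0 by exact: (@inv_succ_cvg0 R).
have c1 := H u (fun n => lt0r_neq0 (u0 n)) uc.
have Nu0 n : - u n != 0 by rewrite oppr_eq0 lt0r_neq0.
have Nuc : (fun n => - u n) @ \oo --> 0 by rewrite -oppr0; exact: cvgN.
have c2 := H (fun n => - u n) Nu0 Nuc.
have l1 : (fun n => alpha + beta * u n) @ \oo --> alpha.
  rewrite -[X in _ --> X]addr0 -(mulr0 beta); apply: cvgD; first exact: cvg_cst.
  by apply: cvgM => //; exact: cvg_cst.
have l2 : (fun n => alpha - beta * u n) @ \oo --> alpha.
  rewrite -[X in _ --> X]subr0 -(mulr0 beta); apply: cvgB; first exact: cvg_cst.
  by apply: cvgM => //; exact: cvg_cst.
apply/eqP; rewrite eq_le; apply/andP; split.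
  apply: (ler_cvg_to c1 l1); apply: nearW => n.
  rewrite mulrC ler_pdivrMr//; apply: le_trans (h (u n)) _.
  by rewrite mulrDl expr2 mulrA.
apply: (ler_cvg_to l2 c2); apply: nearW => n.
rewrite invrN mulNr -mulrN [leRHS]mulrC ler_pdivlMr// -lerN2 opprK.
by apply: le_trans (h (- u n)) _; rewrite mulrBl sqrrN mulrN expr2 mulrA opprB addrC.
Qed.

(** The maximum may sit at the final time, so only earlier times are compared and only a sign is
    obtained. *)
Lemma left_max_derive_ge0 (g : R -> R) (a t d : R) : is_derive t (1 : R) g d -> a < t ->
  (forall s, a <= s <= t -> g s <= g t) -> 0 <= d.
Proof.
move=> [dv <-] at_ h; pose u n : R := - ((t - a) * n.+1%:R^-1).
have u0 n : u n < 0 by rewrite oppr_lt0 mulr_gt0 ?subr_gt0// invr_gt0.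
have uc : u @ \oo --> 0.
  rewrite -oppr0 -(mulr0 (t - a)); apply: cvgN; apply: cvgM; first exact: cvg_cst.
  exact: (@inv_succ_cvg0 R).
have := (cvgr_dnbhsP _ _ _).1 dv u (conj (fun n => ltr0_neq0 (u0 n)) uc).
move=> H; apply: (cvgr_to_ge H); apply: nearW => n /=.
rewrite -[leRHS]/((u n)^-1 * (g (u n * 1 + t) - g t)) mulr1.
rewrite mulr_le0// ?invr_le0 ?(ltW (u0 n))// subr_le0 h//.
rewrite -lerBlDr [X in _ && X]gerDr (ltW (u0 n)) andbT lerNr opprB.
by rewrite ger_pMr ?subr_gt0// invf_le1// ler1n.
Qed.

Definition sqn x : R := x.1 ^+ 2 + x.2 ^+ 2.

Lemma sqn_ge0 x : 0 <= sqn x. Proof. by rewrite addr_ge0 ?sqr_ge0. Qed.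

Lemma sqn_shift i x (r : R) : sqn (x + r *: basis2 R i) = sqn x + 2 * r * crd i x + r ^+ 2.
Proof.
rewrite /sqn /crd /basis2; case: (ord2_cases i) => -> /=; case: x => a b /=;
by rewrite /GRing.scale /=; ring.
Qed.

(** Composing with this retraction turns continuity within a time interval into continuity on the
    whole line. *)
Definition clamp (a b t : R) : R := Num.max a (Num.min b t).

Lemma clamp_itv a b t : a <= b -> a <= clamp a b t <= b.
Proof. by move=> ab; rewrite /clamp le_max lexx ge_max ab ge_min lexx. Qed.

Lemma clamp_id a b t : a <= t <= b -> clamp a b t = t.
Proof. by move=> /andP[h1 h2]; rewrite /clamp min_r// max_r. Qed.

Lemma clamp_continuous a b : continuous (clamp a b).
Proof.
move=> t; apply: (@continuous_max R R (fun=> a) (fun t => Num.min b t)); first exact: cvg_cst.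
by apply: (@continuous_min R R (fun=> b) id) => //; exact: cvg_cst.
Qed.

(** Only points where [Psi] is positive are confined to a box. Since one exists, the maximum over
    the compact box is positive and dominates the nonpositive values outside. *)
Lemma positive_max_exists (Psi : R -> plane R -> plane R -> R) (a b rho : R) : a <= b ->
  continuous (fun p : R * (plane R * plane R) => Psi (clamp a b p.1) p.2.1 p.2.2) ->
  (forall t x y, a <= t <= b -> 0 < Psi t x y ->
     [/\ `|x.1| <= rho, `|x.2| <= rho, `|y.1| <= rho & `|y.2| <= rho]) ->
  (exists t x y, a <= t <= b /\ 0 < Psi t x y) ->
  exists t x y, [/\ a <= t <= b, 0 < Psi t x y &
    forall t' x' y', a <= t' <= b -> Psi t' x' y' <= Psi t x y].
Proof.
move=> ab cPsi far [t0 [x0 [y0 [t0ab P0]]]].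
pose I := `[- rho, rho]%classic : set R.
pose K := (`[a, b]%classic : set R) `*` ((I `*` I) `*` (I `*` I)).
have cK : compact K.
  by rewrite /K; repeat (apply: compact_setX => //; try exact: segment_compact).
have inK t x y : a <= t <= b -> 0 < Psi t x y -> K (t, (x, y)).
  move=> tab P; have [h1 h2 h3 h4] := far _ _ _ tab P.
  by rewrite /K /I /= !in_itv /= tab -!ler_norml h1 h2 h3 h4.
have K0 := inK _ _ _ t0ab P0.
have [|[t [x y]] cin cmax] := compact_EVT_max _ cK (continuous_subspaceT cPsi).
  by exists (t0, (x0, y0)).
have tab : a <= t <= b by move: cin; rewrite inE => -[] /=; rewrite in_itv.
have M t' x' y' : a <= t' <= b -> 0 < Psi t' x' y' -> Psi t' x' y' <= Psi t x y.
  move=> t'ab P; have := cmax (t', (x', y')) (mem_set (inK _ _ _ t'ab P)).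
  by rewrite /= !clamp_id.
exists t, x, y; split => //; first exact: lt_le_trans P0 (M _ _ _ t0ab P0).
move=> t' x' y' t'ab; have [|P] := leP (Psi t' x' y') 0; last exact: M.
by move/le_trans; apply; apply/ltW/(lt_le_trans P0)/M.
Qed.

End touching.

(** Completing the squares in q, r and s leaves (eps p)^2 - G eps p <= 3 G^2 / 4, which fails once
    eps p > 2 G. *)
Lemma four_squares (R : realFieldType) (G eps p q r s : R) : 0 <= G -> 0 < eps ->
  eps * (p ^+ 2 + q ^+ 2 + r ^+ 2 + s ^+ 2) <= G * (p + q + r + s) -> p <= 2 * G / eps.
Proof.
move=> G0 e0 h; rewrite leNgt; apply/negP; rewrite ltr_pdivrMr// [ltRHS]mulrC => hp.
have h' : (eps * p) ^+ 2 + (eps * q) ^+ 2 + (eps * r) ^+ 2 + (eps * s) ^+ 2 <=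
    G * (eps * p + eps * q + eps * r + eps * s).
  have := ler_wpM2l (ltW e0) h; congr (_ <= _); ring.
move: h' hp; move: (eps * p) (eps * q) (eps * r) (eps * s) => P Q S T h' hp.
have k1 := sqr_ge0 (Q - G / 2); have k2 := sqr_ge0 (S - G / 2); have k3 := sqr_ge0 (T - G / 2).
have k4 : 0 < (P - 2 * G) * (P + G) by rewrite mulr_gt0//; lra.
have k5 : 0 <= G * G by rewrite mulr_ge0.
nra.
Qed.

(* The sign of the time derivative of the penalized difference at a maximum after time a:
   al w +- be x are the two gradients of theta given by criticality. *)
Lemma doubling_algebra (R : realFieldType)
    (vx0 vx1 vy0 vy1 w0 w1 x0 x1 y0 y1 al be W L S sx sy : R) :
  0 <= al -> 0 < be -> 0 <= W -> 0 <= sx -> 0 <= sy ->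
  - (L * S) <= (vx0 - vy0) * w0 + (vx1 - vy1) * w1 ->
  - (W * (1 + sx)) <= vx0 * x0 + vx1 * x1 -> - (W * (1 + sy)) <= vy0 * y0 + vy1 * y1 ->
  - (vx0 * (al * w0 + be * x0) + vx1 * (al * w1 + be * x1))
  + (vy0 * (al * w0 - be * y0) + vy1 * (al * w1 - be * y1))
  - al * (L * S) - (2 * W + 1) * be * (1 + sx + sy) < 0.
Proof.
move=> al0 be0 W0 sx0 sy0 h1 h2 h3.
have k1 := ler_wpM2l al0 h1; have k2 := ler_wpM2l (ltW be0) h2; have k3 := ler_wpM2l (ltW be0) h3.
have k4 : 0 <= be * W * (sx + sy) by rewrite mulr_ge0 ?addr_ge0// mulr_ge0// ltW.
have k5 : 0 <= be * (sx + sy) by rewrite mulr_ge0 ?addr_ge0// ltW.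
nra.
Qed.

Section doubling_variables.
Variables (R : realType) (a b M G W : R) (L Lam : R -> R).
Variables (theta : R -> plane R -> R) (v : R -> 'I_2 -> plane R -> R).
Hypotheses (ab : a <= b) (M0 : 0 <= M) (G0 : 0 <= G) (W0 : 0 <= W).
Hypothesis ctheta : continuous (fun p : R * plane R => theta (clamp a b p.1) p.2).
Hypothesis dtheta : forall t x, a <= t <= b -> differentiable (theta t) x.
Hypothesis transport : forall t x, a < t <= b ->
  is_derive t (1 : R) (fun s => theta s x)
    (- (v t 0 x * partial 0 (theta t) x + v t 1 x * partial 1 (theta t) x)).
Hypothesis dLam : forall t, a <= t <= b -> is_derive t (1 : R) Lam (L t).
Hypothesis lipG : forall t x y, a <= t <= b -> theta t x - theta t y <= G * enorm (x - y).
Hypothesis lipM : forall x y, theta a x - theta a y <= M * enorm (x - y).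
Hypothesis v_lip : forall t x y, a <= t <= b ->
  - (L t * sqn (x - y)) <= (v t 0 x - v t 0 y) * (x - y).1 + (v t 1 x - v t 1 y) * (x - y).2.
Hypothesis v_growth : forall t x, a <= t <= b ->
  - (W * (1 + sqn x)) <= v t 0 x * x.1 + v t 1 x * x.2.

Let E t := expR (2 * (Lam t - Lam a)).
(** Growing penalty: of its rate, 4 W pays for the transport of the penalty by v at the two points
    and 2 makes the final inequality strict. *)
Let N t := expR ((4 * W + 2) * (t - a)).

(** By the inequality of means, the bracket after [M] is at least sqrt(E) |x - y|: the parabolas
    indexed by [eta] are smooth majorants of the Lipschitz cone, and the square explains the 2 in
    [E]. *)
Let Psi (eps eta : R) t x y := theta t x - theta t y -
  M * (E t * sqn (x - y) / (2 * eta) + eta / 2) - eps * N t * (1 + sqn x + sqn y).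

Let clampT (F : R -> R) : (forall t, a <= t <= b -> {for t, continuous F}) ->
  continuous (fun p : R * (plane R * plane R) => F (clamp a b p.1)).
Proof.
move=> cF p; apply: (@continuous_comp _ _ _ (fun p : R * (plane R * plane R) => clamp a b p.1) F).
  by apply: (@continuous_comp _ _ _ fst (clamp a b)); [exact: cvg_fst|exact: clamp_continuous].
by apply: cF; exact: clamp_itv.
Qed.

Let csqn : continuous (@sqn R).
Proof.
move=> x; apply: cvgD.
  by apply: (@continuous_comp _ _ _ fst (fun r : R => r ^+ 2)); [exact: cvg_fst|exact: exprn_continuous].
by apply: (@continuous_comp _ _ _ snd (fun r : R => r ^+ 2)); [exact: cvg_snd|exact: exprn_continuous].
Qed.

Let cLam t : a <= t <= b -> {for t, continuous Lam}.
Proof.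
by move=> /dLam [d _]; apply: differentiable_continuous; exact/derivable1_diffP.
Qed.

Lemma doubling_continuous eps eta :
  continuous (fun p : R * (plane R * plane R) => Psi eps eta (clamp a b p.1) p.2.1 p.2.2).
Proof.
have c1 : continuous (fun p : R * (plane R * plane R) => p.2.1).
  by move=> p; apply: (@continuous_comp _ _ _ snd fst); [exact: cvg_snd|exact: cvg_fst].
have c2 : continuous (fun p : R * (plane R * plane R) => p.2.2).
  by move=> p; apply: (@continuous_comp _ _ _ snd snd); [exact: cvg_snd|exact: cvg_snd].
have ct (g : R * (plane R * plane R) -> plane R) : continuous g ->
    continuous (fun p => theta (clamp a b p.1) (g p)).
  move=> cg p; apply: (@continuous_comp _ _ _ (fun p => (p.1, g p))
    (fun p : R * plane R => theta (clamp a b p.1) p.2)); last exact: ctheta.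
  by apply: (cvg_pair (G := nbhs p.1) (H := nbhs (g p))); [exact: cvg_fst|exact: cg].
have cs (g : R * (plane R * plane R) -> plane R) : continuous g -> continuous (fun p => sqn (g p)).
  by move=> cg p; apply: (@continuous_comp _ _ _ g (@sqn R)); [exact: cg|exact: csqn].
have cE : continuous (fun p : R * (plane R * plane R) => E (clamp a b p.1)).
  apply: clampT => t tab; apply: (@continuous_comp _ _ _ (fun t => 2 * (Lam t - Lam a)) expR).
    by apply: cvgM; [exact: cvg_cst|apply: cvgB; [exact: cLam|exact: cvg_cst]].
  exact: continuous_expR.
have cN : continuous (fun p : R * (plane R * plane R) => N (clamp a b p.1)).
  apply: clampT => t tab; apply: (@continuous_comp _ _ _ (fun t => (4 * W + 2) * (t - a)) expR).
    by apply: cvgM; [exact: cvg_cst|apply: cvgB; [exact: cvg_id|exact: cvg_cst]].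
  exact: continuous_expR.
move=> p; rewrite /Psi; apply: cvgB; first apply: cvgB; first apply: cvgB.
- exact: (@ct _ c1).
- exact: (@ct _ c2).
- apply: cvgM; first exact: cvg_cst.
  apply: cvgD; last exact: cvg_cst.
  apply: cvgM; last exact: cvg_cst.
  apply: cvgM; first exact: cE.
  by apply: (cs (fun p => p.2.1 - p.2.2)) => q; apply: cvgB; [exact: c1|exact: c2].
- apply: cvgM; first by apply: cvgM; [exact: cvg_cst|exact: cN].
  apply: cvgD; last exact: (@cs _ c2).
  by apply: cvgD; [exact: cvg_cst|exact: (@cs _ c1)].
Qed.

Let E_gt0 t : 0 < E t. Proof. exact: expR_gt0. Qed.
Let N_ge1 t : a <= t -> 1 <= N t.
Proof.
by move=> at_; rewrite /N -[leLHS]expR0 ler_expR mulr_ge0 ?subr_ge0// addr_ge0// mulr_ge0.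
Qed.

(** [G] is a crude Lipschitz bound, uniform in time, that serves for compactness only: linear growth
    loses against the quadratic penalty. It does not enter the final constant. *)
Lemma doubling_far eps eta t x y : 0 < eps -> 0 < eta -> a <= t <= b -> 0 < Psi eps eta t x y ->
  let rho := 2 * G / eps in
  [/\ `|x.1| <= rho, `|x.2| <= rho, `|y.1| <= rho & `|y.2| <= rho].
Proof.
move=> e0 eta0 tab P rho.
have enorm_le (z : plane R) : enorm z <= `|z.1| + `|z.2|.
  rewrite -[leRHS]ger0_norm ?addr_ge0// -sqrtr_sqr ler_wsqrtr// sqrrD !real_normK ?num_real//.
  by rewrite -addrA [X in _ <= _ + X]addrC lerD2l lerDl mulrn_wge0// mulr_ge0.
have h1 : theta t x - theta t y <= G * (`|x.1| + `|x.2| + `|y.1| + `|y.2|).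
  apply: le_trans (lipG x y tab) _; apply: ler_wpM2l => //; apply: le_trans (enorm_le _) _.
  have := ler_normB x.1 y.1; have := ler_normB x.2 y.2.
  by rewrite /=; lra.
have h2 : 0 <= M * (E t * sqn (x - y) / (2 * eta) + eta / 2).
  rewrite mulr_ge0// addr_ge0//; last by rewrite divr_ge0// ltW.
  rewrite divr_ge0//; last by rewrite mulr_ge0// ltW.
  by rewrite mulr_ge0 ?sqn_ge0// ltW.
have h3 : eps * (1 + sqn x + sqn y) <= eps * N t * (1 + sqn x + sqn y).
  apply: ler_wpM2r; first by do 2 (apply: addr_ge0; last exact: sqn_ge0).
  by rewrite ler_peMr ?(ltW e0)// N_ge1//; case/andP: tab.
have h4 : eps * (`|x.1| ^+ 2 + `|x.2| ^+ 2 + `|y.1| ^+ 2 + `|y.2| ^+ 2) <=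
    G * (`|x.1| + `|x.2| + `|y.1| + `|y.2|).
  rewrite !real_normK ?num_real//; apply: le_trans h1; apply: le_trans (_ : eps * (1 + sqn x + sqn y) <= _).
    by rewrite ler_wpM2l ?(ltW e0)// /sqn -!addrA lerDr.
  apply: le_trans h3 _; rewrite -subr_ge0; apply: le_trans (ltW P) _.
  by rewrite /Psi lerD2r gerBl.
rewrite /rho; move: h4; move: `|x.1| `|x.2| `|y.1| `|y.2| => p q r s h4.
split.
- exact: (four_squares G0 e0 h4).
- apply: (@four_squares _ G eps q p r s G0 e0); move: h4; congr (_ <= _); ring.
- apply: (@four_squares _ G eps r p q s G0 e0); move: h4; congr (_ <= _); ring.
- apply: (@four_squares _ G eps s p q r G0 e0); move: h4; congr (_ <= _); ring.
Qed.

Lemma doubling_le0 eps eta t x y : 0 < eps -> 0 < eta -> a <= t <= b -> Psi eps eta t x y <= 0.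
Proof.
move=> e0 eta0; move: t x y.
have [//|/existsNP[t0 /existsNP[x0 /existsNP[y0 /not_implyP[t0ab /negP]]]]] :=
  pselect (forall t x y, a <= t <= b -> Psi eps eta t x y <= 0).
rewrite -ltNge => P0; exfalso.
have [|t [x [y [tab P Pmax]]]] := @positive_max_exists _ (Psi eps eta) _ _ (2 * G / eps) ab
  (@doubling_continuous eps eta) (fun t x y => @doubling_far eps eta t x y e0 eta0).
  by exists t0, x0, y0.
have w2 : 0 < 2 * eta by rewrite mulr_gt0.
(* At time a the factor [E] is 1, and [lipM] with the inequality of means makes [Psi]
   nonpositive. *)
have at_ : a < t.
  have /andP[+ _] := tab; rewrite le_eqVlt => /predU1P[ta|//]; exfalso; move: P.
  apply/negP; rewrite -leNgt -ta /Psi /E subrr mulr0 expR0 mul1r.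
  have h : theta a x - theta a y <= M * (sqn (x - y) / (2 * eta) + eta / 2).
    apply: le_trans (lipM x y) _; apply: ler_wpM2l => //.
    rewrite -subr_ge0 (_ : _ - _ = (enorm (x - y) - eta) ^+ 2 / (2 * eta)); last first.
      have -> : sqn (x - y) = enorm (x - y) ^+ 2 by rewrite sqr_sqrtr// sqn_ge0.
      by field; exact: lt0r_neq0.
    by rewrite divr_ge0 ?sqr_ge0// ltW.
  rewrite subr_le0; apply: (@le_trans _ _ 0); first by rewrite subr_le0.
  rewrite mulr_ge0//; last by do 2 (apply: addr_ge0; last exact: sqn_ge0).
  by rewrite mulr_ge0 ?(ltW e0)// ltW// expR_gt0.
have tab' : a < t <= b by rewrite at_; case/andP: tab.
pose al := M * E t / eta; pose be := 2 * (eps * N t).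
have al0 : 0 <= al by rewrite divr_ge0 ?(ltW eta0)// mulr_ge0// ltW// E_gt0.
have be0 : 0 < be by rewrite !mulr_gt0// expR_gt0.
(* Maximality in x places theta under a parabola along each axis, which fixes its partial
   derivatives; maximality in y does the same for -theta. *)
have px i : partial i (theta t) x = al * crd i (x - y) + be * crd i x.
  apply: (@is_derive_touch_above _ (theta t) x (basis2 R i) _ _ (al / 2 + be / 2)
    (is_derive_partial i (dtheta x tab))) => r.
  have H := Pmax t (x + r *: basis2 R i) y tab; rewrite /Psi -subr_le0 in H.
  rewrite -subr_le0; move: H; rewrite (addrAC x) !sqn_shift; congr (_ <= _).
  by rewrite /al /be; field; exact: lt0r_neq0.
have py i : partial i (theta t) y = al * crd i (x - y) - be * crd i y.
  have dN : is_derive y (basis2 R i) (fun z => - theta t z) (- partial i (theta t) y).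
    exact: is_deriveN (is_derive_partial i (dtheta y tab)).
  apply/eqP; rewrite -eqr_opp; apply/eqP.
  apply: (@is_derive_touch_above _ _ _ _ _ _ (al / 2 + be / 2) dN) => r.
  have H := Pmax t x (y + r *: basis2 R i) tab; rewrite /Psi -subr_le0 in H.
  rewrite -subr_le0; move: H; rewrite (_ : x - (y + _) = (x - y) + (- r) *: basis2 R i);
    last by rewrite scaleNr opprD addrA.
  rewrite !sqn_shift; congr (_ <= _).
  by rewrite /al /be; field; exact: lt0r_neq0.
pose D := - (v t 0 x * partial 0 (theta t) x + v t 1 x * partial 1 (theta t) x)
  + (v t 0 y * partial 0 (theta t) y + v t 1 y * partial 1 (theta t) y)
  - al * (L t * sqn (x - y)) - (2 * W + 1) * be * (1 + sqn x + sqn y).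
have dD : is_derive t (1 : R) (fun s => Psi eps eta s x y) D.
  have d1 := transport x tab'; have d2 := transport y tab'; have d3 := dLam tab.
  have dE : is_derive t (1 : R) E (E t * (2 * L t)).
    have dl : is_derive t (1 : R) (fun s => 2 * (Lam s - Lam a)) (2 * L t).
      by have h := is_deriveZ 2 (is_deriveB d3 (is_derive_cst (Lam a) t 1)); rewrite subr0 in h.
    exact: (is_derive1_comp (f := expR) (is_derive_expR _) dl).
  have dN : is_derive t (1 : R) N (N t * (4 * W + 2)).
    have dl : is_derive t (1 : R) (fun s => (4 * W + 2) * (s - a)) (4 * W + 2).
      have h := is_deriveZ (4 * W + 2) (is_deriveB (is_derive_id t 1) (is_derive_cst a t 1)).
      by rewrite subr0 /GRing.scale /= mulr1 in h.
    exact: (is_derive1_comp (f := expR) (is_derive_expR _) dl).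
  pose k1 := M * sqn (x - y) / (2 * eta); pose k2 := eps * (1 + sqn x + sqn y).
  rewrite (_ : (fun s => _) = (fun s => theta s x) - (fun s => theta s y) - k1 *: E - k2 *: N
    - cst (M * (eta / 2))); last first.
    apply/funext => s; rewrite /Psi /k1 /k2 !fctE /GRing.scale /=; field; exact: lt0r_neq0.
  have h := is_deriveB (is_deriveB (is_deriveB (is_deriveB d1 d2) (is_deriveZ k1 dE))
    (is_deriveZ k2 dN)) (is_derive_cst (M * (eta / 2)) t 1).
  apply: (is_derive_eq h); rewrite /D /k1 /k2 /al /be /GRing.scale /=; field; exact: lt0r_neq0.
suff D0 : D < 0.
  move: D0; apply/negP; rewrite -leNgt; apply: (left_max_derive_ge0 dD at_) => s /andP[sa st].
  by apply: Pmax; rewrite sa (le_trans st)//; case/andP: tab.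
rewrite /D !px !py.
apply: doubling_algebra => //; try exact: sqn_ge0.
- exact: v_lip.
- exact: v_growth.
- exact: v_growth.
Qed.

Lemma doubling x y : theta b x - theta b y <= M * expR (Lam b - Lam a) * enorm (x - y).
Proof.
have bb : a <= b <= b by rewrite ab lexx.
have H eta : 0 < eta -> theta b x - theta b y <= M * (E b * sqn (x - y) / (2 * eta) + eta / 2).
  (* With eps = e / Q the penalty at (x, y) equals e, which is arbitrary. *)
  move=> eta0; rewrite -subr_le0; set Q := N b * (1 + sqn x + sqn y).
  have Q0 : 0 < Q.
    rewrite mulr_gt0 ?expR_gt0//; apply: ltr_pwDl; last exact: sqn_ge0.
    by apply: ltr_pwDl; last exact: sqn_ge0.
  apply/ler_addgt0Pl => e e0; rewrite addr0 -[leRHS](divfK (lt0r_neq0 Q0)).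
  have h := @doubling_le0 (e / Q) eta b x y (divr_gt0 e0 Q0) eta0 bb.
  by rewrite /Psi -(mulrA (e / Q)) subr_le0 in h.
have [->|xy] := eqVneq x y; first by rewrite !subrr enorm0 mulr0.
have d0 : 0 < enorm (x - y) by rewrite enorm_gt0// subr_eq0.
set z := expR (Lam b - Lam a); have z0 : 0 < z by exact: expR_gt0.
(* The minimising eta is z |x - y|, for which the parabola touches the cone. *)
have := H _ (mulr_gt0 z0 d0); congr (_ <= _).
have -> : E b = z ^+ 2 by rewrite /E /z -expRM_natl.
have -> : sqn (x - y) = enorm (x - y) ^+ 2 by rewrite sqr_sqrtr// sqn_ge0.
by field; rewrite !lt0r_neq0.
Qed.

End doubling_variables.

Lemma continuous_into_within (X Y Z : topologicalType) (D : set Y) (g : X -> Y) (f : Y -> Z) :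
  continuous g -> (forall x, D (g x)) -> {within D, continuous f} -> continuous (fun x => f (g x)).
Proof.
move=> cg Dg /subspace_continuousP cf x.
move=> A /(cf _ (Dg x)) /cg; rewrite /nbhs /=; apply: filterS => x' /= h.
exact: h (Dg x').
Qed.

(** * Integration in time *)

Section primitives.
Variable R : realType.
Local Notation mu := (@lebesgue_measure R).
Implicit Types (f g P : R -> R).

(** The base point lies strictly below the times of interest, so the derivative there is
    two-sided. *)
Lemma primitive_exists g (m : R) : continuous g ->
  exists P, forall t, m < t -> is_derive t (1 : R) P (g t).
Proof.
move=> cg; exists (fun t => \int[mu]_(s in `[m, t]) g s) => t mt.
have t1 : t < t + 1 by rewrite ltrDl.
have ig : mu.-integrable `[m, t + 1] (EFin \o g).
  by apply: continuous_compact_integrable; [exact: segment_compact|exact: continuous_subspaceT].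
have [d1 d2] := continuous_FTC1_closed t1 ig mt (cg t).
by apply: DeriveDef; [exact: d1|rewrite -derive1E; exact: d2].
Qed.

Lemma is_derive_continuous g (t d : R) : is_derive t (1 : R) g d -> {for t, continuous g}.
Proof. by move=> [dg _]; apply: differentiable_continuous; exact/derivable1_diffP. Qed.

Lemma integrable_segment f (a b : R) : (forall t, a <= t <= b -> {for t, continuous f}) ->
  mu.-integrable `[a, b] (EFin \o f).
Proof.
move=> cf; apply: continuous_compact_integrable; first exact: segment_compact.
by apply: continuous_in_subspaceT => t; rewrite inE /= in_itv /=; exact: cf.
Qed.

Lemma Rintegral_primitive g P (a b : R) : a <= b ->
  (forall t, a <= t <= b -> {for t, continuous g}) ->
  (forall t, a <= t <= b -> is_derive t (1 : R) P (g t)) ->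
  \int[mu]_(t in `[a, b]) g t = P b - P a.
Proof.
move=> + cg dP; rewrite le_eqVlt => /predU1P[<-|ab].
  by rewrite set_itv1 Rintegral_set1 subrr.
have cP t : a <= t <= b -> {for t, continuous P} by move=> /dP; exact: is_derive_continuous.
rewrite /Rintegral (continuous_FTC2 (F := P) ab)//.
- by apply: continuous_in_subspaceT => t; rewrite inE /= in_itv /=; exact: cg.
- split.
  + by move=> t; rewrite in_itv /= => /andP[at_ tb]; have [] := dP t; rewrite // !ltW.
  + by apply: cvg_at_right_filter; apply: cP; rewrite lexx ltW.
  + by apply: cvg_at_left_filter; apply: cP; rewrite lexx ltW.
- move=> t; rewrite in_itv /= => /andP[at_ tb]; rewrite derive1E.
  by have [] := dP t; rewrite // !ltW.
Qed.

Lemma Rintegral_le_primitive f g P (a b : R) : a <= b ->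
  (forall t, a <= t <= b -> {for t, continuous f}) ->
  (forall t, a <= t <= b -> {for t, continuous g}) ->
  (forall t, a <= t <= b -> is_derive t (1 : R) P (g t)) ->
  (forall t, a <= t <= b -> f t <= g t) ->
  \int[mu]_(t in `[a, b]) f t <= P b - P a.
Proof.
move=> ab cf cg dP fg; rewrite -(Rintegral_primitive ab cg dP).
apply: le_Rintegral => //; exact: integrable_segment.
Qed.

End primitives.

(** * From two-sided growth bounds to the three estimates *)

Section gronwall.
Variables (R : realType) (y B g P : R -> R) (t C gamma : R).
Local Notation mu := (@lebesgue_measure R).
Implicit Types s tau : R.
Let A tau := \int[mu]_(s in `[0, tau]) B s.
Hypotheses (t0 : 0 <= t) (C0 : 0 < C) (Cg : C <= gamma).
Hypothesis cg : continuous g.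
Hypothesis dP : forall s, 0 <= s <= t -> is_derive s (1 : R) P (g s).
Hypothesis Bg : forall s, 0 <= s <= t -> B s = g s.
Hypothesis y_ge0 : forall s, 0 <= s <= t -> 0 <= y s.
Hypothesis yB : forall s, 0 <= s <= t -> y s <= B s.
Hypothesis forward : forall s, 0 <= s <= t -> y t <= y s * expR (C * (P t - P s)).
Hypothesis backward : forall s, 0 <= s <= t -> y 0 <= y s * expR (C * (P s - P 0)).

Let cP s : 0 <= s <= t -> {for s, continuous P}.
Proof. by move=> /dP; exact: is_derive_continuous. Qed.

Let AE tau : 0 <= tau <= t -> A tau = P tau - P 0.
Proof.
move=> /andP[tau0 taut].
have le s : 0 <= s <= tau -> 0 <= s <= t by move=> /andP[-> /le_trans ->].
rewrite -(@Rintegral_primitive _ g P 0 tau tau0 (fun s _ => @cg s) (fun s st => dP (le s st))).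
by apply: eq_Rintegral => s; rewrite inE /= in_itv /= => /le; exact: Bg.
Qed.

Let cexp (c : R) s : 0 <= s <= t -> {for s, continuous (fun s => expR (c * (P s - P 0)))}.
Proof.
move=> st; apply: (@continuous_comp _ _ _ (fun s => c * (P s - P 0)) expR); last exact: continuous_expR.
by apply: cvgM; [exact: cvg_cst|apply: cvgB; [exact: cP|exact: cvg_cst]].
Qed.

Let dexp (c : R) s : 0 <= s <= t ->
  is_derive s (1 : R) (fun s => expR (c * (P s - P 0))) (c * g s * expR (c * (P s - P 0))).
Proof.
move=> st; have dl : is_derive s (1 : R) (fun s => c * (P s - P 0)) (c * g s).
  by have h := is_deriveZ c (is_deriveB (dP st) (is_derive_cst (P 0) s 1)); rewrite subr0 in h.
by rewrite mulrC; exact: (is_derive1_comp (f := expR) (is_derive_expR _) dl).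
Qed.

Let Bexp s : 0 <= s <= t -> y 0 <= g s * expR (C * (P s - P 0)).
Proof.
move=> st; apply: (le_trans (backward st)).
by rewrite ler_wpM2r ?expR_ge0// -Bg// yB.
Qed.

Let zt : (0 : R) <= 0 <= t. Proof. by rewrite lexx t0. Qed.
Let tt : 0 <= t <= t. Proof. by rewrite lexx t0. Qed.
Let gC : 0 <= gamma - C. Proof. by rewrite subr_ge0. Qed.

Let intE (c : R) : \int[mu]_(tau in `[0, t]) expR (c * A tau) =
  \int[mu]_(tau in `[0, t]) expR (c * (P tau - P 0)).
Proof. by apply: eq_Rintegral => s; rewrite inE /= in_itv /= => /AE ->. Qed.

Let intNE : \int[mu]_(tau in `[0, t]) expR (- (gamma * A tau)) =
  \int[mu]_(tau in `[0, t]) expR (- gamma * (P tau - P 0)).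
Proof. by apply: eq_Rintegral => s; rewrite inE /= in_itv /= => /AE ->; rewrite -mulNr. Qed.

(** For each s, y(t) <= y(s) exp(C (P(t) - P(s))) <= B(s) exp(C (P(t) - P(s))). Times (gamma - C)
    exp(gamma (P(s) - P(0))), the right side is the derivative in s of exp(C (P(t) - P(0)))
    exp((gamma - C) (P(s) - P(0))). Its integral, times y(0), is added to the forward bound from
    time 0. *)
Lemma upper_estimate : y t <= y 0 * expR (gamma * A t) /
  (1 + (gamma - C) * y 0 * \int[mu]_(tau in `[0, t]) expR (gamma * A tau)).
Proof.
rewrite intE AE//; set I := Rintegral _ _ _.
have I0 : 0 <= I by apply: Rintegral_ge0 => s _; exact: expR_ge0.
have den : 0 < 1 + (gamma - C) * y 0 * I.
  by rewrite ltr_pwDl// mulr_ge0// mulr_ge0// y_ge0.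
rewrite ler_pdivlMr// mulrDr mulr1.
have h : (gamma - C) * y t * I <= expR (C * (P t - P 0)) * (expR ((gamma - C) * (P t - P 0)) - 1).
  have -> : (gamma - C) * y t * I =
      \int[mu]_(tau in `[0, t]) ((gamma - C) * y t * expR (gamma * (P tau - P 0))).
    by rewrite RintegralZl//; apply: integrable_segment => s; exact: cexp.
  pose F s := expR (C * (P t - P 0)) * expR ((gamma - C) * (P s - P 0)).
  have := @Rintegral_le_primitive _ (fun s => (gamma - C) * y t * expR (gamma * (P s - P 0)))
    (fun s => expR (C * (P t - P 0)) * ((gamma - C) * g s * expR ((gamma - C) * (P s - P 0)))) F 0 t t0.
  rewrite /F subrr mulr0 expR0 -mulrBr; apply.
  - by move=> s st; apply: cvgM; [exact: cvg_cst|exact: cexp].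
  - move=> s st; apply: cvgM; first exact: cvg_cst.
    by apply: cvgM; [apply: cvgM; [exact: cvg_cst|exact: cg]|exact: cexp].
  - by move=> s st; exact: (is_deriveZ (expR (C * (P t - P 0))) (dexp (gamma - C) st)).
  - move=> s st; have k : y t <= g s * expR (C * (P t - P s)).
      by apply: le_trans (forward st) _; rewrite ler_wpM2r ?expR_ge0// -Bg// yB.
    have -> : expR (C * (P t - P 0)) * ((gamma - C) * g s * expR ((gamma - C) * (P s - P 0))) =
        (gamma - C) * (g s * expR (C * (P t - P s))) * expR (gamma * (P s - P 0)).
      rewrite -!mulrA; rewrite mulrCA; congr (_ * _); rewrite mulrCA; congr (_ * _).
      by rewrite -!expRD; congr expR; ring.
    by rewrite ler_wpM2r ?expR_ge0// ler_wpM2l.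
have h1 := forward zt.
have h2 := ler_wpM2l (y_ge0 zt) h.
have e : expR (gamma * (P t - P 0)) = expR (C * (P t - P 0)) * expR ((gamma - C) * (P t - P 0)).
  by rewrite -expRD; congr expR; ring.
rewrite e; move: h1 h2; move: (y t) (y 0) (expR _) (expR _) => a b d c h1 h2.
have -> : b * (c * d) = b * c + b * (c * (d - 1)) by ring.
by apply: lerD => //; apply: le_trans h2; rewrite le_eqVlt; apply/orP; left; apply/eqP; ring.
Qed.

(** The same with y(0) <= B(s) exp(C (P(s) - P(0))) and negative exponents. It shows that the
    denominator is positive, which the division in [lower_estimate] requires. *)
Lemma denominator_exp : expR (- ((gamma - C) * (P t - P 0))) <=
  1 - (gamma - C) * y 0 * \int[mu]_(tau in `[0, t]) expR (- (gamma * A tau)).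
Proof.
rewrite intNE.
rewrite lerBrDr -lerBrDl.
rewrite -RintegralZl//; last by apply: integrable_segment => s; exact: cexp.
pose F s := - expR (- (gamma - C) * (P s - P 0)).
have := @Rintegral_le_primitive _ (fun s => (gamma - C) * y 0 * expR (- gamma * (P s - P 0)))
    (fun s => - (- (gamma - C) * g s * expR (- (gamma - C) * (P s - P 0)))) F 0 t t0.
have -> : F t - F 0 = 1 - expR (- ((gamma - C) * (P t - P 0))).
  by rewrite /F subrr mulr0 expR0 opprK addrC mulNr.
apply.
- by move=> s st; apply: cvgM; [exact: cvg_cst|exact: cexp].
- move=> s st; apply: cvgN; apply: cvgM; last exact: cexp.
  by apply: cvgM; [exact: cvg_cst|exact: cg].
- by move=> s st; exact: is_deriveN (dexp (- (gamma - C)) st).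
- move=> s st; have -> : - (- (gamma - C) * g s * expR (- (gamma - C) * (P s - P 0))) =
      (gamma - C) * (g s * expR (C * (P s - P 0))) * expR (- gamma * (P s - P 0)).
    rewrite !mulNr opprK -!mulrA; congr (_ * (_ * _)).
    by rewrite -expRD; congr expR; ring.
  by rewrite ler_wpM2r ?expR_ge0// ler_wpM2l// Bexp.
Qed.

Lemma lower_estimate : y 0 * expR (- (gamma * A t)) /
  (1 - (gamma - C) * y 0 * \int[mu]_(tau in `[0, t]) expR (- (gamma * A tau))) <= y t.
Proof.
have h := denominator_exp; move: h; set den := 1 - _ => h.
have den0 : 0 < den by apply: lt_le_trans h; exact: expR_gt0.
rewrite ler_pdivrMr// AE//; apply: le_trans (ler_wpM2l (y_ge0 tt) h).
apply: le_trans (ler_wpM2r (expR_ge0 _) (backward tt)) _.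
by rewrite -mulrA -expRD le_eqVlt; apply/orP; left; apply/eqP; congr (_ * expR _); ring.
Qed.

(** By [Bexp] the derivative of the right side is at least C y(0). *)
Let exp_linear s : 0 <= s <= t -> 1 + C * y 0 * s <= expR (C * (P s - P 0)).
Proof.
move=> /andP[s0 st].
have le u : 0 <= u <= s -> 0 <= u <= t by move=> /andP[-> /le_trans ->].
have := @Rintegral_le_primitive _ (fun u => C * y 0) (fun u => C * g u * expR (C * (P u - P 0)))
   (fun u => expR (C * (P u - P 0))) 0 s s0.
rewrite subrr mulr0 expR0 lerBrDl.
have dl u : 0 <= u <= s -> is_derive u (1 : R) (fun u => C * y 0 * u) (C * y 0).
  move=> _; have h := is_deriveZ (C * y 0) (is_derive_id u (1 : R)).
  by rewrite /GRing.scale /= mulr1 in h.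
rewrite (@Rintegral_primitive _ (fun=> C * y 0) _ 0 s s0 (fun u _ => @cvg_cst _ _ _ _ _) dl).
rewrite mulr0 subr0; apply.
- by move=> u _; exact: cvg_cst.
- move=> u /le us; apply: cvgM; last exact: cexp.
  by apply: cvgM; [exact: cvg_cst|exact: cg].
- by move=> u /le us; exact: dexp.
- by move=> u /le us; rewrite -mulrA ler_wpM2l ?(ltW C0)// Bexp.
Qed.

(** Raising [exp_linear] to the power -gamma/C bounds the integrand by a power of 1 + C y(0) s,
    whose primitive is explicit. Powers are written as exp of ln in order to differentiate them. *)
Lemma denominator_estimate : 1 / ((1 + C * y 0 * t) `^ (gamma / C - 1)) <=
  1 - (gamma - C) * y 0 * \int[mu]_(tau in `[0, t]) expR (- (gamma * A tau)).
Proof.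
rewrite intNE.
rewrite lerBrDr -lerBrDl.
rewrite -RintegralZl//; last by apply: integrable_segment => s; exact: cexp.
pose q s := 1 + C * y 0 * s.
have q0 s : 0 <= s -> 0 < q s.
  by move=> s0; rewrite ltr_pwDl// mulr_ge0// mulr_ge0 ?y_ge0// ltW.
pose F s := - expR (- (gamma / C - 1) * ln (q s)).
have cq s : 0 <= s -> is_derive s (1 : R) (fun s => ln (q s)) ((q s)^-1 * (C * y 0)).
  move=> s0; have dq : is_derive s (1 : R) q (C * y 0).
    have h := is_deriveD (is_derive_cst (1 : R) s (1 : R)) (is_deriveZ (C * y 0) (is_derive_id s (1 : R))).
    by rewrite add0r /GRing.scale /= mulr1 in h.
  exact: (is_derive1_comp (f := @ln R) (is_derive1_ln (q0 _ s0)) dq).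
have de (c : R) s : 0 <= s -> is_derive s (1 : R) (fun s => expR (c * ln (q s)))
    (expR (c * ln (q s)) * (c * ((q s)^-1 * (C * y 0)))).
  move=> s0; have dl := is_deriveZ c (cq s s0).
  exact: (is_derive1_comp (f := expR) (is_derive_expR _) dl).
pose G s := - (expR (- (gamma / C - 1) * ln (q s)) * (- (gamma / C - 1) * ((q s)^-1 * (C * y 0)))).
have GE s : 0 <= s -> G s = (gamma - C) * y 0 * expR (- (gamma / C) * ln (q s)).
  move=> s0; rewrite /G; have -> : (q s)^-1 = expR (- ln (q s)) by rewrite expRN lnK// posrE q0.
  have -> : - (gamma / C) * ln (q s) = - (gamma / C - 1) * ln (q s) + - ln (q s) by ring.
  by rewrite expRD; field; rewrite gt_eqF.
have := @Rintegral_le_primitive _ (fun s => (gamma - C) * y 0 * expR (- gamma * (P s - P 0)))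
    (fun s => (gamma - C) * y 0 * expR (- (gamma / C) * ln (q s))) F 0 t t0.
have -> : F t - F 0 = 1 - 1 / ((1 + C * y 0 * t) `^ (gamma / C - 1)).
  rewrite /F /q mulr0 addr0 ln1 mulr0 expR0 opprK addrC div1r; congr (_ - _).
  by rewrite mulNr expRN /powR gt_eqF// q0.
apply.
- by move=> s st; apply: cvgM; [exact: cvg_cst|exact: cexp].
- move=> s /andP[s0 _]; apply: cvgM; first exact: cvg_cst.
  exact: is_derive_continuous (de (- (gamma / C)) s s0).
- by move=> s /andP[s0 _]; apply: (is_derive_eq (is_deriveN (de _ s s0))); exact: (GE s s0).
- move=> s st; have /andP[s0 _] := st.
  apply: ler_wpM2l; first by rewrite mulr_ge0// y_ge0.
  rewrite ler_expR !mulNr lerN2.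
  have -> : gamma / C * ln (q s) = gamma * (ln (q s) / C) by rewrite mulrAC mulrA.
  rewrite ler_wpM2l//; first by rewrite (le_trans _ Cg)// ltW.
  rewrite ler_pdivrMr// mulrC -ler_expR lnK ?posrE ?q0//.
  exact: exp_linear.
Qed.

End gronwall.

Lemma continuous_segment_bounded (R : realType) (f : R -> R) (a b : R) : a <= b -> continuous f ->
  exists2 K, 0 <= K & forall s, a <= s <= b -> `|f s| <= K.
Proof.
move=> ab cf; have cn : continuous (fun s => `|f s|) by move=> s; apply: cvg_norm; exact: cf.
have [|c _ h] := compact_EVT_max _ (@segment_compact R a b) (continuous_subspaceT cn).
  by exists a => /=; rewrite in_itv /= lexx.
by exists `|f c| => // s sab; apply: h; rewrite inE /= in_itv.
Qed.

(** * Growth bounds for a solution *)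

Section solution.
Variables (R : realType) (phi : int -> plane R -> R[i]).
Hypothesis hphi : littlewood_paley phi.
Variables (T : \bar R) (theta : R -> plane R -> R) (v : R -> 'I_2 -> plane R -> R).
Local Notation D := (time_interval T).
Hypothesis ctheta : continuous_in_besov phi 1 T theta.
Hypothesis jtheta : jointly_continuous T theta.
Hypothesis dtheta : forall t, D t ->
  (forall x : plane R, differentiable (theta t) x) /\ (forall i, lp_recovered phi (partial i (theta t))).
Hypothesis jv : forall k, jointly_continuous T (fun t => v t k).
Hypothesis hv : forall t, D t -> qg_velocity phi (theta t) (v t).
Hypothesis pde : forall (t : R) (x : plane R), 0 < t -> (t%:E < T)%E ->
  derivable (fun r => theta r x) t 1 /\
  derive1 (fun r => theta r x) t + \sum_(k < 2) v t k x * partial k (theta t) x = 0.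
Let B t := fine (besov_norm phi 0 (grad (theta t))).
Let y t := fine (Linf_norm (grad (theta t))).

Lemma time_le a s b : 0 <= a -> D b -> a <= s <= b -> D s.
Proof.
move=> a0 [_ bT] /andP[as_ sb]; split; first exact: le_trans as_.
by apply: le_lt_trans bT; rewrite lee_fin.
Qed.

Lemma solution_besov t : D t -> (besov_norm phi 0 (grad (theta t)) < +oo)%E.
Proof.
by move=> Dt; have [dt rt] := dtheta Dt; apply: besov_gradient_lty => //; have [] := ctheta.1 t Dt.
Qed.

Lemma solution_besov_continuous : {within D, continuous B}.
Proof.
apply/subspace_continuousP => t Dt; apply/cvgrPdist_le => e e0.
pose c := bernstein_cst phi + 1.
have c0 : 0 < c by rewrite ltr_wpDl ?bernstein_cst_ge0.
have H : nbhs (0%E : \bar R) [set z : \bar R | (z < (e / c)%:E)%E].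
  apply: open_nbhs_nbhs; split; first exact: open_ereal_lt_ereal.
  by rewrite /= lte_fin divr_gt0.
have := ctheta.2 t Dt _ H; apply: filterS2 (withinT D _) => r Dr.
rewrite /= => hr.
have [dt rt] := dtheta Dt; have [dr rr] := dtheta Dr.
rewrite distrC; set h := scalar_field _ in hr.
have h1 : (besov_norm phi 1 h < +oo)%E by exact: lt_trans hr (ltry _).
have h2 := besov_gradient_dist hphi (erefl (fun x => theta r x - theta t x)) dr rr dt rt
  (solution_besov Dr) (solution_besov Dt) h1.
apply: (le_trans h2).
have h3 : fine (besov_norm phi 1 h) <= e / c.
  by rewrite -lee_fin fineK ?ge0_fin_numE ?besov_norm_ge0// ltW.
apply: (@le_trans _ _ (c * fine (besov_norm phi 1 h))).
  by apply: ler_wpM2r; [exact/fine_ge0/besov_norm_ge0|rewrite lerDl].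
by rewrite mulrC -ler_pdivlMr.
Qed.

Lemma solution_ge0 t : 0 <= B t /\ 0 <= y t.
Proof. by split; apply: fine_ge0; [exact: besov_norm_ge0|exact: Lnorm_ge0]. Qed.

Lemma solution_le t : D t -> y t <= B t.
Proof. by move=> Dt; have [dt rt] := dtheta Dt; exact: (Linf_le_besov hphi dt rt (solution_besov Dt)). Qed.

Lemma solution_lip t : D t -> forall x z, theta t x - theta t z <= y t * enorm (x - z).
Proof.
move=> Dt x z; have [dt rt] := dtheta Dt; apply: le_trans (ler_norm _) _.
apply: lipschitz_of_speed => // u; exact: (speed_le_Linf hphi dt rt (solution_besov Dt)).
Qed.

Lemma solution_Linf_le t M : D t -> (forall x z, theta t x - theta t z <= M * enorm (x - z)) -> y t <= M.
Proof.
move=> Dt lip; have [dt rt] := dtheta Dt.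
apply: (Linf_le_speed hphi dt rt (solution_besov Dt)) => x; apply: speed_of_lipschitz => // u w.
rewrite ler_norml lip andbT lerNl opprB.
by apply: le_trans (lip w u) _; rewrite /enorm /= -(sqrrN (w.1 - u.1)) -(sqrrN (w.2 - u.2)) !opprB.
Qed.

(** The 2 comes from (|w| + |u|)^2 <= 2 (w^2 + u^2), since the increments of v are bounded by sums
    of coordinate increments. The 1 ensures positivity, as the constant is divided by. *)
Definition growth_cst : R := 2 * riesz_cst phi + 1.

Lemma riesz_cst_ge0 : 0 <= riesz_cst phi.
Proof.
by apply: sumr_ge0 => k _; apply: sumr_ge0 => i _; rewrite mulr_ge0// addr_ge0 ?L1_ge0.
Qed.

Lemma growth_cst_gt0 : 0 < growth_cst.
Proof. by rewrite ltr_wpDl// mulr_ge0// riesz_cst_ge0. Qed.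

Lemma velocity_lip t x z : D t ->
  `|(v t 0 x - v t 0 z) * (x - z).1 + (v t 1 x - v t 1 z) * (x - z).2| <=
  growth_cst * B t * sqn (x - z).
Proof.
move=> Dt; have [dt rt] := dtheta Dt; have [mt mdt] := recovered_moderate dt rt.
have rz i k u := riesz_bound hphi dt mt mdt (solution_besov Dt) (hv Dt) i k u.
have [B0 _] := solution_ge0 t.
have dv k u : differentiable (v t k) u by have [_ _ + _] := hv Dt k; apply.
have L k := lip_partials (fun i u => is_derive_partial i (dv k u)) (fun i u => rz i k u) x z.
move: (L 0) (L 1); rewrite -/(B t) /sqn /growth_cst -[x.1 - z.1]/((x - z).1) -[x.2 - z.2]/((x - z).2).
move: (v t 0 x - v t 0 z) (v t 1 x - v t 1 z) ((x - z).1) ((x - z).2) => p q w u hp hq.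
have r0 : 0 <= riesz_cst phi * B t by rewrite mulr_ge0 ?riesz_cst_ge0.
apply: le_trans (ler_normD _ _) _; rewrite !normrM.
have h1 := ler_wpM2r (normr_ge0 w) hp; have h2 := ler_wpM2r (normr_ge0 u) hq.
apply: le_trans (lerD h1 h2) _.
rewrite -(real_normK (num_real w)) -(real_normK (num_real u)).
have := sqr_ge0 (`|w| - `|u|); have := normr_ge0 w; have := normr_ge0 u.
move: (`|w|) (`|u|) => a c _ _ s.
set r := riesz_cst phi * B t in r0 *.
have -> : (2 * riesz_cst phi + 1) * B t * (a ^+ 2 + c ^+ 2) =
  2 * r * (a ^+ 2 + c ^+ 2) + B t * (a ^+ 2 + c ^+ 2) by rewrite /r; ring.
apply: (@le_trans _ _ (2 * r * (a ^+ 2 + c ^+ 2))).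
  rewrite -subr_ge0 (_ : _ - _ = r * (a - c) ^+ 2); last by ring.
  by rewrite mulr_ge0.
by rewrite lerDl mulr_ge0// addr_ge0// sqr_ge0.
Qed.

Lemma joint_comp (f : R -> plane R -> R) (g : R -> R) :
  jointly_continuous T f -> continuous g -> (forall s, D (g s)) ->
  continuous (fun p : R * plane R => f (g p.1) p.2).
Proof.
move=> jf cg Dg.
have cG : continuous (fun p : R * plane R => (g p.1, p.2)).
  move=> p; apply: (cvg_pair (G := nbhs (g p.1)) (H := nbhs p.2)); last exact: cvg_snd.
  by apply: (@continuous_comp _ _ _ fst g); [exact: cvg_fst|exact: cg].
exact: (@continuous_into_within (R * plane R)%type (R * plane R)%type R _ _ _ cG (fun p => Dg p.1) jf).
Qed.

Lemma clamp_time a b : 0 <= a -> a <= b -> D b -> forall s, D (clamp a b s).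
Proof. by move=> a0 ab Db s; apply: (time_le a0 Db); exact: clamp_itv. Qed.

Lemma besov_bounded a b : 0 <= a -> a <= b -> D b ->
  exists2 K, 0 <= K & forall s, a <= s <= b -> B s <= K.
Proof.
move=> a0 ab Db.
have cB : continuous (fun s => B (clamp a b s)).
  by apply: (continuous_into_within _ _ solution_besov_continuous);
    [exact: clamp_continuous|exact: clamp_time].
have [K K0 hK] := continuous_segment_bounded ab cB.
by exists K => // s sab; apply: le_trans (ler_norm _) _; have := hK s sab; rewrite clamp_id.
Qed.

Lemma joint_slice (f : R -> plane R -> R) (g : R -> R) x :
  jointly_continuous T f -> continuous g -> (forall s, D (g s)) -> continuous (fun s => f (g s) x).
Proof.
move=> jf cg Dg s; have := joint_comp jf cg Dg.
move=> c; apply: (@continuous_comp _ _ _ (fun s : R => (s, x)) (fun p : R * plane R => f (g p.1) p.2));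
  last exact: c.
by apply: (cvg_pair (G := nbhs s) (H := nbhs x)); [exact: cvg_id|exact: cvg_cst].
Qed.

(** v may grow linearly: joint continuity bounds it at the origin over a compact time interval, and
    [velocity_lip] does the rest. *)
Lemma velocity_growth a b : 0 <= a -> a <= b -> D b ->
  exists2 W, 0 <= W & forall t x, a <= t <= b ->
  `|v t 0 x * x.1 + v t 1 x * x.2| <= W * (1 + sqn x).
Proof.
move=> a0 ab Db; have [K K0 hK] := besov_bounded a0 ab Db.
have V k := continuous_segment_bounded ab
  (@joint_slice (fun t => v t k) _ (0 : plane R) (@jv k) (@clamp_continuous R a b) (@clamp_time a b a0 ab Db)).
have [V0 V00 h0] := V 0; have [V1 V10 h1] := V 1.
have C0 := ltW growth_cst_gt0.
exists (V0 + V1 + growth_cst * K) => [|t x tab]; first by rewrite !addr_ge0// mulr_ge0.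
have Dt := time_le a0 Db tab.
have := velocity_lip x 0 Dt; rewrite !subr0.
have := h0 t tab; have := h1 t tab; rewrite !clamp_id//.
move: (v t 0 0) (v t 1 0) (v t 0 x) (v t 1 x) => p q u w hq hp huw.
have -> : u * x.1 + w * x.2 = ((u - p) * x.1 + (w - q) * x.2) + (p * x.1 + q * x.2) by ring.
have S0 := sqn_ge0 x.
have E (c : R) : c ^+ 2 <= sqn x -> `|c| <= 1 + sqn x.
  move=> h; rewrite -(real_normK (num_real c)) in h.
  have := sqr_ge0 (`|c| - 1); have := normr_ge0 c; move: h S0; move: (`|c|) (sqn x) => d e h1' h2' h3' h4'.
  nra.
have e1 : `|x.1| <= 1 + sqn x by apply: E; rewrite lerDl sqr_ge0.
have e2 : `|x.2| <= 1 + sqn x by apply: E; rewrite lerDr sqr_ge0.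
apply: le_trans (ler_normD _ _) _; rewrite [leRHS]mulrDl [leRHS]addrC; apply: lerD; last first.
  apply: le_trans (ler_normD _ _) _; rewrite !normrM [leRHS]mulrDl; apply: lerD.
    exact: ler_pM.
  exact: ler_pM.
apply: le_trans huw _; apply: ler_pM => //; last by rewrite lerDr.
  by rewrite mulr_ge0//; have [] := solution_ge0 t.
by rewrite ler_wpM2l// hK.
Qed.

Lemma transport_derivative t x : 0 < t -> D t -> is_derive t (1 : R) (fun s => theta s x)
  (- (v t 0 x * partial 0 (theta t) x + v t 1 x * partial 1 (theta t) x)).
Proof.
move=> t0 [_ tT]; have [d e] := pde x t0 tT.
apply: DeriveDef => //; rewrite -derive1E; move/eqP: e; rewrite addr_eq0 => /eqP ->.
congr (- _); rewrite big_ord_recl big_ord1.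
by rewrite (_ : lift ord0 ord0 = 1 :> 'I_2)//; exact: val_inj.
Qed.

Lemma solution_lip_bound a b K : 0 <= a -> D b -> (forall s, a <= s <= b -> B s <= K) ->
  forall t x z, a <= t <= b -> theta t x - theta t z <= K * enorm (x - z).
Proof.
move=> a0 Db hK t x z tab; have Dt := time_le a0 Db tab.
apply: le_trans (solution_lip Dt x z) _; apply: ler_wpM2r; first exact: sqrtr_ge0.
exact: le_trans (solution_le Dt) (hK t tab).
Qed.

Lemma growth_forward a b (P : R -> R) : 0 <= a -> a <= b -> D b ->
  (forall s, a <= s <= b -> is_derive s (1 : R) P (B s)) ->
  y b <= y a * expR (growth_cst * (P b - P a)).
Proof.
move=> a0 ab Db dP; have Da : D a by apply: (time_le a0 Db); rewrite lexx.
have [K K0 hK] := besov_bounded a0 ab Db; have [W W0 hW] := velocity_growth a0 ab Db.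
have [_ ya] := solution_ge0 a.
apply: (solution_Linf_le Db) => x z; rewrite mulrBr.
apply: (@doubling _ a b (y a) K W (fun t => growth_cst * B t) (fun t => growth_cst * P t) theta v ab ya K0 W0).
- exact: (joint_comp (@jtheta) (@clamp_continuous R a b) (@clamp_time a b a0 ab Db)).
- by move=> t u tab; have [] := dtheta (time_le a0 Db tab).
- move=> t u /andP[at_ tb]; apply: transport_derivative; first exact: le_lt_trans at_.
  by apply: (time_le a0 Db); rewrite (ltW at_).
- by move=> t tab; exact: (is_deriveZ growth_cst (dP t tab)).
- exact: solution_lip_bound.
- exact: solution_lip.
- by move=> t u w tab; have := velocity_lip u w (time_le a0 Db tab); rewrite ler_norml => /andP[].
- by move=> t u tab; have := hW t u tab; rewrite ler_norml => /andP[].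
Qed.

(** Doubling for theta(a + b - t) with velocity -v. The reversed final time is a, where the
    transport equation must hold, so a has to be positive. *)
Lemma lip_backward a b (P : R -> R) : 0 < a -> a <= b -> D b ->
  (forall s, a <= s <= b -> is_derive s (1 : R) P (B s)) ->
  forall x z, theta a x - theta a z <= y b * expR (growth_cst * (P b - P a)) * enorm (x - z).
Proof.
move=> a_gt0 ab Db dP x z; have a0 := ltW a_gt0.
have [K K0 hK] := besov_bounded a0 ab Db; have [W W0 hW] := velocity_growth a0 ab Db.
have [_ yb] := solution_ge0 b.
have rev t : a <= t <= b -> a <= a + b - t <= b.
  by move=> /andP[h1 h2]; rewrite lerBrDr lerD2l h2 lerBlDr addrC lerD2l h1.
have aE : a + b - a = b by rewrite addrAC subrr add0r.
have bE : a + b - b = a by rewrite addrK.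
have := @doubling _ a b (y b) K W (fun t => growth_cst * B (a + b - t))
  (fun t => - (growth_cst * P (a + b - t))) (fun t => theta (a + b - t))
  (fun t k u => - v (a + b - t) k u) ab yb K0 W0.
rewrite aE bE (_ : - (growth_cst * P a) - - (growth_cst * P b) = growth_cst * (P b - P a)); last by ring.
apply.
- apply: (joint_comp (g := fun s => a + b - clamp a b s) (@jtheta)).
    by move=> s; apply: cvgB; [exact: cvg_cst|exact: clamp_continuous].
  by move=> s; apply: (time_le a0 Db); apply: rev; exact: clamp_itv.
- by move=> t u tab; have [] := dtheta (time_le a0 Db (rev t tab)).
- move=> t u /andP[at_ tb].
  have rt : a <= a + b - t <= b by apply: rev; rewrite (ltW at_).
  have rt0 : 0 < a + b - t by apply: lt_le_trans a_gt0 _; case/andP: rt.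
  have dr : is_derive t (1 : R) (fun s => a + b - s) (-1).
    by have h := is_deriveB (is_derive_cst (a + b) t (1 : R)) (is_derive_id t (1 : R)); rewrite sub0r in h.
  have h := is_derive1_comp (f := fun s => theta s u) (g := fun s => a + b - s) (transport_derivative u rt0 (time_le a0 Db rt)) dr.
  by apply: (is_derive_eq h); ring.
- move=> t tab.
  have dr : is_derive t (1 : R) (fun s => a + b - s) (-1).
    by have h := is_deriveB (is_derive_cst (a + b) t (1 : R)) (is_derive_id t (1 : R)); rewrite sub0r in h.
  have h := is_deriveN (is_deriveZ growth_cst (is_derive1_comp (f := P) (g := fun s => a + b - s) (dP _ (rev t tab)) dr)).
  by apply: (is_derive_eq h); rewrite /GRing.scale /=; ring.
- by move=> t u w tab; exact: (solution_lip_bound a0 Db hK u w (rev t tab)).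
- exact: solution_lip.
- move=> t u w tab; have := velocity_lip u w (time_le a0 Db (rev t tab)).
  rewrite ler_norml => /andP[_ h]; rewrite lerNl; apply: le_trans h.
  by rewrite le_eqVlt; apply/orP; left; apply/eqP; ring.
- move=> t u tab; have := hW _ u (rev t tab).
  rewrite ler_norml => /andP[_ h]; rewrite lerNl; apply: le_trans h.
  by rewrite le_eqVlt; apply/orP; left; apply/eqP; ring.
Qed.

Lemma growth_backward b (P : R -> R) : D b ->
  (forall s, 0 <= s <= b -> is_derive s (1 : R) P (B s)) ->
  y 0 <= y b * expR (growth_cst * (P b - P 0)).
Proof.
move=> Db dP; have b0 : 0 <= b by have [] := Db.
have D0 : D 0 by apply: (time_le (lexx 0) Db); rewrite lexx.
move: (b0); rewrite le_eqVlt => /predU1P[b_0|b_gt0].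
  by rewrite -b_0 subrr mulr0 expR0 mulr1.
(* The bound from time b / (n + 1) is passed to the limit at fixed x and z, using only continuity of
   theta and of [P]. *)
apply: (solution_Linf_le D0) => x z.
pose u n : R := b * n.+1%:R^-1.
have u0 n : 0 < u n by rewrite mulr_gt0// invr_gt0.
have ub n : u n <= b by rewrite ger_pMr// invf_le1// ler1n.
have uc : u @ \oo --> 0.
  by rewrite -(mulr0 b); apply: cvgM; [exact: cvg_cst|exact: (@inv_succ_cvg0 R)].
have ct w : (fun n => theta (u n) w) @ \oo --> theta 0 w.
  have c := @joint_slice theta _ w (@jtheta) (@clamp_continuous R 0 b) (@clamp_time 0 b (lexx 0) b0 Db).
  have -> : (fun n => theta (u n) w) = (fun n => theta (clamp 0 b (u n)) w).
    by apply/funext => n; rewrite clamp_id// ub ltW.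
  rewrite -[X in _ --> theta X w](@clamp_id R 0 b 0) ?lexx//.
  exact: (continuous_cvg _ (@c 0) uc).
have cP : (fun n => P (u n)) @ \oo --> P 0.
  apply: continuous_cvg => //; apply: is_derive_continuous (dP 0 _); by rewrite lexx.
have cr : (fun n => y b * expR (growth_cst * (P b - P (u n))) * enorm (x - z)) @ \oo -->
    y b * expR (growth_cst * (P b - P 0)) * enorm (x - z).
  apply: cvgM; last exact: cvg_cst.
  apply: cvgM; first exact: cvg_cst.
  apply: continuous_cvg; first exact: continuous_expR.
  by apply: cvgM; [exact: cvg_cst|apply: cvgB; [exact: cvg_cst|exact: cP]].
apply: (ler_cvg_to (cvgB (ct x) (ct z)) cr); apply: nearW => n.
apply: lip_backward => // s /andP[us sb]; apply: dP; rewrite sb andbT.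
exact: le_trans (ltW (u0 n)) us.
Qed.

End solution.

Theorem theorem1p4 (R : realType) (phi : int -> plane R -> R[i])
    (hphi : littlewood_paley phi) :
  exists2 C0 : R, 0 < C0 &
  forall (T : \bar R) (theta0 : plane R -> R) (theta : R -> plane R -> R),
    (0 < T)%E ->
    in_besov phi 1 (scalar_field theta0) ->
    continuous_in_besov phi 1 T theta ->
    qg_classical_solution phi T theta0 theta ->
    let y0 : R := fine (Linf_norm (grad theta0)) in
    let y : R -> R := fun t => fine (Linf_norm (grad (theta t))) in
    let B : R -> R := fun t => fine (besov_norm phi 0 (grad (theta t))) in
    let A : R -> R := fun t => \int[lebesgue_measure]_(tau in `[0, t]) B tau in
    forall t gamma : R, 0 <= t -> (t%:E < T)%E -> C0 <= gamma ->
    [/\ y t <=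
          y0 * expR (gamma * A t) /
          (1 + (gamma - C0) * y0 *
               \int[lebesgue_measure]_(tau in `[0, t]) expR (gamma * A tau)),
        y t >=
          y0 * expR (- (gamma * A t)) /
          (1 - (gamma - C0) * y0 *
               \int[lebesgue_measure]_(tau in `[0, t]) expR (- (gamma * A tau)))
      & 1 - (gamma - C0) * y0 *
               \int[lebesgue_measure]_(tau in `[0, t]) expR (- (gamma * A tau))
          >= 1 / ((1 + C0 * y0 * t) `^ (gamma / C0 - 1))].
Proof.
exists (growth_cst phi); first exact: growth_cst_gt0.
move=> T theta0 theta T0 hth0 cth sol y0 y B A t gamma t0 tT Cg.
have [e0 jth dth [v [jv hv pde]]] := sol.
have Dt : time_interval T t by [].
have -> : y0 = y 0 by rewrite /y0 /y; congr (fine (Linf_norm (grad _))); apply/funext => x; rewrite e0.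
have cB := solution_besov_continuous hphi cth dth.
(* B is extended by constants outside [0, t], so that its primitive has two-sided derivatives at
   both ends. *)
have cg : continuous (fun s => B (clamp 0 t s)).
  by apply: (continuous_into_within _ _ cB);
    [exact: clamp_continuous|exact: (@clamp_time R T 0 t (lexx 0) t0 Dt)].
(* Any base point below 0 would do: [P] enters only through differences. *)
have [P dP] := primitive_exists (-1) cg.
have dPg s : 0 <= s <= t -> is_derive s (1 : R) P (B (clamp 0 t s)).
  by move=> /andP[s0 _]; apply: dP; apply: lt_le_trans s0; rewrite ltrN10.
have dPB s : 0 <= s <= t -> is_derive s (1 : R) P (B s).
  by move=> st; have := dPg s st; rewrite clamp_id.
have Bg s : 0 <= s <= t -> B s = B (clamp 0 t s) by move=> st; rewrite clamp_id.
have D s : 0 <= s <= t -> time_interval T s by exact: (@time_le R T 0 s t (lexx 0) Dt).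
have yge s : 0 <= s <= t -> 0 <= y s by move=> _; exact: (solution_ge0 phi theta s).2.
have yB s : 0 <= s <= t -> y s <= B s by move=> st; exact: (solution_le hphi cth dth (D s st)).
have GF := @growth_forward R phi hphi T theta v cth jth dth jv hv pde.
have GB := @growth_backward R phi hphi T theta v cth jth dth jv hv pde.
have fwd s : 0 <= s <= t -> y t <= y s * expR (growth_cst phi * (P t - P s)).
  move=> /andP[s0 st].
  have dP' u : s <= u <= t -> is_derive u (1 : R) P (B u).
    by move=> /andP[su ut]; apply: dPB; rewrite ut (le_trans s0).
  exact: (GF s t P s0 st Dt dP').
have bwd s : 0 <= s <= t -> y 0 <= y s * expR (growth_cst phi * (P s - P 0)).
  move=> st; have /andP[_ st'] := st.
  have dP' u : 0 <= u <= s -> is_derive u (1 : R) P (B u).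
    by move=> /andP[u0 us]; apply: dPB; rewrite u0 (le_trans us).
  exact: (GB s P (D s st) dP').
have C0 := growth_cst_gt0 phi.
split.
- exact: (upper_estimate t0 Cg cg dPg Bg yge yB fwd).
- exact: (lower_estimate t0 Cg cg dPg Bg yge yB bwd).
- exact: (denominator_estimate t0 C0 Cg cg dPg Bg yge yB bwd).
Qed.
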